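(* Let $V(z)=\gamma+\int_0^\infty\frac{d\sigma(t)}{t-z}$ belong to the class $SL_0(R)$ (with $\gamma\in(-\infty,+\infty)$), and suppose that $\sigma(t)$ is the distribution function of an operator pair $\tilde B_\theta$, $\tilde B$ in $L_2[a,+\infty)$, where $\tilde B$ is the symmetric operator $\tilde By=-y''+q(x)y$, $y(a)=y'(a)=0$, and $\tilde B_\theta$ is its positive self-adjoint extension $\tilde B_\theta y=-y''+q(x)y$, $y'(a)=\theta y(a)$. Then there exist a unique Schrödinger operator $T_h$ with $\operatorname{Im}h>0$, $$T_hy=-y''+q(x)y,\qquad y'(a)=hy(a),$$ a unique $( * )$-extension $\mathbb A$ of $T_h$ of the form $$\mathbb A y=-y''+q(x)y-\frac{1}{\mu-h}\,[y'(a)-hy(a)]\,[\mu\delta(x-a)+\delta'(x-a)],\qquad \mu\in[-\infty,+\infty],$$ a unique operator $K:\mathbb C\to\mathcal H_-$, $Kc=cg$, with $g=\frac{(\operatorname{Im}h)^{1/2}}{|\mu-h|}[\mu\delta(x-a)+\delta'(x-a)]$ (so that $K^*y=(y,g)$, $y\in\mathcal H_+$), and hence a unique rigged canonical system of the Livsic type $$\Theta=\begin{pmatrix}\mathbb A&K&1\\ \mathcal H_+\subset L_2[a,+\infty)\subset\mathcal H_-&&\mathbb C\end{pmatrix}$$ such that $V(z)$ is realized by $\Theta$, i.e. $V(z)=V_\Theta(z)$.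
   Context: Class $SL_0(R)$: scalar functions $V(z)=\gamma+\int_0^\infty\frac{d\sigma(t)}{t-z}$ with $\gamma$ an arbitrary real number and $\sigma$ a non-decreasing function on $[0,+\infty)$ such that $\int_0^\infty d\sigma(t)=\infty$ and $\int_0^\infty\frac{d\sigma(t)}{1+t}<\infty$. Differential operators: $q$ is a real locally summable function on $[a,+\infty)$, $l(y)=-y''+q(x)y$, and $D^*$ is the set of functions $y\in L_2[a,+\infty)$ that are locally absolutely continuous together with $y'$ and satisfy $l(y)\in L_2[a,+\infty)$. All operators $\tilde B,\tilde B_\theta,T_h$ act as $l$ on the elements of $D^*$ satisfying the indicated boundary condition. The symmetric operator $\tilde B$ is assumed to have deficiency indices $(1,1)$. $\theta$ is real. Distribution function of the pair: a non-decreasing $\sigma$ on $[0,+\infty)$ is the distribution function of the pair $\tilde B_\theta,\tilde B$ if there is an isometric one-to-one correspondence $U$ of $L_2[a,+\infty)$ onto $L_2^\sigma[0,+\infty)$ under which $\tilde B_\theta$ is unitarily equivalent to the multiplication operator $\Lambda_\sigma\varphi(\lambda)=\lambda\varphi(\lambda)$ in $L_2^\sigma[0,+\infty)$, while $\tilde B$ is unitarily equivalent to the symmetric operator $\Lambda^0_\sigma$, the restriction of $\Lambda_\sigma$ to those $\varphi$ in its domain with $\int_0^\infty\varphi(\lambda)\,d\sigma(\lambda)=0$. Rigged space: $\mathcal H=L_2[a,+\infty)$, $\mathcal H_+=D(\tilde B^* )=D^*$ with inner product $(y,z)_+=\int_a^\infty(y\bar z+l(y)\overline{l(z)})\,dx$,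 and $\mathcal H_-$ is the corresponding negative space, $\mathcal H_+\subset\mathcal H\subset\mathcal H_-$. The elements $\delta(x-a),\delta'(x-a)\in\mathcal H_-$ are the functionals with $(y,\delta(x-a))=y(a)$, $(y,\delta'(x-a))=-y'(a)$ for $y\in\mathcal H_+$. For $\mu=\pm\infty$ the formulas for $\mathbb A$ and $g$ are understood as limits, i.e. $\mathbb Ay=-y''+qy-[y'(a)-hy(a)]\delta(x-a)$ and $g=(\operatorname{Im}h)^{1/2}\delta(x-a)$. $( * )$-extension: with $A=\tilde B$ and $T=T_h$, a bounded operator $\mathbb A:\mathcal H_+\to\mathcal H_-$ is a $( * )$-extension of $T$ if $\mathbb A\supset T\supset A$, $\mathbb A^*\supset T^*\supset A$, and $\operatorname{Re}\mathbb A=\frac12(\mathbb A+\mathbb A^* )$ is a self-adjoint bi-extension of $A$, i.e. $\operatorname{Re}\mathbb A$ extends $A$ and its restriction to $\{f\in\mathcal H_+:\operatorname{Re}\mathbb A f\in\mathcal H\}$ is self-adjoint in $\mathcal H$. A rigged canonical system of the Livsic type $\Theta$ as displayed (direction operator $J=1$, $E=\mathbb C$) requires $K\in[\mathbb C,\mathcal H_-]$ and $\operatorname{Im}\mathbb A=\frac{1}{2i}(\mathbb A-\mathbb A^* )=KK^*$. Its associated function is $V_\Theta(z)=K^*(\operatorname{Re}\mathbb A-zI)^{-1}K$. *)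

(* Defs.v *)
From HB Require Import structures.
From mathcomp Require Import all_boot all_order all_algebra.
From mathcomp Require Import all_classical all_reals all_analysis.
From mathcomp Require Import complex.

Set Implicit Arguments.
Unset Strict Implicit.
Unset Printing Implicit Defensive.

Import Order.TTheory GRing.Theory Num.Theory.
Import numFieldNormedType.Exports.

Local Open Scope classical_set_scope.
Local Open Scope ring_scope.
Local Open Scope complex_scope.

Local Notation Re := complex.Re.
Local Notation Im := complex.Im.
Import ComplexField.Normc.

(* Only the values on [0, +oo[ matter. *)
Record distr_fun (R : realType) := DistrFun {
  distr_val :> R -> R;
  distr_nd : forall s t, 0 <= s -> s <= t -> distr_val s <= distr_val t }.

(* sigma(t+0) for t >= 0 and sigma(0) for t < 0: the Stieltjes measure of this
   right-continuous function is dsigma on [0, +oo[, with mass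
   sigma(0+0) - sigma(0) at the origin, and it vanishes on ]-oo, 0[. *)
Definition rcont_distr (R : realType) (sigma : distr_fun R) (t : R) : R :=
  if t < 0 then sigma 0 else inf (sigma @` `]t, +oo[).

Section rcont_distr_cumulative.
Context {R : realType} (sigma : distr_fun R).

Let img_lb t : 0 <= t -> lbound (sigma @` `]t, +oo[) (sigma t).
Proof.
move=> t0 _ [s + <-]; rewrite /= in_itv/= andbT => ts.
by apply: distr_nd => //; exact: ltW.
Qed.

Let img_ne t : sigma @` `]t, +oo[ !=set0.
Proof. by exists (sigma (t + 1)), (t + 1) => //; rewrite /= in_itv/= andbT ltrDl. Qed.

Let rcont_le t s : 0 <= t -> t < s -> rcont_distr sigma t <= sigma s.
Proof.
move=> t0 ts; rewrite /rcont_distr ltNge t0/=; apply: ge_inf.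
  by exists (sigma t); exact: img_lb.
by exists s => //; rewrite /= in_itv/= andbT.
Qed.

Let rcont_ge t : 0 <= t -> sigma t <= rcont_distr sigma t.
Proof.
move=> t0; rewrite /rcont_distr ltNge t0/=; apply: lb_le_inf => //.
exact: img_lb.
Qed.

Let rcont_nd : nondecreasing (rcont_distr sigma).
Proof.
move=> s t st.
have [t0|t0] := ltP t 0; first by rewrite /rcont_distr t0 (le_lt_trans st t0).
have [s0|s0] := ltP s 0.
  rewrite {1}/rcont_distr s0; apply: le_trans (rcont_ge t0).
  exact: distr_nd.
move: st; rewrite le_eqVlt => /predU1P[->//|st].
exact: le_trans (rcont_le s0 st) (rcont_ge t0).
Qed.

Let rcont_rc : right_continuous (rcont_distr sigma).
Proof.
move=> t; apply/(@cvgrPdist_le _ R^o) => e e0.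
have [t0|t0] := ltP t 0.
  near=> s; have s0 : s < 0 by near: s; exact: nbhs_right_lt.
  by rewrite /rcont_distr t0 s0 subrr normr0 ltW.
have [_ [u + <-] ule] : exists2 r, (sigma @` `]t, +oo[) r &
    r < rcont_distr sigma t + e.
  rewrite /rcont_distr ltNge t0/=; apply: inf_adherent => //.
  by split; [exact: img_ne | exists (sigma t); exact: img_lb].
rewrite /= in_itv/= andbT => tu.
near=> s.
have ts : t < s by near: s; exact: nbhs_right_gt.
have su : s < u by near: s; exact: nbhs_right_lt.
rewrite distrC ger0_norm ?subr_ge0 ?rcont_nd ?(ltW ts)//.
rewrite lerBlDl; apply: le_trans (ltW ule).
by apply: rcont_le => //; exact: le_trans t0 (ltW ts).
Unshelve. all: by end_near. Qed.

HB.instance Definition _ :=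
  isCumulative.Build R _ R (rcont_distr sigma) rcont_nd rcont_rc.

Definition distr_measure : {measure set (measurableTypeR R) -> \bar R} :=
  lebesgue_stieltjes_measure (rcont_distr sigma).

End rcont_distr_cumulative.

(* Vectors of L_2 are represented by functions; everything below is invariant
   under (and operators are saturated for) equality almost everywhere on D. *)
Section L2.
Context {R : realType}.
Variables (m : {measure set (measurableTypeR R) -> \bar R}) (D : set R).
Implicit Types (f g u v : R -> R[i]).

Definition cintegral f : R[i] :=
  Rintegral m D (fun x => Re (f x)) +i* Rintegral m D (fun x => Im (f x)).

Definition inL2 f : Prop :=
  [/\ measurable_fun D (fun x => Re (f x)),
      measurable_fun D (fun x => Im (f x)) &
      (\int[m]_(x in D) (normc (f x) ^+ 2)%:E < +oo)%E].

Definition dotp f g : R[i] := cintegral (fun x => f x * (g x)^*).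

Definition aeq f g : Prop := ae_eq m D f g.

(* Operators are given by their graphs. *)
Definition graph := set ((R -> R[i]) * (R -> R[i])).
Implicit Types (G : graph).

Definition adjoint G : graph :=
  [set p | [/\ inL2 p.1, inL2 p.2 &
    forall f g, G (f, g) -> dotp g p.1 = dotp f p.2]].

Definition symmetric_op G : Prop := G `<=` adjoint G.

Definition selfadjoint_op G : Prop := G = adjoint G.

Definition nonneg_op G : Prop := forall f g, G (f, g) -> 0 <= dotp g f.

Definition one_dimensional (N : set (R -> R[i])) : Prop :=
  exists2 u, N u /\ ~ aeq u (fun=> 0) &
    forall v, N v -> exists c : R[i], aeq v (fun x => c * u x).

Definition deficiency_space G (z : R[i]) : set (R -> R[i]) :=
  [set u | adjoint G (u, fun x => z * u x)].

Definition deficiency_indices_11 G : Prop :=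
  one_dimensional (deficiency_space G 'i) /\
  one_dimensional (deficiency_space G (- 'i)).

End L2.

Arguments graph R : clear implicits.

Definition abs_cont (R : realType) (c d : R) (f : R -> R[i]) : Prop :=
  forall e : R, 0 < e -> exists2 del : R, 0 < del &
    forall (n : nat) (u v : 'I_n -> R),
      (forall i, [/\ c <= u i, u i <= v i & v i <= d]) ->
      (forall i j, i != j -> v i <= u j \/ v j <= u i) ->
      \sum_(i < n) (v i - u i) < del ->
      \sum_(i < n) normc (f (v i) - f (u i)) < e.

Section Schroedinger.
Context {R : realType}.
Variables (a : R) (q : R -> R).
Implicit Types (y z f g u v : R -> R[i]) (h : R[i]).

Local Notation lambda := (@lebesgue_measure R).
Local Notation Ia := (`[a, +oo[%classic : set R).

Definition locally_summable : Prop :=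
  forall b, a <= b -> lambda.-integrable `[a, b] (EFin \o q).

Definition L2a f := inL2 lambda Ia f.
Definition dota f g := dotp lambda Ia f g.
Definition aeqa f g := aeq lambda Ia f g.

Definition loc_abs_cont f : Prop := forall b, a <= b -> abs_cont a b f.

(* Difference quotients are taken within [a, +oo[, so the derivative at a is
   one-sided and the values of the function off [a, +oo[ are irrelevant. *)
Definition diffquo (r : R -> R) (x t : R) : R := (r t - r x) / (t - x).

Definition rderivable (r : R -> R) (x : R) : Prop :=
  cvg (diffquo r x t @[t --> within Ia x^']).

Definition rderiv (r : R -> R) (x : R) : R :=
  lim (diffquo r x t @[t --> within Ia x^']).

Definition cderivable y (x : R) : Prop :=
  rderivable (fun t => Re (y t)) x /\ rderivable (fun t => Im (y t)) x.

Definition cderiv y (x : R) : R[i] :=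
  rderiv (fun t => Re (y t)) x +i* rderiv (fun t => Im (y t)) x.

(* The second derivative exists almost everywhere on Dstar. *)
Definition ell y (x : R) : R[i] := - cderiv (cderiv y) x + (q x)%:C * y x.

Definition Dstar y : Prop :=
  [/\ L2a y, loc_abs_cont y, (forall x, a <= x -> cderivable y x),
      loc_abs_cont (cderiv y) & L2a (ell y)].

Definition schr_op (bc : R[i] -> R[i] -> Prop) : graph R :=
  [set p | [/\ L2a p.1, L2a p.2 &
    exists y, [/\ Dstar y, bc (y a) (cderiv y a), aeqa p.1 y &
                  aeqa p.2 (ell y)]]].

Definition B_op : graph R := schr_op (fun c0 c1 => c0 = 0 /\ c1 = 0).

(* h = theta real gives the extension B_theta. *)
Definition T_op h : graph R := schr_op (fun c0 c1 => c1 = h * c0).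

Definition dotplus y z : R[i] := dota y z + dota (ell y) (ell z).
Definition normplus y : R := Num.sqrt (Re (dotplus y y)).

(* F in H_- is identified with the bounded antilinear functional
   y |-> (F, y) on H_+; the pairing (y, F) is the conjugate of F y. *)
Definition functional := (R -> R[i]) -> R[i].
Implicit Types (F : functional).

Definition in_Hminus F : Prop :=
  (forall (k : R[i]) y z, Dstar y -> Dstar z ->
     F (fun x => k * y x + z x) = k^* * F y + F z) /\
  (exists C : R, forall y, Dstar y -> normc (F y) <= C * normplus y).

Definition eq_Hminus F F' : Prop := forall z, Dstar z -> F z = F' z.

Definition pairing y F : R[i] := (F y)^*.

Definition embed f : functional := fun z => dota f z.

Definition delta : functional := fun z => (z a)^*.
Definition delta' : functional := fun z => - (cderiv z a)^*.

(* Operators H_+ -> H_-. *)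
Definition pmop := (R -> R[i]) -> functional.
Implicit Types (A : pmop).

Definition bounded_pm A : Prop :=
  [/\ forall y, Dstar y -> in_Hminus (A y),
      forall (k : R[i]) y z, Dstar y -> Dstar z ->
        eq_Hminus (A (fun x => k * y x + z x)) (fun w => k * A y w + A z w) &
      exists C : R, forall y w, Dstar y -> Dstar w ->
        normc (A y w) <= C * normplus y * normplus w].

(* (A y, z) = (y, A^* z) *)
Definition adj_pm A : pmop := fun z y => (A y z)^*.

Definition Re_pm A : pmop := fun y z => (A y z + adj_pm A y z) / 2%:R.
Definition Im_pm A : pmop := fun y z => (A y z - adj_pm A y z) / (2%:R * 'i).

(* The restriction of A to {y in H_+ | A y in H}, as an operator in H. *)
Definition restr_H A : graph R :=
  [set p | [/\ L2a p.1, L2a p.2 &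
    exists y, [/\ Dstar y, aeqa p.1 y & eq_Hminus (A y) (embed p.2)]]].

Definition extends A (G : graph R) : Prop := G `<=` restr_H A.

Definition selfadjoint_biextension A (G : graph R) : Prop :=
  [/\ bounded_pm A, extends A G & selfadjoint_op lambda Ia (restr_H A)].

Definition star_extension A (T : graph R) : Prop :=
  let Tadj := adjoint lambda Ia T in
  [/\ bounded_pm A,
      extends A T /\ B_op `<=` T,
      extends (adj_pm A) Tadj /\ B_op `<=` Tadj &
      selfadjoint_biextension (Re_pm A) B_op].

(* The infinite values of mu give the limit expressions. *)
Definition A_form h (mu : \bar R) : pmop := fun y z =>
  match mu with
  | EFin r => dota (ell y) z
      - (r%:C - h)^-1 * (cderiv y a - h * y a) * (r%:C * delta z + delta' z)
  | _ => dota (ell y) z - (cderiv y a - h * y a) * delta z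
  end.

Definition g_form h (mu : \bar R) : functional := fun z =>
  match mu with
  | EFin r => (Num.sqrt (Im h) / normc (r%:C - h))%:C
              * (r%:C * delta z + delta' z)
  | _ => (Num.sqrt (Im h))%:C * delta z
  end.

Definition channel := R[i] -> functional.
Implicit Types (K : channel).

Definition bounded_channel K : Prop :=
  (forall c, in_Hminus (K c)) /\
  (forall k c c', eq_Hminus (K (k * c + c')) (fun z => k * K c z + K c' z)).

(* (K c, y) = c * (K^* y)^* *)
Definition adj_channel K y : R[i] := pairing y (K 1).

Definition livsic_system (T : graph R) A K : Prop :=
  [/\ star_extension A T, bounded_channel K &
      forall y, Dstar y -> eq_Hminus (Im_pm A y) (K (adj_channel K y))].

Definition shifted A (z : R[i]) : pmop :=
  fun y w => A y w - z * embed y w.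

(* w = K^* (Re A - z)^{-1} K: Re A - z is injective on H_+, K 1 lies in its
   range, and K^* maps the preimage of K 1 to w. *)
Definition transfer_value A K (z w : R[i]) : Prop :=
  (forall y, Dstar y -> eq_Hminus (shifted (Re_pm A) z y) (fun=> 0) ->
     forall x, a <= x -> y x = 0) /\
  (exists y, [/\ Dstar y, eq_Hminus (shifted (Re_pm A) z y) (K 1) &
                 w = adj_channel K y]).

(* Functions of the class SL_0(R) are defined on the complement of [0, +oo[;
   ~~ (0 <= z) says that z is not a non-negative real number. *)
Definition realized (V : R[i] -> R[i]) A K : Prop :=
  forall z : R[i], ~~ (0 <= z) -> transfer_value A K z (V z).

Definition schr_realization (V : R[i] -> R[i]) h A K : Prop :=
  [/\ 0 < Im h,
      exists mu : \bar R,
        (forall y, Dstar y -> eq_Hminus (A y) (A_form h mu y)) /\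
        in_Hminus (g_form h mu) /\
        (forall c, eq_Hminus (K c) (fun z => c * g_form h mu z)),
      livsic_system (T_op h) A K &
      realized V A K].

Definition mult_op (sigma : distr_fun R) : graph R :=
  let L2s := inL2 (distr_measure sigma) `[0, +oo[ in
  [set p | [/\ L2s p.1, L2s p.2 &
    aeq (distr_measure sigma) `[0, +oo[ p.2 (fun t => t%:C * p.1 t)]].

Definition mult0_op (sigma : distr_fun R) : graph R :=
  [set p | mult_op sigma p /\
    cintegral (distr_measure sigma) `[0, +oo[ p.1 = 0].

Definition pair_distribution (sigma : distr_fun R) (Btheta B : graph R) : Prop :=
  let m := distr_measure sigma in
  let J : set R := `[0, +oo[%classic in
  exists U : (R -> R[i]) -> (R -> R[i]),
    [/\ (forall f, L2a f -> inL2 m J (U f)),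
        (forall (k : R[i]) f g, L2a f -> L2a g ->
           aeq m J (U (fun x => k * f x + g x)) (fun t => k * U f t + U g t)),
        (forall f g, L2a f -> L2a g -> dotp m J (U f) (U g) = dota f g),
        (forall phi, inL2 m J phi -> exists2 f, L2a f & aeq m J (U f) phi) &
        (forall f g, L2a f -> L2a g ->
           (Btheta (f, g) <-> mult_op sigma (U f, U g)) /\
           (B (f, g) <-> mult0_op sigma (U f, U g)))].

End Schroedinger.

Definition SL0 (R : realType) (V : R[i] -> R[i]) (gamma : R)
    (sigma : distr_fun R) : Prop :=
  let m := distr_measure sigma in
  [/\ (\int[m]_(t in `[0%R, +oo[) 1 = +oo)%E,
      (\int[m]_(t in `[0%R, +oo[) ((1 + t)^-1)%:E < +oo)%E &
      forall z : R[i], ~~ (0 <= z) ->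
        V z = gamma%:C + cintegral m `[0, +oo[ (fun t => (t%:C - z)^-1)].

(* Main.v *)
(* Green's identity on the maximal domain needs no integration by parts: B_theta
   being symmetric, it only has to be tested on y0 w, where y0 lies in D(B_theta),
   y0(a) = 1, and w(x) = (x - a) max(1 - b(x - a), 0)^2. Changing b alters y0 w
   by an element of D(B), and as b -> oo the boundary form is read off near a.

   For z outside [0, +oo[ let phi_z be the L_2 solution of ell y = z y with
   y'(a) - theta y(a) = 1. The functionals y |-> y(a) and y |-> int U y dsigma on
   D(B_theta) both have kernel D(B), so they are proportional; hence
   U phi_z = const / (t - z), and phi_z(a) = k - s^-1 int dsigma(t) / (t - z) with
   s > 0 and k independent of z. Testing phi_{-b^2} against y0 w gives
   phi_{-b^2}(a) -> 0, that is, k = 0.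

   Solving (Re A - z) y = K 1 with y = c phi_z makes V_Theta a Moebius function of
   phi_z(a) with coefficients depending on h and mu. Since phi_z(a) takes three
   distinct real values on the negative axis, V = V_Theta amounts to equations for
   (h, mu) whose only solution is h = theta + s / (gamma - i),
   mu = theta + s / gamma. *)
From HB Require Import structures.
Require Import Defs.
From mathcomp Require Import all_boot all_order all_algebra.
From mathcomp Require Import all_classical all_reals all_analysis.
From mathcomp Require Import complex measurable_realfun.
From mathcomp Require Import ring lra.
Set Implicit Arguments.
Unset Strict Implicit.
Unset Printing Implicit Defensive.
Import Order.TTheory GRing.Theory Num.Theory.
Import numFieldNormedType.Exports.
Local Open Scope classical_set_scope.
Local Open Scope ring_scope.
Local Open Scope complex_scope.
Local Notation Re := complex.Re.
Local Notation Im := complex.Im.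
Import ComplexField.Normc.
Local Notation "x ^*" := (conjc x) : ring_scope.

(** [ell y] is a pointwise formula whose derivatives are limits with a default value where they do
    not exist. It is therefore linear only almost everywhere, because absolutely continuous
    functions are differentiable almost everywhere; this fact and the measurability of the
    derivative are what the real analysis below supplies. No theory of the differential equation
    enters. The resolvent of B_theta is pulled back from multiplication by 1/(t - z), and it yields
    the existence of phi_z and the uniqueness of L_2 solutions up to a factor. As the deficiency
    space at i is one-dimensional, it also shows that the adjoint of B is the maximal operator. The
    deficiency indices exclude B_theta = B as well, which is why y0 exists. In the uniqueness
    argument V = V_Theta becomes a quadratic equation in phi_z(a). Its leading coefficient says that
    the self-adjoint operator contained in Re A is B_theta; the other two then fix h and mu. *)

Section complex_facts.
Context {R : realType}.
Implicit Types z w : R[i].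

Lemma ReD z w : Re (z + w) = Re z + Re w. Proof. by case: z; case: w. Qed.
Lemma ImD z w : Im (z + w) = Im z + Im w. Proof. by case: z; case: w. Qed.
Lemma ReN z : Re (- z) = - Re z. Proof. by case: z. Qed.
Lemma ImN z : Im (- z) = - Im z. Proof. by case: z. Qed.
Lemma ReM z w : Re (z * w) = Re z * Re w - Im z * Im w.
Proof. by case: z; case: w. Qed.
Lemma ImM z w : Im (z * w) = Re z * Im w + Im z * Re w.
Proof. by case: z; case: w. Qed.
Lemma ReJ z : Re (z^*) = Re z. Proof. by case: z. Qed.
Lemma ImJ z : Im (z^*) = - Im z. Proof. by case: z. Qed.

Definition ReImE := (ReD, ImD, ReN, ImN, ReM, ImM, ReJ, ImJ).

Lemma complexP z w : Re z = Re w -> Im z = Im w -> z = w.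
Proof. by case: z; case: w => /= a b c d -> ->. Qed.

Lemma conjcM z w : (z * w)^* = z^* * w^*.
Proof. by apply: complexP; rewrite !ReImE; ring. Qed.
Lemma conjcD z w : (z + w)^* = z^* + w^*.
Proof. by apply: complexP; rewrite !ReImE; ring. Qed.
Lemma conjcN z : (- z)^* = - z^*.
Proof. by apply: complexP; rewrite !ReImE. Qed.
Lemma conjcB z w : (z - w)^* = z^* - w^*.
Proof. by rewrite conjcD conjcN. Qed.
Lemma conj1c : (1 : R[i])^* = 1.
Proof. by apply: complexP; rewrite !ReImE/= ?oppr0. Qed.
Lemma conjcV z : (z^-1)^* = (z^*)^-1. Proof. exact: conjc_inv. Qed.

Lemma normc2E z : normc z ^+ 2 = Re z ^+ 2 + Im z ^+ 2.
Proof. by case: z => a b /=; rewrite sqr_sqrtr// addr_ge0 ?sqr_ge0. Qed.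

Lemma normc_ge0 z : 0 <= normc z.
Proof. by case: z => a b /=; exact: sqrtr_ge0. Qed.

Lemma le_Re_normc z : `|Re z| <= normc z.
Proof.
by rewrite -ler_sqr ?nnegrE ?normc_ge0// normc2E real_normK ?num_real// lerDl sqr_ge0.
Qed.

Lemma le_Im_normc z : `|Im z| <= normc z.
Proof.
by rewrite -ler_sqr ?nnegrE ?normc_ge0// normc2E real_normK ?num_real// lerDr sqr_ge0.
Qed.

Lemma normcJ z : normc (z^*) = normc z.
Proof. by case: z => a b /=; rewrite sqrrN. Qed.

Lemma normcR (r : R) : normc r%:C = `|r|.
Proof. by rewrite /= expr0n addr0 sqrtr_sqr. Qed.

Lemma mul_conjc z : z * z^* = (normc z ^+ 2)%:C.
Proof. by apply: complexP; rewrite !ReImE/= ?normc2E; ring. Qed.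

Lemma normc_gt0 z : z != 0 -> 0 < normc z.
Proof. by move=> z0; rewrite lt0r normc_ge0 andbT; apply: contra z0 => /eqP/eq0_normc ->. Qed.

Lemma normc_le_ReIm z : normc z <= `|Re z| + `|Im z|.
Proof.
rewrite -ler_sqr ?nnegrE ?normc_ge0 ?addr_ge0// normc2E sqrrD !real_normK ?num_real//.
by rewrite -addrA lerD2l lerDr mulrn_wge0// mulr_ge0.
Qed.

End complex_facts.

Lemma measurable_sqrt {R : realType} : measurable_fun [set: R] (@Num.sqrt R).
Proof. by apply: nondecreasing_measurable => // s t st; exact: ler_wsqrtr. Qed.

(** * Complex-valued L2 functions *)
Section L2_theory.
Context {R : realType} (m : {measure set (measurableTypeR R) -> \bar R}).
Context (D : set R) (mD : measurable (D : set (measurableTypeR R))).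
Implicit Types (f g u v : R -> R[i]) (r s : R -> R).

Definition rint r := m.-integrable D (EFin \o r).

Lemma rintD r s : rint r -> rint s -> rint (fun x => r x + s x).
Proof.
move=> ir is_; have := integrableD mD ir is_.
by apply: eq_integrable.
Qed.

Lemma rintZ (k : R) r : rint r -> rint (fun x => k * r x).
Proof.
move=> ir; have := integrableZl mD k ir.
by apply: eq_integrable.
Qed.

Lemma rintN r : rint r -> rint (fun x => - r x).
Proof.
by move=> /(rintZ (-1)); apply: eq_integrable => // x _ /=; rewrite mulN1r.
Qed.

Lemma rintB r s : rint r -> rint s -> rint (fun x => r x - s x).
Proof. by move=> ir /rintN; exact: rintD. Qed.

Lemma rint_measurable r : rint r -> measurable_fun D r.
Proof. by move=> /measurable_int /measurable_EFinP. Qed.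

Lemma le_rint r s : measurable_fun D r -> (forall x, D x -> `|r x| <= s x) ->
  rint s -> rint r.
Proof.
move=> mr rs; apply: le_integrable => //.
  exact/measurable_EFinP.
by move=> x Dx /=; rewrite lee_fin (le_trans (rs _ Dx))// ler_norm.
Qed.

Lemma rint_ae_eq r s : rint s -> measurable_fun D r ->
  ae_eq m D r s -> rint r /\ Rintegral m D r = Rintegral m D s.
Proof.
move=> is_ mr rs.
have mr' : measurable_fun D (EFin \o r) by exact/measurable_EFinP.
have ms' := measurable_int _ is_.
have rs' : ae_eq m D (EFin \o r) (EFin \o s).
  by apply: filterS rs => x h Dx /=; rewrite (h Dx).
split; last by rewrite /Rintegral; congr fine; exact: ae_eq_integral.
apply/integrableP; split => //.
have /integrableP[_] := is_; rewrite (@ae_eq_integral _ _ _ m _ (fun x => `|(EFin \o r) x|)%E (fun x => `|(EFin \o s) x|)%E)//.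
- exact: measurableT_comp.
- exact: measurableT_comp.
- by apply: filterS rs => x h Dx /=; rewrite (h Dx).
Qed.

Definition cint f := rint (fun x => Re (f x)) /\ rint (fun x => Im (f x)).
Definition cmeas f := measurable_fun D (fun x => Re (f x)) /\
  measurable_fun D (fun x => Im (f x)).

Lemma cint_meas f : cint f -> cmeas f.
Proof. by case=> /rint_measurable ? /rint_measurable. Qed.

Lemma cmeasD f g : cmeas f -> cmeas g -> cmeas (fun x => f x + g x).
Proof.
move=> [f1 f2] [g1 g2]; split; under eq_fun do rewrite ?ReImE.
  exact: measurable_funD.
exact: measurable_funD.
Qed.

Lemma cmeasM f g : cmeas f -> cmeas g -> cmeas (fun x => f x * g x).
Proof.
move=> [f1 f2] [g1 g2]; split; under eq_fun do rewrite ?ReImE.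
  by apply: measurable_funB; exact: measurable_funM.
by apply: measurable_funD; exact: measurable_funM.
Qed.

Lemma cmeas_cst (k : R[i]) : cmeas (fun=> k).
Proof. by split; exact: measurable_cst. Qed.

Lemma cmeasJ f : cmeas f -> cmeas (fun x => (f x)^*).
Proof.
move=> [f1 f2]; split; (under eq_fun do rewrite ?ReImE) => //.
exact: measurable_funN.
Qed.

Lemma cmeas_normc f : cmeas f -> measurable_fun D (fun x => normc (f x)).
Proof.
move=> [f1 f2].
have -> : (fun x => normc (f x)) = (fun x => Num.sqrt (Re (f x) ^+ 2 + Im (f x) ^+ 2)).
  by apply/funext => x; case: (f x).
apply: (measurableT_comp measurable_sqrt).
by apply: measurable_funD; exact: measurable_funX.
Qed.

Lemma cintD f g : cint f -> cint g -> cint (fun x => f x + g x).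
Proof.
move=> [f1 f2] [g1 g2]; split; under [X in rint X]eq_fun do rewrite ?ReImE; exact: rintD.
Qed.

Lemma cintZ (k : R[i]) f : cint f -> cint (fun x => k * f x).
Proof.
move=> [f1 f2]; split; under [X in rint X]eq_fun do rewrite ?ReImE.
  by apply: rintB; exact: rintZ.
by apply: rintD; exact: rintZ.
Qed.

Lemma cint_normc f : cint f -> rint (fun x => normc (f x)).
Proof.
move=> cf; have [f1 f2] := cf.
apply: (@le_rint _ (fun x => `|Re (f x)| + `|Im (f x)|)).
- by apply: cmeas_normc; exact: cint_meas.
- by move=> x _; rewrite ger0_norm ?normc_ge0// normc_le_ReIm.
- by apply: rintD; exact: integrable_norm.
Qed.

Lemma le_cint f s : cmeas f -> (forall x, D x -> normc (f x) <= s x) ->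
  rint s -> cint f.
Proof.
move=> [f1 f2] fs is_; split; apply: (@le_rint _ s) => // x Dx.
  by rewrite (le_trans (le_Re_normc _))// fs.
by rewrite (le_trans (le_Im_normc _))// fs.
Qed.

Local Notation I := (cintegral m D).

Lemma cintegralD f g : cint f -> cint g -> I (fun x => f x + g x) = I f + I g.
Proof.
move=> [f1 f2] [g1 g2]; apply: complexP; rewrite ?ReImE /cintegral/=.
  by rewrite -RintegralD//; apply: eq_Rintegral => x _; rewrite ?ReImE.
by rewrite -RintegralD//; apply: eq_Rintegral => x _; rewrite ?ReImE.
Qed.

Lemma cintegralZ (k : R[i]) f : cint f -> I (fun x => k * f x) = k * I f.
Proof.
move=> [f1 f2]; apply: complexP; rewrite ?ReImE /cintegral/=.
  rewrite -!RintegralZl// -RintegralB//; try exact: rintZ.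
  by apply: eq_Rintegral => x _; rewrite ?ReImE.
rewrite -!RintegralZl// -RintegralD//; try exact: rintZ.
by apply: eq_Rintegral => x _; rewrite ?ReImE.
Qed.

Lemma RintegralN r : rint r -> Rintegral m D (fun x => - r x) = - Rintegral m D r.
Proof.
move=> ir; rewrite -mulN1r -RintegralZl//.
by apply: eq_Rintegral => x _; rewrite mulN1r.
Qed.

Lemma cintegralJ f : cint f -> I (fun x => (f x)^*) = (I f)^*.
Proof.
move=> [f1 f2]; apply: complexP; rewrite ?ReImE /cintegral/=.
  by apply: eq_Rintegral => x _; rewrite ?ReImE.
by rewrite -RintegralN//; apply: eq_Rintegral => x _; rewrite ?ReImE.
Qed.

Lemma eq_cintegral f g : (forall x, D x -> f x = g x) -> I f = I g.
Proof.
move=> fg; apply: complexP; rewrite /cintegral/=; apply: eq_Rintegral => x /set_mem Dx;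
  by rewrite fg.
Qed.

Lemma cint_aeq f g : cint g -> cmeas f -> aeq m D f g -> cint f /\ I f = I g.
Proof.
move=> [g1 g2] [f1 f2] fg.
have h1 : ae_eq m D (fun x => Re (f x)) (fun x => Re (g x)).
  by apply: filterS fg => x h Dx; rewrite h.
have h2 : ae_eq m D (fun x => Im (f x)) (fun x => Im (g x)).
  by apply: filterS fg => x h Dx; rewrite h.
have [i1 e1] := rint_ae_eq g1 f1 h1; have [i2 e2] := rint_ae_eq g2 f2 h2.
by split; [split | rewrite /cintegral e1 e2].
Qed.

Lemma normc_cintegral f : cint f -> normc (I f) <= Rintegral m D (fun x => normc (f x)).
Proof.
move=> cf; have [->|nz] := eqVneq (I f) 0.
  rewrite normc0; apply: Rintegral_ge0 => x _; exact: normc_ge0.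
have n0 := normc_gt0 nz.
(* [k] has modulus 1 and rotates the integral onto the positive axis, so that only a real part has
   to be estimated. *)
pose k := (normc (I f))^-1%:C * (I f)^*.
have kI : k * I f = (normc (I f))%:C.
  rewrite /k -mulrA [_^* * _]mulrC mul_conjc -rmorphM/= expr2 mulrA mulVf ?mul1r//.
  by rewrite gt_eqF.
have nk : normc k = 1.
  by rewrite normcM normcJ normcR ger0_norm ?invr_ge0 ?normc_ge0// mulVf// gt_eqF.
have -> : normc (I f) = Re (k * I f) by rewrite kI.
rewrite -cintegralZ// /cintegral/=; apply: le_Rintegral => //.
- by have [] := cintZ k cf.
- exact: cint_normc.
- by move=> x Dx; rewrite (le_trans (ler_norm _))// (le_trans (le_Re_normc _))// normcM nk mul1r.
Qed.

Local Notation L2 := (inL2 m D).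
Local Notation dot := (dotp m D).

Let absnE f : (fun x => `|(EFin \o (fun x => (normc (f x) ^+ 2)%R)) x|%E) =
  (fun x => (normc (f x) ^+ 2)%:E).
Proof. by apply/funext => x /=; rewrite ger0_norm ?sqr_ge0. Qed.

Lemma inL2P f : L2 f <-> cmeas f /\ rint (fun x => normc (f x) ^+ 2).
Proof.
split=> [[f1 f2 f3]|[[f1 f2] f3]].
  have mn : measurable_fun D (fun x => normc (f x) ^+ 2).
    by apply: measurable_funX; exact: cmeas_normc.
  split => //; apply/integrableP; split; first exact/measurable_EFinP.
  by rewrite absnE.
by split => //; move/integrableP: f3 => [_]; rewrite absnE.
Qed.

Lemma L2_meas f : L2 f -> cmeas f. Proof. by move=> /inL2P[]. Qed.

Lemma L2_cint f g : L2 f -> L2 g -> cint (fun x => f x * (g x)^*).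
Proof.
move=> /inL2P[mf f2] /inL2P[mg g2].
apply: (@le_cint _ (fun x => normc (f x) ^+ 2 + normc (g x) ^+ 2)).
- by apply: cmeasM => //; exact: cmeasJ.
- move=> x _; rewrite normcM normcJ.
  have := sqr_ge0 (normc (f x) - normc (g x)).
  have := mulr_ge0 (normc_ge0 (f x)) (normc_ge0 (g x)).
  by rewrite sqrrB; nra.
- exact: rintD.
Qed.

Lemma L2_dom f s : cmeas f -> (forall x, D x -> normc (f x) ^+ 2 <= s x) -> rint s -> L2 f.
Proof.
move=> mf fs is_; apply/inL2P; split => //; apply: (@le_rint _ s) => //.
  by apply: measurable_funX; exact: cmeas_normc.
by move=> x Dx; rewrite ger0_norm ?sqr_ge0 ?fs.
Qed.

Lemma L2D f g : L2 f -> L2 g -> L2 (fun x => f x + g x).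
Proof.
move=> /inL2P[mf f2] /inL2P[mg g2].
apply: (@L2_dom _ (fun x => 2 * normc (f x) ^+ 2 + 2 * normc (g x) ^+ 2)).
- exact: cmeasD.
- move=> x _; have := le_normcD (f x) (g x).
  have h1 := normc_ge0 (f x + g x); have h2 := normc_ge0 (f x); have h3 := normc_ge0 (g x).
  have := sqr_ge0 (normc (f x) - normc (g x)).
  move: h1 h2 h3; set p := normc _; set q := normc _; set r := normc _ => *; nra.
- by apply: rintD; exact: rintZ.
Qed.

Lemma L2M (b : R -> R[i]) (C : R) f : cmeas b -> (forall x, D x -> normc (b x) <= C) ->
  L2 f -> L2 (fun x => b x * f x).
Proof.
move=> mb bC /inL2P[mf f2].
apply: (@L2_dom _ (fun x => C ^+ 2 * normc (f x) ^+ 2)).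
- exact: cmeasM.
- move=> x Dx; rewrite normcM exprMn ler_wpM2r ?sqr_ge0// ler_sqr ?nnegrE ?normc_ge0 ?bC//.
  exact: le_trans (normc_ge0 _) (bC _ Dx).
- exact: rintZ.
Qed.

Lemma L2Z (k : R[i]) f : L2 f -> L2 (fun x => k * f x).
Proof. by apply: (@L2M _ (normc k)); first exact: cmeas_cst. Qed.

Lemma L2_lin (k : R[i]) f g : L2 f -> L2 g -> L2 (fun x => k * f x + g x).
Proof. by move=> /(L2Z k); exact: L2D. Qed.

Lemma L2N f : L2 f -> L2 (fun x => - f x).
Proof. by move=> /(L2Z (-1)); under eq_fun do rewrite mulN1r. Qed.

Lemma L2B f g : L2 f -> L2 g -> L2 (fun x => f x - g x).
Proof. by move=> Lf /L2N; exact: L2D. Qed.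

Lemma L20 : L2 (fun=> 0).
Proof.
apply: (@L2_dom _ (fun=> 0)); first exact: cmeas_cst.
  by move=> x _; rewrite normc0 expr0n.
by have := integrable0 m D; apply: eq_integrable.
Qed.

Lemma dotpE f g : dot f g = I (fun x => f x * (g x)^*).
Proof. by []. Qed.

Lemma dotDl f g u : L2 f -> L2 g -> L2 u -> dot (fun x => f x + g x) u = dot f u + dot g u.
Proof.
move=> Lf Lg Lu; rewrite !dotpE -cintegralD; try exact: L2_cint.
by apply: eq_cintegral => x _; rewrite mulrDl.
Qed.

Lemma dotZl k f u : L2 f -> L2 u -> dot (fun x => k * f x) u = k * dot f u.
Proof.
move=> Lf Lu; rewrite !dotpE -cintegralZ; last exact: L2_cint.
by apply: eq_cintegral => x _; rewrite mulrA.
Qed.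

Lemma dotC f u : L2 f -> L2 u -> dot u f = (dot f u)^*.
Proof.
move=> Lf Lu; rewrite !dotpE -cintegralJ; last exact: L2_cint.
by apply: eq_cintegral => x _; rewrite conjcM conjcK mulrC.
Qed.

Lemma dot_linl k f g u : L2 f -> L2 g -> L2 u ->
  dot (fun x => k * f x + g x) u = k * dot f u + dot g u.
Proof. by move=> Lf Lg Lu; rewrite dotDl ?dotZl//; exact: L2Z. Qed.

Lemma dotDr f g u : L2 f -> L2 g -> L2 u -> dot u (fun x => f x + g x) = dot u f + dot u g.
Proof.
move=> Lf Lg Lu; rewrite dotC//; last exact: L2D.
by rewrite dotDl// conjcD -!dotC.
Qed.

Lemma dotZr k f u : L2 f -> L2 u -> dot u (fun x => k * f x) = k^* * dot u f.
Proof.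
move=> Lf Lu; rewrite dotC//; last exact: L2Z.
by rewrite dotZl// conjcM -!dotC.
Qed.

Lemma dot_linr k f g u : L2 f -> L2 g -> L2 u ->
  dot u (fun x => k * f x + g x) = k^* * dot u f + dot u g.
Proof. by move=> Lf Lg Lu; rewrite dotDr ?dotZr//; exact: L2Z. Qed.

Lemma dotBl f g u : L2 f -> L2 g -> L2 u -> dot (fun x => f x - g x) u = dot f u - dot g u.
Proof.
move=> Lf Lg Lu; rewrite dotDl//; last exact: L2N.
congr (_ + _); rewrite -mulN1r -dotZl//; congr (dotp m D _ _).
by apply/funext => x; rewrite mulN1r.
Qed.

Lemma dotBr f g u : L2 f -> L2 g -> L2 u -> dot u (fun x => f x - g x) = dot u f - dot u g.
Proof.
move=> Lf Lg Lu; rewrite dotC//; last exact: L2B.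
by rewrite dotBl// conjcB -!dotC.
Qed.

Lemma dot_aeq f f' g g' : L2 f -> L2 f' -> L2 g -> L2 g' ->
  aeq m D f f' -> aeq m D g g' -> dot f g = dot f' g'.
Proof.
move=> Lf Lf' Lg Lg' ff' gg'; rewrite !dotpE.
apply: (cint_aeq _ _ _).2; first exact: L2_cint.
  by apply: cmeasM; [exact: L2_meas | apply: cmeasJ; exact: L2_meas].
by apply: filterS2 ff' gg' => x h1 h2 Dx; rewrite h1// h2.
Qed.

Lemma dot_selfE f : L2 f -> dot f f = (Rintegral m D (fun x => normc (f x) ^+ 2))%:C.
Proof.
move=> Lf; apply: complexP; rewrite dotpE/cintegral/=.
  by apply: eq_Rintegral => x _; rewrite mul_conjc.
rewrite (@eq_Rintegral _ _ _ _ _ (fun=> 0)).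
  by rewrite Rintegral_cst// mul0r.
by move=> x _; rewrite mul_conjc.
Qed.

Definition sqn f := Re (dot f f).

Lemma sqnE f : L2 f -> sqn f = Rintegral m D (fun x => normc (f x) ^+ 2).
Proof. by move=> Lf; rewrite /sqn dot_selfE. Qed.

Lemma dot_self f : L2 f -> dot f f = (sqn f)%:C.
Proof. by move=> Lf; rewrite sqnE// dot_selfE. Qed.

Lemma sqn_ge0 f : L2 f -> 0 <= sqn f.
Proof. by move=> Lf; rewrite sqnE//; apply: Rintegral_ge0 => x _; rewrite sqr_ge0. Qed.

Lemma sqn_eq0 f : L2 f -> sqn f = 0 -> aeq m D f (fun=> 0).
Proof.
move=> Lf; rewrite sqnE// => h.
have /inL2P[mf i2] := Lf.
have mn := measurable_int _ i2.
have h' : (\int[m]_(x in D) `|(EFin \o (fun x => (normc (f x) ^+ 2)%R)) x| = 0)%E.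
  rewrite absnE -[LHS]fineK; last exact: integrable_fin_num i2.
  by move: h; rewrite /Rintegral => ->.
have [/(_ h') + _] := ae_eq_integral_abs m mD mn.
apply: filterS => x /[apply] /= -[] /eqP; rewrite expf_eq0/= => /eqP.
exact: eq0_normc.
Qed.

Lemma L2_Cauchy_Schwarz f g : L2 f -> L2 g -> normc (dot f g) ^+ 2 <= sqn f * sqn g.
Proof.
move=> Lf Lg; set d := dot f g; set p := sqn f; set r := sqn g.
(* The quadratic in t is the squared norm of f - t d g; its minimum, at t = 1/r, is the
   inequality. *)
have key (t : R) : 0 <= p - 2 * t * normc d ^+ 2 + t ^+ 2 * normc d ^+ 2 * r.
  have LZ : L2 (fun x => (t%:C * d) * g x) by exact: L2Z.
  have LB : L2 (fun x => f x - (t%:C * d) * g x) by exact: L2B.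
  have := sqn_ge0 LB; rewrite /sqn dotBl// !dotBr// !dotZl// !dotZr// -/d.
  rewrite (dotC Lf Lg) -/d !dot_self// -/p -/r.
  clear LB LZ; move: d p r => d p r; suff -> : p%:C - (t%:C * d)^* * d - (t%:C * d * d^* - t%:C * d * ((t%:C * d)^* * r%:C)) =
    (p - 2 * t * normc d ^+ 2 + t ^+ 2 * normc d ^+ 2 * r)%:C by [].
  by case: d => d1 d2; apply: complexP; rewrite !ReImE/= ?(normc2E (_ +i* _))/=; ring.
have p0 : 0 <= p := sqn_ge0 Lf; have r0 : 0 <= r := sqn_ge0 Lg.
have d0 : 0 <= normc d ^+ 2 := sqr_ge0 _.
have [rz|rnz] := eqVneq r 0.
  rewrite rz mulr0; apply/contraT; rewrite -ltNge => dp.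
  (* For r = 0 the expression is affine in t, and this t gives it the value -1. *)
  have := key ((p + 1) / (2 * normc d ^+ 2)); rewrite rz mulr0 addr0.
  have -> : 2 * ((p + 1) / (2 * normc d ^+ 2)) * normc d ^+ 2 = p + 1.
    by field; apply: contraTN dp => /eqP ->; rewrite expr0n ltxx.
  by rewrite opprD addrA subrr add0r oppr_ge0 ler10.
have := key r^-1.
have -> : p - 2 * r^-1 * normc d ^+ 2 + r^-1 ^+ 2 * normc d ^+ 2 * r = p - normc d ^+ 2 / r by field.
by rewrite subr_ge0 ler_pdivrMr// lt0r rnz.
Qed.

End L2_theory.

(** * Absolutely continuous functions are differentiable almost everywhere *)
Section real_abs_cont.
Context {R : realType}.
Implicit Types (c d : R) (f g : R -> R) (s t : seq (R * R)).

Definition racont c d f : Prop :=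
  forall e : R, 0 < e -> exists2 del : R, 0 < del &
    forall (n : nat) (u v : 'I_n -> R),
      (forall i, [/\ c <= u i, u i <= v i & v i <= d]) ->
      (forall i j, i != j -> v i <= u j \/ v j <= u i) ->
      \sum_(i < n) (v i - u i) < del ->
      \sum_(i < n) `|f (v i) - f (u i)| < e.

(* A pair [p] stands for the interval [[p.2, p.1]]. *)
Definition non_overlapping : rel (R * R) := fun p q => (p.1 <= q.2) || (q.1 <= p.2).

Let inside c d (p : R * R) := [&& c <= p.2, p.2 <= p.1 & p.1 <= d].

(** Lists replace indexed families because the variation argument glues subdivisions by
    concatenation. *)
Lemma racont_seq c d f : racont c d f -> forall e, 0 < e -> exists2 del, 0 < del &
  forall s, all (inside c d) s -> pairwise non_overlapping s ->
    \sum_(p <- s) (p.1 - p.2) < del -> \sum_(p <- s) `|f p.1 - f p.2| < e.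
Proof.
move=> fac e e0; have [del del0 H] := fac e e0; exists del => // s sin sd ss.
pose x0 : R * R := (0, 0).
have := H (size s) (fun i => (nth x0 s i).2) (fun i => (nth x0 s i).1).
rewrite (big_nth x0) big_mkord in ss; rewrite (big_nth x0) big_mkord; apply => //.
  by move=> i; move/allP: sin => /(_ (nth x0 s i) (mem_nth _ (ltn_ord i)))/and3P[].
have P i j : (i < j < size s)%N -> non_overlapping (nth x0 s i) (nth x0 s j).
  by move=> /andP[ij js]; apply: (pairwiseP x0 sd) => //; rewrite inE (ltn_trans ij).
move=> i j; rewrite -val_eqE/= neq_ltn => /orP[ij|ji].
  by have := P i j; rewrite ij ltn_ord => /(_ isT)/orP[]; [left|right].
by have := P j i; rewrite ji ltn_ord => /(_ isT)/orP[]; [right|left].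
Qed.

Lemma non_overlapping_sub (p q r : R * R) : r.2 <= p.2 -> p.1 <= r.1 -> non_overlapping r q -> non_overlapping p q.
Proof.
move=> h1 h2 /orP[h|h]; rewrite /non_overlapping.
  by rewrite (le_trans h2 h).
by rewrite (le_trans h h1) orbT.
Qed.

(** [zip s' (x :: s')] pairs each point of a subdivision with its predecessor, the shape in which
    [variation_zip] sums the variation. *)
Lemma zip_path x (s' : seq R) : path <%O x s' ->
  [/\ all (inside x (last x s')) (zip s' (x :: s')),
      pairwise non_overlapping (zip s' (x :: s')) &
      \sum_(p <- zip s' (x :: s')) (p.1 - p.2) = last x s' - x].
Proof.
elim: s' x => [x _|y s' ih x /= /andP[xy /ih[h1 h2 h3]]].
  by rewrite /= big_nil subrr.
have yl : y <= last y s'.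
  by case: (s') h3 h1 => // z l _ /andP[/and3P[/= a b c] _]; rewrite (le_trans a) ?(le_trans b).
rewrite big_cons h3/=; split.
- rewrite /inside/= lexx ltW//= yl/=; apply: sub_all h1 => p /and3P[a b c].
  by rewrite /inside (le_trans (ltW xy) a) b c.
- rewrite h2 andbT; apply: sub_all h1 => p /and3P[a b c].
  by rewrite /non_overlapping/= a.
- by rewrite addrC addrA subrK.
Qed.

Local Notation TV := (@total_variation R).

Lemma racont_sub c d c' d' f : c <= c' -> d' <= d -> racont c d f -> racont c' d' f.
Proof.
move=> cc dd H e /H[del d0 {}H]; exists del => // n u v uv; apply: H => i.
by have [h1 h2 h3] := uv i; rewrite (le_trans cc) ?(le_trans h3).
Qed.

(** Absolute continuity with e = 1 bounds the variation by 1 on intervals shorter than del, and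
    finitely many steps of length del / 2 exhaust [c, d]. *)
Lemma racont_TV_lty c d f : c <= d -> racont c d f -> (TV c d f < +oo)%E.
Proof.
move=> cd fac; have [del del0 H] := racont_seq fac ltr01.
have step x y : c <= x -> x <= y -> y <= d -> y - x < del -> (TV x y f < +oo)%E.
  move=> cx xy yd xyd; apply: (@le_lt_trans _ _ 1%E); last exact: ltry.
  apply: ge_ereal_sup => _ [_ [s' ps] <-] <-; rewrite lee_fin.
  rewrite variation_zip//; case: ps => ps /eqP ls; apply/ltW.
  have [h1 h2 h3] := zip_path ps; apply: H => //; last by rewrite h3 ls.
  apply: sub_all h1 => p /and3P[a b e]; rewrite /inside b (le_trans cx a)/=.
  by rewrite (le_trans e)// ls.
have ind k x : c <= x -> x <= d -> x - c <= k%:R * (del / 2) -> (TV c x f < +oo)%E.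
  elim: k x => [|k ih] x cx xd.
    rewrite mul0r subr_le0 => xc; have -> : x = c by apply/eqP; rewrite eq_le cx xc.
    by rewrite total_variationxx.
  move=> xk; pose y := Num.max c (x - del / 2).
  have cy : c <= y by rewrite le_max lexx.
  have yx : y <= x by rewrite ge_max cx lerBlDr lerDl ltW// divr_gt0.
  rewrite (total_variationD f cy yx) lte_add_pinfty//.
    apply: ih => //; first exact: le_trans yx xd.
    rewrite /y; have [h|h] := leP c (x - del / 2); last by rewrite subrr mulr_ge0// ltW// divr_gt0.
    by move: xk; rewrite -natr1 mulrDl mul1r; lra.
  apply: step => //; have : x - del / 2 <= y by rewrite le_max lexx orbT.
  by lra.
have [k kP] : exists k : nat, d - c <= k%:R * (del / 2).
  exists (Num.bound ((d - c) / (del / 2))); rewrite -ler_pdivrMr ?divr_gt0//.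
  by apply/ltW/archi_boundP; rewrite divr_ge0 ?subr_ge0// ltW// divr_gt0.
exact: ind kP.
Qed.

(** [s] carries variations and [t] plain increments, so that induction on [s] can trade the
    variation of its head for the increments over an arbitrary subdivision moved into [t]. The bound
    is not strict because the variation is a supremum. *)
Lemma racont_TV_seq c d f : racont c d f -> forall e, 0 < e -> exists2 del, 0 < del &
  forall s t, all (inside c d) (s ++ t) -> pairwise non_overlapping (s ++ t) ->
    \sum_(p <- s ++ t) (p.1 - p.2) < del ->
    \sum_(p <- s) fine (TV p.2 p.1 f) + \sum_(p <- t) `|f p.1 - f p.2| <= e.
Proof.
move=> fac e e0; have [del del0 H] := racont_seq fac e0; exists del => //.
elim=> [t ht dt st|p s ih t]; first by rewrite big_nil add0r ltW// H.
rewrite /= big_cons => /andP[/and3P[cp pp pd] ht] /andP[dp dt] st.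
have TVfin : TV p.2 p.1 f \is a fin_num.
  rewrite ge0_fin_numE ?total_variation_ge0//; apply: racont_TV_lty => //.
  exact: racont_sub fac.
rewrite big_cons -addrA -lerBrDr -lee_fin fineK//.
apply: ge_ereal_sup => _ [_ [s' ps] <-] <-; rewrite lee_fin lerBrDr.
rewrite variation_zip//; case: ps => ps /eqP ls.
have [h1 h2 h3] := zip_path ps; set z := zip _ _ in h1 h2 h3 *.
have hz : forall q, q \in z -> p.2 <= q.2 /\ q.1 <= p.1.
  by move=> q /(allP h1)/and3P[a _ b]; rewrite -ls.
rewrite addrCA -big_cat/=; apply: ih.
- move: ht; rewrite !all_cat => /andP[-> ->]; rewrite andbT/=.
  by apply/allP => q qz; have [a b] := hz _ qz; have /and3P[_ h _] := allP h1 _ qz;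
    rewrite /inside h (le_trans cp a) (le_trans b pd).
- move: dp dt; rewrite all_cat !pairwise_cat => /andP[ds dt] /and3P[st' ps' pt].
  rewrite ps' pt h2 !andbT allrel_catr st' andbT /=; apply/andP; split.
    apply/allrelP => x y xs yz; have [a b] := hz _ yz.
    by rewrite /non_overlapping orbC; apply: (non_overlapping_sub a b); exact: (allP ds).
  apply/allrelP => y x yz xs; have [a b] := hz _ yz.
  by apply: (non_overlapping_sub a b); exact: (allP dt).
- move: st; rewrite !big_cat/= h3 ls; lra.
Qed.

Definition variation_fun c f x : R := fine (TV c x f).

Lemma variation_funB c d f x y : racont c d f -> c <= x -> x <= y -> y <= d ->
  variation_fun c f y - variation_fun c f x = fine (TV x y f).
Proof.
move=> fac cx xy yd; have fin u v : c <= u -> u <= v -> v <= d -> TV u v f \is a fin_num.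
  move=> cu uv vd; rewrite ge0_fin_numE ?total_variation_ge0//; apply: racont_TV_lty => //.
  exact: racont_sub fac.
rewrite /variation_fun (total_variationD f cx xy) fineD ?fin ?(le_trans xy)//; first by rewrite addrAC subrr add0r.
Qed.

Lemma racont_seqP c d f : (forall e, 0 < e -> exists2 del, 0 < del &
  forall s, all (inside c d) s -> pairwise non_overlapping s ->
    \sum_(p <- s) (p.1 - p.2) < del -> \sum_(p <- s) `|f p.1 - f p.2| < e) -> racont c d f.
Proof.
move=> H e /H[del del0 {}H]; exists del => // n u v uv duv suv.
have := H [seq (v i, u i) | i <- enum 'I_n]; rewrite !big_map/= -!big_enum/=; apply => //.
  by apply/allP => _ /mapP[i _ ->]; rewrite /inside/=; case: (uv i) => -> -> ->.
rewrite pairwise_map; apply: (@sub_in_pairwise _ predT (fun i j => i != j)) => //.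
- by move=> i j _ _ /= ij; rewrite /non_overlapping/=; case: (duv _ _ ij) => ->; rewrite ?orbT.
- exact/all_predT.
- by have := enum_uniq 'I_n; rewrite uniq_pairwise.
- by rewrite big_enum.
Qed.

Lemma racont_variation_fun c d f : racont c d f -> racont c d (variation_fun c f).
Proof.
move=> fac; apply: racont_seqP => e e0.
(* Halving e restores the strict inequality lost in [racont_TV_seq]. *)
have e20 : 0 < e / 2 by rewrite divr_gt0.
have [del del0 H] := racont_TV_seq fac e20; exists del => // s h1 h2 h3.
have := H s [::]; rewrite cats0 => /(_ h1 h2 h3); rewrite big_nil addr0 => h.
rewrite (@le_lt_trans _ _ (e / 2))//; last lra.
apply: le_trans h; rewrite big_seq [leRHS]big_seq; apply: ler_sum => p ps.
have /and3P[a b e'] := allP h1 _ ps.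
by rewrite (variation_funB fac)// ger0_norm// fine_ge0// total_variation_ge0.
Qed.

Lemma racontB c d f g : racont c d f -> racont c d g -> racont c d (fun x => f x - g x).
Proof.
move=> fac gac e e0; have e20 : 0 < e / 2 by rewrite divr_gt0.
have [d1 d10 H1] := fac _ e20; have [d2 d20 H2] := gac _ e20.
exists (Num.min d1 d2); first by rewrite lt_min d10.
move=> n u v uv duv; rewrite lt_min => /andP[h1 h2].
have := H1 _ _ _ uv duv h1; have := H2 _ _ _ uv duv h2.
move=> k2 k1; rewrite (splitr e) (le_lt_trans _ (ltrD k1 k2))// -big_split/=.
apply: ler_sum => i _; rewrite (_ : _ - _ - _ = (f (v i) - f (u i)) - (g (v i) - g (u i))) ?ler_normB//.
by ring.
Qed.

(** Jordan decomposition with absolutely continuous parts; [g] is monotone because an increment of f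
    never exceeds the variation over the same interval. *)
Lemma racont_nd_decomp c d f : racont c d f ->
  let g := fun x => variation_fun c f x - f x in
  [/\ forall x y, c <= x -> x <= y -> y <= d -> variation_fun c f x <= variation_fun c f y,
      forall x y, c <= x -> x <= y -> y <= d -> g x <= g y,
      racont c d (variation_fun c f) & racont c d g].
Proof.
move=> fac g; have tac := racont_variation_fun fac; split => //; last exact: racontB.
  move=> x y cx xy yd; rewrite -subr_ge0 (variation_funB fac)// fine_ge0//.
  exact: total_variation_ge0.
move=> x y cx xy yd; rewrite -subr_ge0 /g.
suff : `|f y - f x| <= variation_fun c f y - variation_fun c f x by move=> /(le_trans (ler_norm _)); lra.
rewrite (variation_funB fac)// -lee_fin fineK ?total_variation_ge//.
rewrite ge0_fin_numE ?total_variation_ge0//; apply: racont_TV_lty => //.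
exact: racont_sub fac.
Qed.

Lemma racont_continuous_at c d f : racont c d f -> forall e, 0 < e -> exists2 del, 0 < del &
  forall x y, c <= x -> x <= y -> y <= d -> y - x < del -> `|f y - f x| < e.
Proof.
move=> /racont_seq H e /H[del del0 {}H]; exists del => // x y cx xy yd xyd.
have := H [:: (y, x)]; rewrite !big_seq1/=; apply => //.
by rewrite /inside/= cx xy yd.
Qed.

End real_abs_cont.

Lemma stieltjes_itvoc {R : realType} (F : cumulative R R) (u v : R) : u <= v ->
  (lebesgue_stieltjes_measure F : {measure set (measurableTypeR R) -> \bar R})
    `]u, v]%classic = (F v - F u)%:E.
Proof.
move=> uv; rewrite -(wlength_itv_bnd F false false)//; apply: (measurable_mu_extE (wlength F)).
exact: is_ocitv.
Qed.

(** * Differentiability of monotone absolutely continuous functions *)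

Section stieltjes_density.
Context {R : realType} (c d : R) (G : R -> R).
Hypothesis cd : c < d.
Hypothesis ndG : forall x y, c <= x -> x <= y -> y <= d -> G x <= G y.
Hypothesis acG : racont c d G.

Local Notation mu := (@lebesgue_measure R).

(** Extending [G] by constants beyond [c, d] makes it a cumulative function on the whole line. *)
Definition clampfun (t : R) : R := G (Num.max c (Num.min d t)).

Let clampE t : c <= t <= d -> clampfun t = G t.
Proof. by move=> /andP[ct td]; rewrite /clampfun (min_idPr td) (max_idPr ct). Qed.

Let clamp_in t : c <= Num.max c (Num.min d t) <= d.
Proof. by rewrite le_max lexx /= ge_max (ltW cd) ge_min lexx. Qed.

Let clamp_le s t : s <= t -> Num.max c (Num.min d s) <= Num.max c (Num.min d t).
Proof. by move=> st; apply: le_max2 => //; apply: le_min2. Qed.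

Let clamp_nd : nondecreasing clampfun.
Proof.
move=> s t st; have /andP[h1 h2] := clamp_in s; have /andP[h3 h4] := clamp_in t.
by apply: ndG => //; exact: clamp_le.
Qed.

Let clamp_rc : right_continuous clampfun.
Proof.
move=> t; apply/cvgrPdist_lt => e e0.
have [del del0 H] := racont_continuous_at acG e0.
near=> s.
have ts : t < s by near: s; exact: nbhs_right_gt.
have std : s - t < del by rewrite ltrBlDl; near: s; apply: nbhs_right_lt; rewrite ltrDl.
have /andP[h1 h2] := clamp_in s; have /andP[h3 h4] := clamp_in t.
rewrite distrC; apply: H => //; first exact/clamp_le/ltW.
apply: le_lt_trans std; rewrite /Num.max/Num.min; do ! case: ifPn; rewrite -?leNgt; lra.
Unshelve. all: by end_near. Qed.

HB.instance Definition _ := isCumulative.Build R _ R clampfun clamp_nd clamp_rc.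

Let nu : {measure set (measurableTypeR R) -> \bar R} := lebesgue_stieltjes_measure clampfun.

Let nuE (u v : R) : u <= v -> nu `]u, v]%classic = (clampfun v - clampfun u)%:E.
Proof. exact: stieltjes_itvoc. Qed.

Let D : set R := `]c, d]%classic.
Let mD : measurable (D : set (measurableTypeR R)). Proof. exact: measurable_itv. Qed.
Let nuD : (nu D < +oo)%E. Proof. by rewrite nuE ?ltry// ltW. Qed.

Let x_ n k : R := c + (d - c) * (k%:R / n.+1%:R).
Let cell n k : set R := `]x_ n k, x_ n k.+1]%classic.

Let x_mono n k l : (k <= l)%N -> x_ n k <= x_ n l.
Proof.
by move=> kl; rewrite lerD2l ler_wpM2l ?subr_ge0 ?(ltW cd)// ler_wpM2r ?invr_ge0// ler_nat.
Qed.

Let x_end n : x_ n n.+1 = d.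
Proof. by rewrite /x_ divff// mulr1 addrC subrK. Qed.

Let x_start n : x_ n 0 = c.
Proof. by rewrite /x_ mul0r mulr0 addr0. Qed.

Let x_in n k : (k <= n.+1)%N -> c <= x_ n k <= d.
Proof. by move=> kn; rewrite -[X in X <= _](x_start n) -[X in _ && (_ <= X)](x_end n) !x_mono. Qed.

Let P (U : set R) n (k : 'I_n.+1) : bool := `[< cell n k `<=` U >].
(** The cells of the n-th uniform grid that fit into U: a finite disjoint family of intervals, to
    which absolute continuity applies directly, and which eventually captures each point of an open
    U in ]c, d]. *)
Let U_ (U : set R) n : set R := \big[setU/set0]_(k < n.+1 | P U k) cell n k.

Let mcell n k : measurable (cell n k : set (measurableTypeR R)).
Proof. exact: measurable_itv. Qed.

Let mU U n : measurable (U_ U n : set (measurableTypeR R)).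
Proof. by rewrite /U_; apply: bigsetU_measurable => k _. Qed.

Let mu_cell n k : mu (cell n k) = (x_ n k.+1 - x_ n k)%:E.
Proof.
rewrite /cell lebesgue_measure_itv/= lte_fin; case: ltP => // h.
by congr EFin; apply/eqP; rewrite eq_sym subr_eq0 eq_le h x_mono.
Qed.

Let U_E U n : U_ U n = \bigcup_(k in [set k | k \in P U (n := n)]) cell n k.
Proof. exact/esym/bigcup_pred. Qed.

Let U_sub U n : U_ U n `<=` U.
Proof.
rewrite U_E => x [k /= /asboolP]; exact.
Qed.

Let cell_trivIset n (A : set 'I_n.+1) : trivIset A (cell n).
Proof.
apply/trivIsetP => k l _ _ kl.
wlog : k l kl / (k < l)%N.
  move=> wl; move: (kl); rewrite -val_eqE/= neq_ltn => /orP[|]; first exact: wl.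
  by rewrite setIC; apply: wl; rewrite eq_sym.
move=> {}kl; apply/eqP/negPn/negP => /set0P[x []].
rewrite /cell/= !in_itv/= => /andP[_ h1] /andP[h2 _].
by have := x_mono n kl; rewrite leNgt (lt_le_trans h2 h1).
Qed.

(** The cells inside U have total length at most the measure of U, so absolute continuity bounds
    their nu-mass uniformly in n. *)
Let nuU (e : R) : 0 < e -> exists2 del : R, 0 < del & forall U n, measurable (U : set (measurableTypeR R)) ->
  (mu U < del%:E)%E -> (nu (U_ U n) <= e%:E)%E.
Proof.
move=> e0; have [del del0 H] := acG e0; exists del => // U n mU' Ud.
(* Cells outside the family become the degenerate interval [c, c], which keeps the index set
   ['I_n.+1]. *)
pose u k := if P U (n := n) k then x_ n k else c.
pose v k := if P U (n := n) k then x_ n k.+1 else c.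
have kn (k : 'I_n.+1) : c <= x_ n k <= d by apply: x_in; rewrite ltnW.
have kn1 (k : 'I_n.+1) : c <= x_ n k.+1 <= d by apply: x_in.
have cu k : c <= u k by rewrite /u; case: ifP => // _; case/andP: (kn k).
have uv k : u k <= v k by rewrite /u/v; case: ifP => // _; exact: x_mono.
have := H n.+1 u v; rewrite /U_ measure_bigsetU_ord_cond//.
have -> : (\sum_(k < n.+1 | P U k) nu (cell n k) = (\sum_(k < n.+1) `|G (v k) - G (u k)|)%:E)%E.
  rewrite -sumEFin big_mkcond; apply: eq_bigr => k _; rewrite /u/v; case: ifP => [_|_].
    rewrite /cell nuE ?x_mono// !clampE// ger0_norm// subr_ge0; apply: ndG.
    - by case/andP: (kn k).
    - exact: x_mono.
    - by case/andP: (kn1 k).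
  by rewrite subrr normr0.
rewrite lee_fin => {}H; apply/ltW/H.
- by move=> k; split => //; rewrite /v; case: ifP => [_|_]; [case/andP: (kn1 k)|exact: ltW].
- move=> k l kl; rewrite /v; case: ifP => [Pk|_]; last by left.
  rewrite /u Pk; case: ifP => [Pl|Pl]; last by right; case/andP: (kn k).
  move: kl; rewrite -val_eqE/= neq_ltn => /orP[|] kl; [left|right]; exact: x_mono.
- rewrite -lte_fin (le_lt_trans _ Ud)//; have := le_measure mu _ _ (@U_sub U n).
  rewrite !inE => /(_ (mU _ _) mU'); apply: le_trans.
  rewrite /U_ measure_bigsetU_ord_cond// -sumEFin [leRHS]big_mkcond.
  apply: lee_sum => k _; rewrite /u/v; case: ifP => [_|_]; last by rewrite subrr.
  have h : ((x_ n k.+1 - x_ n k)%:E <= mu (cell n k))%E by rewrite mu_cell.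
  exact: h.
Qed.

Let cell_ex U x : open U -> U x -> D x -> exists m, forall n, (m <= n)%N -> U_ U n x.
Proof.
move=> oU Ux; rewrite /D/= in_itv/= => /andP[cx xd].
have [r /= r0 rU] := open_itvoo_subset oU Ux.
exists (Num.bound ((d - c) / (r / 2))) => n mn.
have hyp : exists k, x <= x_ n k by exists n.+1; rewrite x_end.
have [[|k] xk kmin] := ex_minnP hyp; first by move: xk; rewrite x_start leNgt cx.
have kx : x_ n k < x by rewrite ltNge; apply/negP => /kmin; rewrite ltnn.
have kn : (k < n.+1)%N.
  by rewrite ltnNge; apply/negP => /(x_mono n); rewrite x_end leNgt (lt_le_trans kx).
have mesh : x_ n k.+1 - x_ n k < r / 2.
  rewrite /x_ -natr1 (_ : _ - _ = (d - c) / n.+1%:R); last by field; rewrite nat1r pnatr_eq0.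
  have h : (d - c) / (r / 2) < n.+1%:R.
    have := @archi_boundP R ((d - c) / (r / 2)).
    rewrite divr_ge0 ?subr_ge0 ?(ltW cd)// ?divr_ge0// ?(ltW r0)// => /(_ isT)/lt_le_trans; apply.
    by rewrite ler_nat (leq_trans mn).
  by rewrite ltr_pdivrMr// mulrC -ltr_pdivrMr// divr_gt0.
rewrite U_E; exists (Ordinal kn); last by rewrite /cell/= in_itv/= kx xk.
apply/asboolP => y; rewrite /cell/= in_itv/= => /andP[h1 h2].
apply: (rU (r / 2)) => //=.
- by rewrite sub0r normrN gtr0_norm ?divr_gt0// gtr_pMr// invf_lt1// ltr1n.
- by rewrite divr_gt0.
- rewrite in_itv/=; apply/andP; split; lra.
Qed.

(** An open set of Lebesgue measure below del covers the null set; its grid approximations have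
    nu-mass at most e, and continuity from below carries this bound over to N. *)
Let nu_ac (N : set R) : measurable (N : set (measurableTypeR R)) -> mu N = 0%E -> nu (N `&` D) = 0%E.
Proof.
move=> mN N0; apply/eqP; rewrite eq_le measure_ge0 andbT; apply/lee_addgt0Pr => e e0.
rewrite add0e; have [del del0 H] := nuU e0.
have [U [oU NU muU0]] := outer_measure_open_le N (divr_gt0 del0 (ltr0Sn R 1)).
have muU : (mu U <= mu N + (del / 2)%:E)%E := muU0.
rewrite N0 add0e in muU.
have mUU : measurable (U : set (measurableTypeR R)) by exact: open_measurable.
have {}muU : (mu U < del%:E)%E by rewrite (le_lt_trans muU)// lte_fin; lra.
(* Successive grids are not nested, so the sets [U_ U n] need not increase; the intersections [W m]
   of their tails do. *)
pose W m := \bigcap_(n in [set n | (m <= n)%N]) U_ U n.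
have mW m : measurable (W m : set (measurableTypeR R)) by apply: bigcap_measurable => [|k _]; [exists m => /=|exact: mU].
have mWW : measurable (\bigcup_m W m : set (measurableTypeR R)) by exact: bigcup_measurable.
have ndW : nondecreasing_seq W.
  move=> m n mn; apply/subsetPset => x Wx k /= nk; apply: Wx => /=; exact: leq_trans nk.
have := nondecreasing_cvg_mu mW mWW ndW (mu := nu).
move=> cvgW; apply: (@le_trans _ _ (nu (\bigcup_m W m))).
  apply: le_measure; rewrite ?inE//; first exact: measurableI.
  move=> x [Nx Dx]; have [m hm] := cell_ex oU (NU _ Nx) Dx; exists m => // n /= mn; exact: hm.
rewrite -(cvg_lim _ cvgW)//; apply: lime_le; first by apply/cvg_ex; exists (nu (\bigcup_m W m)).
apply: nearW => m /=; apply: le_trans (H U m mUU muU).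
by apply: le_measure; rewrite ?inE// => x; apply => /=.
Qed.

Let nuf : {finite_measure set (measurableTypeR R) -> \bar R} := mfrestr mD nuD.

(* Absolute continuity of G makes its Stieltjes measure dominated by Lebesgue
   measure, so that G is the integral of a Radon-Nikodym density. *)
Lemma nd_racont_derivable : {ae mu, forall x, c < x < d -> derivable G x 1}.
Proof.
have dom : nuf `<< (mu : {sigma_finite_measure set (measurableTypeR R) -> \bar R}).
  apply/null_content_dominatesP => A mA A0; exact: nu_ac.
have [g [g0 gfin gint gE]] := radon_nikodym_sigma_finite dom.
have gint' : mu.-integrable setT (EFin \o (fine \o g)).
  by apply: eq_integrable gint => // x _ /=; rewrite fineK.
have GE x : c < x < d -> G x = G c + (\int[mu]_(t in `]c, x]) (fine \o g) t).
  move=> /andP[cx xd]; have := gE `]c, x]%classic (measurable_itv _).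
  rewrite /nuf/= /mfrestr /mrestr (_ : _ `&` D = `]c, x]%classic); last first.
    apply/setIidl => t /=; rewrite /D/= !in_itv/= => /andP[-> h] /=.
    exact: le_trans h (ltW xd).
  rewrite nuE ?(ltW cx)// !clampE ?lexx ?(ltW cd) ?(ltW cx) ?(ltW xd)// => h.
  rewrite /Rintegral (eq_integral g); last by move=> t _ /=; rewrite fineK.
  by rewrite -h/= addrC subrK.
have gi y : mu.-integrable [set` Interval (BRight c) (BRight y)] (EFin \o (fine \o g)).
  exact: integrableS gint'.
have := @FTC1 R (fine \o g) (BRight c) gi (open_integrable_locally openT gint').
apply: filterS; first exact: (ae_filter_ringOfSetsType mu).
move=> x /= h /andP[cx xd].
have [df _] := h cx.
apply: (@near_eq_derivable _ _ _ (fun x => G c + \int[mu]_(t in `]c, x]) (fine \o g) t)).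
  have : x \in `]c, d[ by rewrite in_itv/= cx xd.
  move/near_in_itvoo; apply: filterS => y; rewrite in_itv/= => yy; exact/esym/GE.
exact: derivableD.
Qed.

End stieltjes_density.

(** * Algebra of absolutely continuous functions *)

Section abs_cont_calculus.
Context {R : realType}.
Implicit Types (c d : R) (f g : R -> R).
Local Notation mu := (@lebesgue_measure R).

Lemma racont_derivable c d f : c < d -> racont c d f ->
  {ae mu, forall x, c < x < d -> derivable f x 1}.
Proof.
move=> cd fac; have [h1 h2 h3 h4] := racont_nd_decomp fac.
have := nd_racont_derivable cd h1 h3; have := nd_racont_derivable cd h2 h4.
apply: filterS2; first exact: (ae_filter_ringOfSetsType mu).
move=> x k2 k1 xcd; have -> : f = variation_fun c f - (variation_fun c f - f).
  by apply/funext => y /=; rewrite !fctE opprB addrC subrK.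
by apply: derivableB; [exact: k1 | exact: k2].
Qed.

Lemma racont_bounded c d f : c <= d -> racont c d f ->
  exists2 M, 0 <= M & forall x, c <= x <= d -> `|f x| <= M.
Proof.
move=> cd fac; exists (`|f c| + fine (total_variation c d f)).
  by rewrite addr_ge0// fine_ge0// total_variation_ge0.
move=> x /andP[cx xd].
have fin : total_variation c x f \is a fin_num.
  rewrite ge0_fin_numE ?total_variation_ge0//; apply: racont_TV_lty => //.
  exact: racont_sub fac.
have h : `|f x - f c| <= fine (total_variation c x f).
  by rewrite -lee_fin fineK// total_variation_ge.
have -> : f x = f c + (f x - f c) by rewrite addrC subrK.
rewrite (le_trans (ler_normD _ _))// lerD2l (le_trans h)//.
apply: fine_le => //.
  by rewrite ge0_fin_numE ?total_variation_ge0//; exact: racont_TV_lty.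
by rewrite (total_variationD f cx xd) leeDl// total_variation_ge0.
Qed.

Lemma racontD c d f g : racont c d f -> racont c d g -> racont c d (fun x => f x + g x).
Proof.
move=> fac gac.
have Ng : racont c d (fun x => - g x).
  move=> e /gac[del d0 H]; exists del => // n u v h1 h2 h3.
  by under eq_bigr do rewrite -opprD normrN; exact: H.
by have := racontB fac Ng; under eq_fun do rewrite opprK.
Qed.

Lemma racont_lip c d f (L : R) : 0 <= L ->
  (forall x y, c <= x <= d -> c <= y <= d -> `|f y - f x| <= L * `|y - x|) -> racont c d f.
Proof.
move=> L0 H e e0; have L1 : 0 < L + 1 by lra.
exists (e / (L + 1)); first by rewrite divr_gt0.
move=> n u v h _ hs; apply: (@le_lt_trans _ _ (\sum_(i < n) (L + 1) * (v i - u i))).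
  apply: ler_sum => i _; have [a1 a2 a3] := h i.
  have uv : 0 <= v i - u i by rewrite subr_ge0.
  rewrite (le_trans (H _ _ _ _))//; first by rewrite a1 (le_trans a2).
  - by rewrite a3 (le_trans a1).
  - by rewrite (ger0_norm uv) ler_wpM2r// lerDl.
by rewrite -mulr_sumr mulrC -ltr_pdivlMr.
Qed.

Lemma racontM c d f g : c <= d -> racont c d f -> racont c d g ->
  racont c d (fun x => f x * g x).
Proof.
move=> cd fac gac e e0.
have [M M0 fM] := racont_bounded cd fac; have [N N0 gN] := racont_bounded cd gac.
have e20 : 0 < e / 2 by rewrite divr_gt0.
have e1 : 0 < e / 2 / (N + 1) by rewrite divr_gt0// ltr_wpDl.
have e2 : 0 < e / 2 / (M + 1) by rewrite divr_gt0// ltr_wpDl.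
have [d1 d10 H1] := fac _ e1; have [d2 d20 H2] := gac _ e2.
exists (Num.min d1 d2); first by rewrite lt_min d10.
move=> n u v uv duv; rewrite lt_min => /andP[k1 k2].
have {H1} := H1 _ _ _ uv duv k1; have {H2} := H2 _ _ _ uv duv k2.
rewrite ltr_pdivlMr ?ltr_wpDl// => {}k2; rewrite ltr_pdivlMr ?ltr_wpDl// => {}k1.
rewrite (splitr e) (le_lt_trans _ (ltrD k1 k2))// !mulr_suml -big_split/=.
apply: ler_sum => i _; have [a1 a2 a3] := uv i.
rewrite (_ : f (v i) * g (v i) - f (u i) * g (u i) =
  (f (v i) - f (u i)) * g (v i) + (g (v i) - g (u i)) * f (u i)); last by ring.
rewrite (le_trans (ler_normD _ _))// !normrM; apply: lerD.
  by rewrite ler_wpM2l// (le_trans (gN _ _)) ?lerDl// a3 (le_trans a1).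
by rewrite ler_wpM2l// (le_trans (fM _ _)) ?lerDl// a1 (le_trans a2).
Qed.

Lemma racont_ext c d f g : (forall x, c <= x <= d -> f x = g x) -> racont c d f -> racont c d g.
Proof.
move=> fg fac e /fac[del d0 H]; exists del => // n u v h1 h2 h3.
rewrite (eq_bigr (fun i => `|f (v i) - f (u i)|)); first exact: H.
by move=> i _; have [k1 k2 k3] := h1 i; rewrite !fg ?k1 ?k3 ?(le_trans k1 k2) ?(le_trans k2).
Qed.

Lemma abs_cont_ReIm c d (f : R -> R[i]) : abs_cont c d f <->
  racont c d (fun x => Re (f x)) /\ racont c d (fun x => Im (f x)).
Proof.
split=> [fac|[fr fi] e e0].
  split=> e /fac[del d0 H]; exists del => // n u v h1 h2 h3;
    (apply: le_lt_trans (H _ _ _ h1 h2 h3); apply: ler_sum => i _).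
    by rewrite (le_trans _ (le_Re_normc _))// !ReImE.
  by rewrite (le_trans _ (le_Im_normc _))// !ReImE.
have e20 : 0 < e / 2 by rewrite divr_gt0.
have [d1 d10 H1] := fr _ e20; have [d2 d20 H2] := fi _ e20.
exists (Num.min d1 d2); first by rewrite lt_min d10.
move=> n u v uv duv; rewrite lt_min => /andP[h1 h2].
have := H1 _ _ _ uv duv h1; have := H2 _ _ _ uv duv h2.
move=> k2 k1; rewrite (splitr e) (le_lt_trans _ (ltrD k1 k2))// -big_split/=.
by apply: ler_sum => i _; rewrite (le_trans (normc_le_ReIm _))// !ReImE.
Qed.

End abs_cont_calculus.

(** * Derivatives on [a, +oo[ *)
Section right_derivative.
Context {R : realType} (a : R).
Implicit Types (r s : R -> R) (x t l : R).
Local Notation Ia := (`[a, +oo[%classic : set R).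

(** The limit of difference quotients with the denominator multiplied out, which makes the rules of
    differentiation free of division; [isrdP] gives the equivalence. *)
Definition is_rderiv r x l : Prop := forall e, 0 < e -> exists2 del, 0 < del &
  forall t, a <= t -> `|t - x| < del -> `|r t - r x - l * (t - x)| <= e * `|t - x|.

Let Fa x := within Ia x^'.

Lemma Fa_proper x : a <= x -> ProperFilter (Fa x).
Proof.
move=> ax; apply: Build_ProperFilter_ex => P FP.
have /nbhs_ballP[e /= e0 H] : nbhs x (fun t => t != x -> Ia t -> P t) := FP.
exists (x + e / 2).
have e2 : 0 < e / 2 by rewrite divr_gt0.
apply: H => /=.
- by rewrite /ball/= opprD addrA subrr add0r normrN gtr0_norm//; lra.
- by rewrite gt_eqF// ltrDl.
- by rewrite in_itv/= andbT (le_trans ax)// lerDl ltW.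
Qed.

Lemma isrdP r x l : is_rderiv r x l <-> diffquo r x t @[t --> Fa x] --> l.
Proof.
split=> [H|].
  apply/(@cvgrPdist_le _ R^o) => e /H[del d0 {}H]; rewrite near_withinE.
  apply/nbhs_ballP; exists del => // t /= xt tx /=; rewrite in_itv/= andbT => ta.
  have h : `|r t - r x - l * (t - x)| <= e * `|t - x| by apply: H => //; rewrite distrC.
  have tx0 : t - x != 0 by rewrite subr_eq0.
  rewrite distrC /diffquo.
  rewrite (_ : (r t - r x) / (t - x) - l = (r t - r x - l * (t - x)) / (t - x)); last by field.
  by rewrite normrM normfV ler_pdivrMr ?normr_gt0.
move/(@cvgrPdist_le _ R^o) => H e /H; rewrite near_withinE => /nbhs_ballP[del /= d0 {}H].
exists del => // t ta tx.
have [->|tx0] := eqVneq t x; first by rewrite !subrr mulr0 subrr normr0 mulr0.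
have := H t; rewrite /ball/= distrC => /(_ tx tx0); rewrite in_itv/= andbT => /(_ ta).
have tx0' : t - x != 0 by rewrite subr_eq0.
rewrite /diffquo distrC (_ : (r t - r x) / (t - x) - l = (r t - r x - l * (t - x)) / (t - x)); last by field.
by rewrite normrM normfV ler_pdivrMr// normr_gt0.
Qed.

Lemma is_rderiv_rderiv r x l : a <= x -> is_rderiv r x l -> rderivable a r x /\ rderiv a r x = l.
Proof.
move=> ax /isrdP h; split; first by apply/cvg_ex; exists l.
have := Fa_proper ax => FF.
by apply: (@cvg_lim R^o) => //; exact: Rhausdorff.
Qed.

Lemma rderivableP r x : a <= x -> rderivable a r x -> is_rderiv r x (rderiv a r x).
Proof. by move=> ax h; apply/isrdP. Qed.

Lemma is_rderiv_ext r s x l : a <= x -> (forall t, a <= t -> r t = s t) -> is_rderiv r x l -> is_rderiv s x l.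
Proof.
move=> ax rs H e /H[del d0 {}H]; exists del => // t ta tx.
by rewrite -!rs//; exact: H.
Qed.

(** No derivability is required: the two image filters coincide, so even the default value of [lim]
    is the same. *)
Lemma rderiv_ext r s x : a <= x -> (forall t, a <= t -> r t = s t) -> rderiv a r x = rderiv a s x.
Proof.
move=> ax rs; rewrite /rderiv.
suff -> : diffquo r x t @[t --> Fa x] = diffquo s x t @[t --> Fa x] by [].
rewrite /fmap/=; apply/funext => P; apply/propext.
have e t : Ia t -> diffquo r x t = diffquo s x t.
  by rewrite /= in_itv/= andbT => at_; rewrite /diffquo !rs.
by split; apply: (@filterS _ x^') => t h At; have := h At; rewrite /= e.
Qed.

Lemma rderivable_ext r s x : a <= x -> (forall t, a <= t -> r t = s t) ->
  rderivable a r x -> rderivable a s x.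
Proof.
move=> ax rs /(rderivableP ax) /(is_rderiv_ext ax rs); by case/(is_rderiv_rderiv ax).
Qed.

Lemma derivable_isrd r x : derivable r x 1 -> exists l, is_rderiv r x l.
Proof.
move=> /cvg_ex[/= l] /(@cvgrPdist_le _ R^o) H; exists l => e /H.
move=> /nbhs_ballP[del /= d0 {}H]; exists del => // t ta tx.
have [->|tx0] := eqVneq t x; first by rewrite !subrr mulr0 subrr normr0 mulr0.
have tx0' : t - x != 0 by rewrite subr_eq0.
have := H (t - x); rewrite /ball/= sub0r normrN => /(_ tx tx0').
rewrite [(t - x) *: _]mulr1 subrK distrC [_ *: _]mulrC.
rewrite (_ : (r t - r x) / (t - x) - _ = (r t - r x - l * (t - x)) / (t - x)); last by field.
by rewrite normrM normfV ler_pdivrMr// normr_gt0.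
Qed.

Lemma isrdD r s x l k : is_rderiv r x l -> is_rderiv s x k -> is_rderiv (fun t => r t + s t) x (l + k).
Proof.
move=> Hr Hs e e0; have e20 : 0 < e / 2 by rewrite divr_gt0.
have [d1 d10 H1] := Hr _ e20; have [d2 d20 H2] := Hs _ e20.
exists (Num.min d1 d2); first by rewrite lt_min d10.
move=> t ta; rewrite lt_min => /andP[h1 h2].
rewrite (_ : _ - _ - _ = (r t - r x - l * (t - x)) + (s t - s x - k * (t - x))); last by ring.
by rewrite (splitr e) mulrDl (le_trans (ler_normD _ _))// lerD ?H1 ?H2.
Qed.

Lemma isrdZ r x l (k : R) : is_rderiv r x l -> is_rderiv (fun t => k * r t) x (k * l).
Proof.
move=> Hr e e0; have k0 : 0 < `|k| + 1 by rewrite ltr_wpDl.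
have [del d0 H] := Hr _ (divr_gt0 e0 k0); exists del => // t ta tx.
rewrite (_ : _ - _ - _ = k * (r t - r x - l * (t - x))); last by ring.
rewrite normrM; apply: (@le_trans _ _ ((`|k| + 1) * `|r t - r x - l * (t - x)|)).
  by rewrite ler_wpM2r// lerDl.
rewrite (le_trans (ler_wpM2l (ltW k0) (H _ ta tx)))//.
by rewrite mulrA [(_ + 1) * _]mulrC divfK// gt_eqF.
Qed.

Lemma is_rderiv_lip r x l : is_rderiv r x l -> exists2 del, 0 < del & forall t, a <= t ->
  `|t - x| < del -> `|r t - r x| <= (`|l| + 1) * `|t - x|.
Proof.
move=> /(_ _ ltr01)[del d0 H]; exists del => // t ta tx.
rewrite (_ : r t - r x = (r t - r x - l * (t - x)) + l * (t - x)); last by ring.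
by rewrite (le_trans (ler_normD _ _))// mulrDl addrC lerD ?H// normrM.
Qed.

Lemma isrdM r s x l k : is_rderiv r x l -> is_rderiv s x k -> is_rderiv (fun t => r t * s t) x (l * s x + r x * k).
Proof.
move=> Hr Hs e e0.
have [d0 d00 H0] := is_rderiv_lip Hr.
(* C adds up the coefficients of the two linear errors and of the cross term A B, where one factor
   |t - x| is at most e / C; the final 1 keeps C positive. *)
pose C := `|s x| + `|r x| + (`|l| + 1) * (`|k| + 1) + 1.
have C0 : 0 < C by rewrite ltr_wpDl// !addr_ge0// mulr_ge0// addr_ge0.
have eC : 0 < e / C by rewrite divr_gt0.
have [d1 d10 H1] := Hr _ eC; have [d2 d20 H2] := Hs _ eC; have [d3 d30 H3] := is_rderiv_lip Hs.
exists (Num.min (Num.min d0 d1) (Num.min (Num.min d2 d3) (e / C))).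
  by rewrite !lt_min d00 d10 d20 d30 eC.
move=> t ta; rewrite !lt_min => /andP[/andP[t0 t1] /andP[/andP[t2 t3] t4]].
have := H0 t ta t0; have := H1 t ta t1; have := H2 t ta t2; have := H3 t ta t3.
set dt := t - x in t4 *; set A := r t - r x; set B := s t - s x => k3 k2 k1 k0.
rewrite (_ : r t * s t - r x * s x - (l * s x + r x * k) * dt =
  (A - l * dt) * s x + r x * (B - k * dt) + A * B); last by rewrite /A/B; ring.
have nd : 0 <= `|dt| by [].
apply: (@le_trans _ _ (e / C * `|dt| * `|s x| + `|r x| * (e / C * `|dt|) +
   (`|l| + 1) * `|dt| * ((`|k| + 1) * `|dt|))).
  rewrite (le_trans (ler_normD _ _))// lerD//.
    by rewrite (le_trans (ler_normD _ _))// lerD// normrM ?ler_wpM2r ?ler_wpM2l.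
  by rewrite normrM ler_pM.
have := ler_wpM2l (mulr_ge0 nd (mulr_ge0 (addr_ge0 (normr_ge0 l) ler01) (addr_ge0 (normr_ge0 k) ler01))) (ltW t4).
have -> : e * `|dt| = e / C * `|dt| * `|s x| + `|r x| * (e / C * `|dt|)
  + `|dt| * ((`|l| + 1) * (`|k| + 1)) * (e / C) + e / C * `|dt|.
  by rewrite /C; field; rewrite gt_eqF.
have := mulr_ge0 (ltW eC) nd; lra.
Qed.

End right_derivative.

(** * Measurability and almost everywhere existence of the derivative *)

Section derivative_measurable.
Context {R : realType} (a : R).
Implicit Types (r s : R -> R) (x t l : R).
Local Notation Ia := (`[a, +oo[%classic : set R).
Local Notation mu := (@lebesgue_measure R).

Definition econt r : Prop := forall x, a <= x -> forall e, 0 < e -> exists2 del, 0 < del &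
  forall t, a <= t -> `|t - x| < del -> `|r t - r x| < e.

Lemma racont_econt r : (forall b, a <= b -> racont a b r) -> econt r.
Proof.
move=> H x ax e e0; have [del d0 K] := racont_continuous_at (H (x + 1) (ler_wpDr ler01 ax)) e0.
exists (Num.min del 1); first by rewrite lt_min d0 ltr01.
move=> t ta; rewrite lt_min => /andP[h1 h2].
have [tx|xt] := leP t x.
  rewrite distrC; apply: K => //; first by rewrite lerDl.
  by rewrite -[ltLHS]ger0_norm ?subr_ge0// distrC.
apply: K => //; first exact: ltW.
  by rewrite -lerBlDl ltW// (le_lt_trans (ler_norm _)).
by rewrite -[ltLHS]ger0_norm ?subr_ge0// ltW.
Qed.

Definition clampl r t := r (Num.max a t).

Lemma clamplE r t : a <= t -> clampl r t = r t.
Proof. by move=> at_; rewrite /clampl (max_idPr at_). Qed.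

Lemma clampl_continuous r : econt r -> continuous (clampl r).
Proof.
move=> cr x; apply/(@cvgrPdist_lt _ R^o) => e e0.
have mx : a <= Num.max a x by rewrite le_max lexx.
have [del d0 H] := cr _ mx e e0; apply/nbhs_ballP; exists del => // t /= xt.
rewrite /clampl distrC; apply: H; first by rewrite le_max lexx.
apply: le_lt_trans xt; have k1 := ler_norm (x - t); have k2 := ler_norm (t - x).
rewrite distrC in k2.
have [h1|h1] := leP a t; have [h2|h2] := leP a x.
- by rewrite distrC.
- by rewrite ger0_norm; lra.
- by rewrite ler0_norm; lra.
- by rewrite subrr normr0.
Qed.

Lemma measurable_Ia : measurable (Ia : set (measurableTypeR R)).
Proof. exact: measurable_itv. Qed.

Lemma econt_measurable r : econt r -> measurable_fun Ia r.
Proof.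
move=> cr; apply: (@eq_measurable_fun _ _ _ _ _ (clampl r)).
  by move=> x; rewrite inE/= in_itv/= andbT => ax; rewrite clamplE.
apply: (measurable_funS measurableT) => //.
by apply: continuous_measurable_fun; exact: clampl_continuous.
Qed.

Section rderiv_meas.
Variables (r : R -> R) (cr : econt r).
Let rr := clampl r.
Let Q x (h : R) := (rr (x + h) - rr x) / h.

Let crr : continuous rr. Proof. exact: clampl_continuous. Qed.

Let mQ h : measurable_fun [set: R] (Q ^~ h).
Proof.
apply: measurable_funM => //; apply: measurable_funB; last exact: continuous_measurable_fun.
have -> : (fun x => rr (x + h)) = rr \o (fun x => x + h) by [].
apply: measurableT_comp; first exact: continuous_measurable_fun.
exact: measurable_funD.
Qed.

Let S k m (h1 h2 : rat) : set R :=
  [set x | ratr h1 != 0 :> R -> ratr h2 != 0 :> R -> `|ratr h1| < m.+1%:R^-1 :> R -> `|ratr h2| < m.+1%:R^-1 :> R ->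
     `|Q x (ratr h1) - Q x (ratr h2)| <= k.+1%:R^-1].

Let mS k m h1 h2 : measurable (S k m h1 h2).
Proof.
rewrite /S.
have [e1|n1] := boolP (ratr h1 != 0 :> R); last first.
  by rewrite (_ : mkset _ = setT)//; apply/seteqP; split => // x _ /=.
have [e2|n2] := boolP (ratr h2 != 0 :> R); last first.
  by rewrite (_ : mkset _ = setT)//; apply/seteqP; split => // x _ /=.
have [e3|n3] := boolP (`|ratr h1| < m.+1%:R^-1 :> R); last first.
  by rewrite (_ : mkset _ = setT)//; apply/seteqP; split => // x _ /=.
have [e4|n4] := boolP (`|ratr h2| < m.+1%:R^-1 :> R); last first.
  by rewrite (_ : mkset _ = setT)//; apply/seteqP; split => // x _ /=.
rewrite (_ : mkset _ = [set: R] `&` [set x | `|Q x (ratr h1) - Q x (ratr h2)| <= k.+1%:R^-1]); last first.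
  by rewrite setTI; apply/seteqP; split => x /= H; [exact: H|move=> *; exact: H].
apply: measurable_fun_le => //; apply: measurableT_comp => //.
exact: measurable_funB.
Qed.

(** The Cauchy criterion for difference quotients, over rational increments only. Continuity of the
    quotient in its increment makes these sufficient, and the set is then a countable combination of
    measurable ones. *)
Let E : set R := \bigcap_k \bigcup_m \bigcap_h1 \bigcap_h2 S k m h1 h2.

Let mE : measurable E.
Proof.
apply: bigcapT_measurable => k; apply: bigcupT_measurable => m.
rewrite -[X in measurable X]setCK; apply: measurableC; rewrite setC_bigcap.
apply: bigcupT_measurable_rat => h1.
rewrite setC_bigcap; apply: bigcupT_measurable_rat => h2; exact: measurableC.
Qed.

Let Q_cont x h : h != 0 -> forall e, 0 < e -> exists2 del, 0 < del &
  forall h', `|h' - h| < del -> h' != 0 /\ `|Q x h' - Q x h| < e.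
Proof.
move=> h0 e e0.
have : Q x h' @[h' --> h] --> Q x h.
  apply: (@cvgM R R^o); last exact: cvgV.
  apply: (@cvgB _ R^o); last exact: cvg_cst.
  apply: (@cvg_comp _ _ _ (fun h' => x + h') rr _ (nbhs (x + h))); last exact: crr.
  by apply: (@cvgD _ R^o); [exact: cvg_cst|exact: cvg_id].
move=> /(@cvgrPdist_lt _ R^o)/(_ e e0)/nbhs_ballP[d1 /= d10 H].
exists (Num.min d1 `|h|); first by rewrite lt_min d10 normr_gt0.
move=> h'; rewrite lt_min => /andP[k1 k2]; split.
  by apply: contraTneq k2 => ->; rewrite sub0r normrN ltxx.
by rewrite distrC; apply: H; rewrite /ball/= distrC.
Qed.

Let ratnear (h : R) del : 0 < del -> exists q : rat, `|ratr q - h| < del.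
Proof.
move=> d0; have [|q] := @rat_in_itvoo R (h - del) (h + del); first lra.
by rewrite in_itv/= => /andP[h1 h2]; exists q; rewrite ltr_norml; lra.
Qed.

Let EP x : a < x -> E x <-> rderivable a r x.
Proof.
move=> ax; split=> [Ex|].
  have ext t : a <= t -> rr t = r t by exact: clamplE.
  apply: (rderivable_ext (ltW ax) ext).
  have := Fa_proper (ltW ax) => FF.
  apply/cauchy_cvgP/cauchy_exP => e e0.
  have [k ke] : exists k, k.+1%:R^-1 < e / 2 :> R.
    have e20 : 0 < e / 2 by rewrite divr_gt0.
    exists (Num.bound (e / 2)^-1); rewrite -[ltRHS]invrK ltf_pV2 ?posrE ?invr_gt0//.
    rewrite (lt_trans (archi_boundP _)) ?ltr_nat// invr_ge0 ltW//.
  have [m _ Hm] := Ex k I.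
  have m0 : (0 : R) < m.+1%:R^-1 by rewrite invr_gt0.
  have [q0 /andP[q00 q01]] : exists q : rat, 0 < (ratr q : R) < m.+1%:R^-1.
    by have [q] := rat_in_itvoo m0; rewrite in_itv; exists q.
  exists (Q x (ratr q0)); apply/nbhs_ballP; exists m.+1%:R^-1 => //= t xt tx _ /=.
  rewrite /ball/= /diffquo.
  have h0 : t - x != 0 by rewrite subr_eq0.
  have -> : (rr t - rr x) / (t - x) = Q x (t - x) by rewrite /Q [x + _]addrC subrK.
  have e20 : 0 < e / 2 by rewrite divr_gt0.
  have [d1 d10 H1] := Q_cont x h0 e20.
  have d20 : 0 < m.+1%:R^-1 - `|t - x| by rewrite subr_gt0 distrC.
  (* The real increment t - x is replaced by a rational one, still below 1/(m + 1), to which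
     membership in [E] applies. *)
  have [q] : exists q : rat, `|ratr q - (t - x)| < Num.min d1 (m.+1%:R^-1 - `|t - x|).
    by apply: ratnear; rewrite lt_min d10.
  rewrite lt_min => /andP[k1 k2]; have [q0' k3] := H1 _ k1.
  have := Hm q0 I q I; rewrite /S/= gt_eqF// gtr0_norm// => /(_ isT q0' q01).
  have -> : `|ratr q| < m.+1%:R^-1 :> R.
    rewrite -[ratr q : R](subrK (t - x)) (le_lt_trans (ler_normD _ _))//.
    by rewrite -ltrBrDr.
  move=> /(_ isT) k4.
  rewrite -(subrKA (Q x (ratr q))) (le_lt_trans (ler_normD _ _))// (splitr e) ltrD//.
  exact: le_lt_trans k4 ke.
move=> /(rderivableP (ltW ax)) D k _.
have k0 : (0 : R) < k.+1%:R^-1 / 2 by rewrite divr_gt0// invr_gt0.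
have [del d0 H] := D _ k0.
have d1 : 0 < Num.min del (x - a) by rewrite lt_min d0 subr_gt0.
have [m mP] : exists m, m.+1%:R^-1 < Num.min del (x - a) :> R.
  exists (Num.bound (Num.min del (x - a))^-1); rewrite -[ltRHS]invrK ltf_pV2 ?posrE ?invr_gt0//.
  rewrite (lt_trans (archi_boundP _)) ?ltr_nat// invr_ge0 ltW//.
exists m => // h1 _ h2 _ n1 n2 l1 l2.
have main (q : R) : q != 0 -> `|q| < m.+1%:R^-1 -> `|Q x q - rderiv a r x| <= k.+1%:R^-1 / 2.
  move=> q0 qm; have := lt_trans qm mP; rewrite lt_min => /andP[qd qx].
  have axq : a <= x + q.
    by have := ler_norm (- q); rewrite normrN; lra.
  have := H (x + q) axq; rewrite addrAC subrr add0r => /(_ qd) h.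
  rewrite /Q /rr (clamplE _ axq) (clamplE _ (ltW ax)).
  rewrite (_ : _ / q - _ = (r (x + q) - r x - rderiv a r x * q) / q); last by field.
  by rewrite normrM normfV ler_pdivrMr ?normr_gt0.
rewrite -(subrKA (rderiv a r x)) (le_trans (ler_normD _ _))// [leRHS]splitr lerD ?main//.
by rewrite distrC main.
Qed.

(* [rderiv] takes the default value of [lim] off the set of differentiability, so
   this needs that set to be Borel. *)
Lemma rderiv_measurable : measurable_fun Ia (rderiv a r).
Proof.
(* The point a is split off because [E] is built on two-sided increments, so that [EP] describes
   derivability within [a, +oo[ for x > a. *)
have mU : Ia = [set a] `|` `]a, +oo[%classic.
  by apply/seteqP; split => x /=; rewrite !in_itv/= !andbT le_eqVlt eq_sym => /predU1P.
rewrite mU; apply/measurable_funU => //; split; first exact: measurable_fun_set1.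
pose f n x := if x \in E then Q x n.+1%:R^-1 else point.
apply: (@measurable_fun_cvg _ _ _ _ f) => [m|x].
  apply: (measurable_funS measurableT) => //; apply: measurable_fun_ifT => //.
  apply: (measurable_fun_bool true) => //.
  rewrite (_ : _ @^-1` _ = E) ?setTI//; apply/seteqP; split => x /=.
    by move=> /set_mem.
  by move=> Ex; apply/mem_set.
rewrite /= in_itv/= andbT => ax; rewrite /f.
have [/set_mem Ex|/negP nE] := boolP (x \in E).
  have D := rderivableP (ltW ax) ((EP ax).1 Ex).
  apply/(@cvgrPdist_le _ R^o) => e /D[del d0 H].
  have [N _ HN] := near_infty_natSinv_lt (PosNum d0); exists N => // n /= Nn.
  have nd : n.+1%:R^-1 < del := HN n Nn.
  have an : a <= x + n.+1%:R^-1 by rewrite ler_wpDr// ltW.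
  have n0 : (0 : R) < n.+1%:R^-1 by rewrite invr_gt0.
  have := H _ an; rewrite addrAC subrr add0r gtr0_norm// => /(_ nd) h.
  rewrite distrC /Q /rr (clamplE _ an) (clamplE _ (ltW ax)).
  rewrite (_ : _ / _ - _ = (r (x + n.+1%:R^-1) - r x - rderiv a r x * n.+1%:R^-1) / n.+1%:R^-1).
    by rewrite normrM normfV (gtr0_norm n0) ler_pdivrMr.
  by field; rewrite nat1r pnatr_eq0.
rewrite /rderiv dvgP; first exact: cvg_cst.
by move=> h; apply: nE; apply/mem_set/EP.
Qed.

End rderiv_meas.

Lemma lac_rderivable_ae r : (forall b, a <= b -> racont a b r) ->
  {ae mu, forall x, a <= x -> rderivable a r x}.
Proof.
move=> H.
have H1 n : {ae mu, forall x, a < x < a + n.+1%:R -> derivable r x 1}.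
  by apply: racont_derivable; [rewrite ltrDl|apply: H; rewrite lerDl].
have H2 : {ae mu, forall x n, a < x < a + n.+1%:R -> derivable r x 1}.
  exact/ae_foralln.
have H3 : {ae mu, forall x, x != a}.
  exists [set a]; split => //; first exact: lebesgue_measure_set1.
  by move=> x /= /negP/negPn/eqP.
apply: filterS2 H2 H3; first exact: (ae_filter_ringOfSetsType mu).
move=> x h xa ax; have := h (Num.bound (x - a)).
have -> : a < x < a + (Num.bound (x - a)).+1%:R.
  rewrite lt_neqAle eq_sym xa ax/= -ltrBlDl (lt_trans (archi_boundP _)) ?subr_ge0//.
  by rewrite ltr_nat.
move=> /(_ isT) /(derivable_isrd a)[l] /(is_rderiv_rderiv ax)[].
by [].
Qed.

End derivative_measurable.

Section L2_extra.
Context {R : realType} (m : {measure set (measurableTypeR R) -> \bar R}).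
Context (D : set R) (mD : measurable (D : set (measurableTypeR R))).

Lemma L2_aeq f g : inL2 m D g -> cmeas D f -> aeq m D f g -> inL2 m D f.
Proof.
move=> /inL2P[mg g2] mf fg; apply/inL2P; split => //.
apply: (rint_ae_eq mD g2 _ _).1.
  by apply: measurable_funX; exact: cmeas_normc.
by apply: filterS fg => x h Dx; rewrite (h Dx).
Qed.

Lemma cmeasR (r : R -> R) : measurable_fun D r -> cmeas D (fun x => (r x)%:C).
Proof. by split => //=; exact: measurable_cst. Qed.

Lemma cmeasN f : cmeas D f -> cmeas D (fun x => - f x).
Proof.
by case=> h1 h2; split; under eq_fun do rewrite ReImE; exact: measurable_funN.
Qed.

End L2_extra.

Section lebesgue_ae.
Context {R : realType}.
Local Notation mu := (@lebesgue_measure R).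

Lemma ae_lebesgueS (P Q : R -> Prop) : (forall x, P x -> Q x) ->
  {ae mu, forall x, P x} -> {ae mu, forall x, Q x}.
Proof. by move=> PQ; apply: filterS => //; exact: (ae_filter_ringOfSetsType mu). Qed.

Lemma ae_lebesgueS2 (P Q S : R -> Prop) : (forall x, P x -> Q x -> S x) ->
  {ae mu, forall x, P x} -> {ae mu, forall x, Q x} -> {ae mu, forall x, S x}.
Proof. by move=> PQ; apply: filterS2 => //; exact: (ae_filter_ringOfSetsType mu). Qed.

End lebesgue_ae.

(** * The maximal domain and the Green identity *)
Section Dstar_theory.
Context {R : realType} (a : R) (q : R -> R) (q_loc : locally_summable a q).
Implicit Types (y z f g : R -> R[i]) (w : R -> R) (x t : R).
Local Notation Ia := (`[a, +oo[%classic : set R).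
Local Notation mu := (@lebesgue_measure R).
Local Notation ell := (ell a q).
Local Notation cderiv := (cderiv a).
Local Notation Dstar := (Dstar a q).
Let mI := @measurable_Ia R a.

Definition is_cderiv y x (l : R[i]) : Prop :=
  is_rderiv a (fun t => Re (y t)) x (Re l) /\ is_rderiv a (fun t => Im (y t)) x (Im l).

Lemma is_cderiv_cderiv y x l : a <= x -> is_cderiv y x l -> cderivable a y x /\ cderiv y x = l.
Proof.
move=> ax [/(is_rderiv_rderiv ax)[h1 h2] /(is_rderiv_rderiv ax)[h3 h4]]; split; first by [].
by apply: complexP; rewrite /Defs.cderiv /= ?h2 ?h4.
Qed.

Lemma cderivableP y x : a <= x -> cderivable a y x -> is_cderiv y x (cderiv y x).
Proof. by move=> ax [h1 h2]; split; exact: rderivableP. Qed.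

Lemma is_rderiv_eq r s x l : (forall t, r t = s t) -> is_rderiv a r x l -> is_rderiv a s x l.
Proof. by move=> rs; rewrite (_ : r = s)//; apply/funext. Qed.

Lemma is_cderiv_ext y z x l : a <= x -> (forall t, a <= t -> y t = z t) -> is_cderiv y x l -> is_cderiv z x l.
Proof.
move=> ax yz [h1 h2]; split; [apply: is_rderiv_ext h1|apply: is_rderiv_ext h2] => // t ta;
  by rewrite yz.
Qed.

Lemma is_cderiv_lin (k : R[i]) y z x l l' : is_cderiv y x l -> is_cderiv z x l' ->
  is_cderiv (fun t => k * y t + z t) x (k * l + l').
Proof.
move=> [h1 h2] [h3 h4]; split; rewrite !ReImE.
  apply: (@is_rderiv_eq (fun t => Re k * Re (y t) + (- Im k) * Im (y t) + Re (z t))).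
    by move=> t; rewrite !ReImE mulNr.
  by rewrite -mulNr; apply: isrdD => //; apply: isrdD; exact: isrdZ.
apply: (@is_rderiv_eq (fun t => Re k * Im (y t) + Im k * Re (y t) + Im (z t))).
  by move=> t; rewrite !ReImE.
by apply: isrdD => //; apply: isrdD; exact: isrdZ.
Qed.

Lemma iscdM y w x l k : is_cderiv y x l -> is_rderiv a w x k ->
  is_cderiv (fun t => y t * (w t)%:C) x (l * (w x)%:C + y x * k%:C).
Proof.
move=> [h1 h2] hw; split; rewrite !ReImE/= !mulr0 ?subr0 ?add0r ?addr0.
  apply: (@is_rderiv_eq (fun t => Re (y t) * w t)); last exact: isrdM.
  by move=> t; rewrite !ReImE/= mulr0 subr0.
apply: (@is_rderiv_eq (fun t => Im (y t) * w t)); last exact: isrdM.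
by move=> t; rewrite !ReImE/= mulr0 add0r.
Qed.

Lemma loc_abs_cont_ReIm y : loc_abs_cont a y <->
  (forall b, a <= b -> racont a b (fun x => Re (y x))) /\
  (forall b, a <= b -> racont a b (fun x => Im (y x))).
Proof.
split=> [H|[h1 h2] b ab]; last by apply/abs_cont_ReIm; split; auto.
by split=> b ab; have /abs_cont_ReIm[] := H b ab.
Qed.

Lemma loc_abs_cont_ext y z : (forall x, a <= x -> y x = z x) -> loc_abs_cont a y -> loc_abs_cont a z.
Proof.
move=> yz /loc_abs_cont_ReIm[h1 h2]; apply/loc_abs_cont_ReIm; split=> b ab.
  by apply: racont_ext (h1 b ab) => x /andP[ax _]; rewrite yz.
by apply: racont_ext (h2 b ab) => x /andP[ax _]; rewrite yz.
Qed.

Lemma racont_cst (b : R) (k : R) : racont a b (fun=> k).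
Proof.
by apply: (@racont_lip _ _ _ _ 0) => // x y _ _; rewrite subrr normr0 mul0r.
Qed.

Lemma racontZ (b : R) (k : R) (r : R -> R) : a <= b -> racont a b r -> racont a b (fun x => k * r x).
Proof. by move=> ab; apply: racontM => //; exact: racont_cst. Qed.

Lemma loc_abs_cont_lin (k : R[i]) y z : loc_abs_cont a y -> loc_abs_cont a z ->
  loc_abs_cont a (fun x => k * y x + z x).
Proof.
move=> /loc_abs_cont_ReIm[h1 h2] /loc_abs_cont_ReIm[h3 h4]; apply/loc_abs_cont_ReIm.
split=> b ab.
  apply: (@racont_ext _ _ _ (fun t => Re k * Re (y t) + (- Im k) * Im (y t) + Re (z t))).
    by move=> t _; rewrite !ReImE mulNr.
  by apply: racontD; [apply: racontD; apply: racontZ; auto|auto].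
apply: (@racont_ext _ _ _ (fun t => Re k * Im (y t) + Im k * Re (y t) + Im (z t))).
  by move=> t _; rewrite !ReImE.
by apply: racontD; [apply: racontD; apply: racontZ; auto|auto].
Qed.

Lemma loc_abs_contM y w : loc_abs_cont a y -> (forall b, a <= b -> racont a b w) ->
  loc_abs_cont a (fun x => y x * (w x)%:C).
Proof.
move=> /loc_abs_cont_ReIm[h1 h2] hw; apply/loc_abs_cont_ReIm; split=> b ab.
  apply: (@racont_ext _ _ _ (fun t => Re (y t) * w t)); last by apply: racontM; auto.
  by move=> t _; rewrite !ReImE/= mulr0 subr0.
apply: (@racont_ext _ _ _ (fun t => Im (y t) * w t)); last by apply: racontM; auto.
by move=> t _; rewrite !ReImE/= mulr0 add0r.
Qed.

Lemma loc_abs_cont_meas y : loc_abs_cont a y -> cmeas Ia y.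
Proof.
move=> /loc_abs_cont_ReIm[h1 h2]; split; apply: econt_measurable; exact: racont_econt.
Qed.

Lemma q_measurable : measurable_fun Ia q.
Proof.
have -> : Ia = \bigcup_n `[a, a + n%:R]%classic.
  apply/seteqP; split => x /=; rewrite in_itv/= ?andbT.
    move=> ax; exists (Num.bound (x - a)) => //; rewrite /= in_itv/= ax/=.
    by rewrite -lerBlDl ltW// archi_boundP// subr_ge0.
  by move=> [n _]; rewrite /= in_itv/= => /andP[].
apply/measurable_fun_bigcup => n; first exact: measurable_itv.
have an : a <= a + n%:R by rewrite lerDl.
by have /measurable_int/measurable_EFinP := q_loc an.
Qed.

Lemma cderiv_ext y z x : a <= x -> (forall t, a <= t -> y t = z t) -> cderiv y x = cderiv z x.
Proof.
move=> ax yz; apply: complexP => /=; apply: rderiv_ext => // t ta; by rewrite yz.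
Qed.

Lemma loc_abs_cont_cderivable_ae y : loc_abs_cont a y ->
  {ae mu, forall x, a <= x -> is_cderiv y x (cderiv y x)}.
Proof.
move=> /loc_abs_cont_ReIm[/lac_rderivable_ae h1 /lac_rderivable_ae h2].
by apply: ae_lebesgueS2 h1 h2 => x k1 k2 ax; apply: cderivableP => //; split; auto.
Qed.

Lemma ell_meas y : loc_abs_cont a y -> loc_abs_cont a (cderiv y) -> cmeas Ia (ell y).
Proof.
move=> yac /loc_abs_cont_ReIm[h1 h2]; apply: cmeasD.
  by apply: cmeasN; split => /=; apply: rderiv_measurable; exact: racont_econt.
by apply: cmeasM; [apply: cmeasR; exact: q_measurable|exact: loc_abs_cont_meas].
Qed.

(** [y1] and [y2] are candidates for the two derivatives. As [y2] is correct only almost everywhere,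
    so is the formula for [ell y]; the measurability of [ell y] itself has to come from
    [ell_meas]. *)
Lemma Dstar_intro y y1 y2 : L2a a y -> loc_abs_cont a y ->
  (forall x, a <= x -> is_cderiv y x (y1 x)) -> loc_abs_cont a y1 ->
  {ae mu, forall x, a <= x -> is_cderiv y1 x (y2 x)} ->
  L2a a (fun x => - y2 x + (q x)%:C * y x) ->
  [/\ Dstar y, forall x, a <= x -> cderiv y x = y1 x &
      aeqa a (ell y) (fun x => - y2 x + (q x)%:C * y x)].
Proof.
move=> Ly yac yd y1ac y1d L2e.
have dE x : a <= x -> cderiv y x = y1 x by move=> ax; have [] := is_cderiv_cderiv ax (yd x ax).
have dac : loc_abs_cont a (cderiv y) by apply: loc_abs_cont_ext y1ac => x ax; rewrite dE.
have ae : aeqa a (ell y) (fun x => - y2 x + (q x)%:C * y x).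
  apply: ae_lebesgueS y1d => x h; rewrite /= in_itv/= andbT => ax.
  rewrite /Defs.ell; congr (- _ + _); rewrite (cderiv_ext ax dE).
  by have [] := is_cderiv_cderiv ax (h ax).
split => //; split => //.
  by move=> x ax; have [] := is_cderiv_cderiv ax (yd x ax).
by apply: (L2_aeq mI L2e) => //; exact: ell_meas.
Qed.

Lemma Dstar_iscd y x : Dstar y -> a <= x -> is_cderiv y x (cderiv y x).
Proof. by case=> _ _ h _ _ ax; apply: cderivableP => //; exact: h. Qed.

Lemma Dstar_L2 y : Dstar y -> L2a a y. Proof. by case. Qed.
Lemma Dstar_L2ell y : Dstar y -> L2a a (ell y). Proof. by case. Qed.
Lemma Dstar_ac y : Dstar y -> loc_abs_cont a y. Proof. by case. Qed.
Lemma Dstar_dac y : Dstar y -> loc_abs_cont a (cderiv y). Proof. by case. Qed.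

Lemma Dstar_lin (k : R[i]) y z : Dstar y -> Dstar z ->
  [/\ Dstar (fun x => k * y x + z x),
      forall x, a <= x -> cderiv (fun x => k * y x + z x) x = k * cderiv y x + cderiv z x &
      aeqa a (ell (fun x => k * y x + z x)) (fun x => k * ell y x + ell z x)].
Proof.
move=> Dy Dz.
have eE : (fun x => - (k * cderiv (cderiv y) x + cderiv (cderiv z) x) + (q x)%:C * (k * y x + z x)) =
  (fun x => k * ell y x + ell z x).
  by apply/funext => x; rewrite /Defs.ell; ring.
have := @Dstar_intro (fun x => k * y x + z x) (fun x => k * cderiv y x + cderiv z x)
  (fun x => k * cderiv (cderiv y) x + cderiv (cderiv z) x).
rewrite eE; apply.
- by apply: (L2_lin mI); exact: Dstar_L2.
- by apply: loc_abs_cont_lin; exact: Dstar_ac.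
- by move=> x ax; apply: is_cderiv_lin; exact: Dstar_iscd.
- by apply: loc_abs_cont_lin; exact: Dstar_dac.
- have := loc_abs_cont_cderivable_ae (Dstar_dac Dy).
  have := loc_abs_cont_cderivable_ae (Dstar_dac Dz).
  by apply: ae_lebesgueS2 => x h1 h2 ax; exact: (is_cderiv_lin k (h2 ax) (h1 ax)).
- by apply: (L2_lin mI); exact: Dstar_L2ell.
Qed.

(** Leibniz rule. Nothing puts y' in L_2 and w2 is not assumed bounded, hence the separate L_2
    conditions on the two cross terms. *)
Lemma Dstar_mul y w w1 w2 (M : R) : Dstar y ->
  (forall b, a <= b -> racont a b w) -> (forall b, a <= b -> racont a b w1) ->
  (forall x, a <= x -> is_rderiv a w x (w1 x)) ->
  {ae mu, forall x, a <= x -> is_rderiv a w1 x (w2 x)} ->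
  (forall x, a <= x -> `|w x| <= M) ->
  L2a a (fun x => cderiv y x * (w1 x)%:C) -> L2a a (fun x => y x * (w2 x)%:C) ->
  [/\ Dstar (fun x => y x * (w x)%:C),
      forall x, a <= x -> cderiv (fun x => y x * (w x)%:C) x =
        cderiv y x * (w x)%:C + y x * (w1 x)%:C &
      aeqa a (ell (fun x => y x * (w x)%:C))
        (fun x => (w x)%:C * ell y x - (2%:R * (cderiv y x * (w1 x)%:C) + y x * (w2 x)%:C))].
Proof.
move=> Dy wac w1ac dw dw1 wM L1 L2.
have mw : cmeas Ia (fun x => (w x)%:C) by apply: cmeasR; apply: econt_measurable; exact: racont_econt.
have wM' x : Ia x -> normc (w x)%:C <= M by rewrite normcR /= in_itv/= andbT; exact: wM.
have eE : (fun x => - ((cderiv (cderiv y) x * (w x)%:C + cderiv y x * (w1 x)%:C) +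
    (cderiv y x * (w1 x)%:C + y x * (w2 x)%:C)) + (q x)%:C * (y x * (w x)%:C)) =
  (fun x => (w x)%:C * ell y x - (2%:R * (cderiv y x * (w1 x)%:C) + y x * (w2 x)%:C)).
  by apply/funext => x; rewrite /Defs.ell; ring.
have := @Dstar_intro (fun x => y x * (w x)%:C) (fun x => cderiv y x * (w x)%:C + y x * (w1 x)%:C)
  (fun x => (cderiv (cderiv y) x * (w x)%:C + cderiv y x * (w1 x)%:C) +
    (cderiv y x * (w1 x)%:C + y x * (w2 x)%:C)).
rewrite eE; apply.
- have := L2M mI mw wM' (Dstar_L2 Dy).
  by rewrite (_ : (fun x => (w x)%:C * y x) = (fun x => y x * (w x)%:C))//; apply/funext => x; rewrite mulrC.
- by apply: loc_abs_contM => //; exact: Dstar_ac.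
- by move=> x ax; apply: iscdM; [exact: Dstar_iscd|exact: dw].
- have := @loc_abs_cont_lin 1 _ _ (loc_abs_contM (Dstar_dac Dy) wac) (loc_abs_contM (Dstar_ac Dy) w1ac).
  by under eq_fun do rewrite mul1r.
- have := loc_abs_cont_cderivable_ae (Dstar_dac Dy).
  apply: ae_lebesgueS2 dw1 => x h1 h2 ax.
  have k1 := iscdM (h2 ax) (dw x ax); have k2 := iscdM (Dstar_iscd Dy ax) (h1 ax).
  have := @is_cderiv_lin 1 _ _ _ _ _ k1 k2; rewrite mul1r.
  by apply: is_cderiv_ext => // t _; rewrite mul1r.
- apply: (L2B mI); first exact: (L2M mI mw wM' (Dstar_L2ell Dy)).
  by apply: (L2D mI) => //; exact: (L2Z mI).
Qed.

End Dstar_theory.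

(** * The cut-off multiplier w and its derivatives *)

Section bump.
Context {R : realType} (a b : R) (b0 : 0 < b).
Implicit Types (x t : R).
Local Notation Ia := (`[a, +oo[%classic : set R).
Local Notation mu := (@lebesgue_measure R).

(** The square of this truncated linear function is continuously differentiable, so w has the
    regularity of a multiplier of [Dstar]. In s = b (t - a), w = s (1 - s)^2 / b on its support, so
    w, w', w'' are of orders 1/b, 1 and b. *)
Definition bump_m t : R := Num.max (1 - b * (t - a)) 0.
(* [bump_dw] and [bump_ddw] are the first two derivatives of [bump_w], which
   vanishes beyond a + 1/b. *)
Definition bump_w t : R := (t - a) * (bump_m t * bump_m t).
Definition bump_dw t : R := bump_m t * bump_m t + (t - a) * (- 2 * b * bump_m t).
Definition bump_ddw t : R := if b * (t - a) < 1 then b * (6 * (b * (t - a)) - 4) else 0.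

Let bump_m_in t : b * (t - a) < 1 -> bump_m t = 1 - b * (t - a).
Proof. by move=> h; rewrite /bump_m; have [|] := leP (1 - b * (t - a)) 0 => // ?; lra. Qed.

Let bump_m_out t : 1 <= b * (t - a) -> bump_m t = 0.
Proof. by move=> h; rewrite /bump_m; have [|] := leP (1 - b * (t - a)) 0 => // ?; lra. Qed.

Lemma bump_w_a : bump_w a = 0. Proof. by rewrite /bump_w subrr mul0r. Qed.

Lemma bump_dw_a : bump_dw a = 1.
Proof. by rewrite /bump_dw subrr mul0r addr0 bump_m_in subrr mulr0 ?subr0 ?mulr1. Qed.

Lemma bump_w_out t : 1 <= b * (t - a) -> bump_w t = 0.
Proof. by move=> /bump_m_out h; rewrite /bump_w h !mulr0. Qed.

Lemma bump_dw_out t : 1 <= b * (t - a) -> bump_dw t = 0.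
Proof. by move=> /bump_m_out h; rewrite /bump_dw h !mulr0 addr0. Qed.

Lemma bump_ddw_out t : 1 <= b * (t - a) -> bump_ddw t = 0.
Proof. by move=> h; rewrite /bump_ddw ltNge h. Qed.

Lemma bump_w_le t : a <= t -> `|bump_w t| <= b^-1.
Proof.
move=> ta; have [h|h] := ltP (b * (t - a)) 1; last first.
  by rewrite bump_w_out// normr0 invr_ge0 ltW.
have st : 0 <= b * (t - a) by rewrite mulr_ge0 ?subr_ge0// ltW.
rewrite /bump_w bump_m_in//; rewrite -[leRHS]mul1r ler_pdivlMr//.
rewrite ger0_norm; last by rewrite mulr_ge0 ?subr_ge0// mulr_ge0// subr_ge0 ltW.
set s := b * (t - a) in st h *.
rewrite (_ : _ * b = s * ((1 - s) * (1 - s))); last by rewrite /s; ring.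
have k1 : 0 <= 1 - s by lra.
have k2 : (1 - s) * (1 - s) <= 1 by nra.
by have := mulr_ge0 st (mulr_ge0 k1 k1); nra.
Qed.

Lemma bump_dw_le t : a <= t -> `|bump_dw t| <= 3.
Proof.
move=> ta; have [h|h] := ltP (b * (t - a)) 1; last by rewrite bump_dw_out// normr0.
have st : 0 <= b * (t - a) by rewrite mulr_ge0 ?subr_ge0// ltW.
rewrite /bump_dw bump_m_in//.
rewrite (_ : (t - a) * (- 2 * b * (1 - b * (t - a))) = - 2 * (b * (t - a)) * (1 - b * (t - a))); last by ring.
by move: st h; set s := b * (t - a) => s0 s1; rewrite ler_norml; apply/andP; split; nra.
Qed.

Lemma bump_ddw_le t : a <= t -> `|bump_ddw t| <= 10 * b.
Proof.
move=> ta; have [h|h] := ltP (b * (t - a)) 1; last by rewrite bump_ddw_out// normr0 mulr_ge0// ltW.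
have st : 0 <= b * (t - a) by rewrite mulr_ge0 ?subr_ge0// ltW.
rewrite /bump_ddw h; move: st h; set s := b * (t - a) => s0 s1.
rewrite normrM (gtr0_norm b0) mulrC ler_wpM2r ?(ltW b0)// ler_norml; lra.
Qed.

Let id_lip c : a <= c -> racont a c (fun t => t - a).
Proof.
move=> ac; apply: (@racont_lip _ _ _ _ 1) => // x y _ _.
by rewrite mul1r opprB addrA subrK.
Qed.

Let bump_m_lip x t : `|bump_m t - bump_m x| <= b * `|t - x|.
Proof.
have h1 := ler_norm (t - x); have h2 := ler_norm (x - t); rewrite distrC in h2.
have k1 : b * (t - x) <= b * `|t - x| by rewrite ler_pM2l.
have k2 : b * (x - t) <= b * `|t - x| by rewrite ler_pM2l.
have k0 : 0 <= b * `|t - x| by rewrite mulr_ge0// ltW.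
rewrite /bump_m; have [|] := leP (1 - b * (t - a)) 0; have [|] := leP (1 - b * (x - a)) 0 => u v;
  rewrite ler_norml; lra.
Qed.

Let bump_m_ac c : a <= c -> racont a c bump_m.
Proof. by move=> ac; apply: (@racont_lip _ _ _ _ b) => //; exact: ltW. Qed.

Lemma bump_w_ac c : a <= c -> racont a c bump_w.
Proof. by move=> ac; apply: racontM; auto; apply: racontM; auto. Qed.

Lemma bump_dw_ac c : a <= c -> racont a c bump_dw.
Proof.
move=> ac; apply: racontD; first by apply: racontM; auto.
by apply: racontM; auto; apply: racontM; auto; exact: racont_cst.
Qed.

Lemma is_rderiv_sq r x l (C : R) : 0 <= C -> (forall t, a <= t ->
  `|r t - r x - l * (t - x)| <= C * (t - x) ^+ 2) -> is_rderiv a r x l.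
Proof.
move=> C0 H e e0; have C1 : 0 < C + 1 by lra.
exists (e / (C + 1)); first by rewrite divr_gt0.
move=> t ta; rewrite ltr_pdivlMr// => tx; rewrite (le_trans (H t ta))//.
rewrite -real_normK ?num_real// expr2 mulrA ler_wpM2r// (le_trans _ (ltW tx))//.
by rewrite mulrC ler_wpM2l// lerDl.
Qed.

Let is_rderiv_id x : is_rderiv a (fun t => t - a) x 1.
Proof.
apply: (@is_rderiv_sq _ _ _ 0) => // t ta.
by rewrite mul1r mul0r (_ : _ - _ = 0) ?normr0//; ring.
Qed.

Let is_rderiv_bm2 x : is_rderiv a (fun t => bump_m t * bump_m t) x (- 2 * b * bump_m x).
Proof.
apply: (@is_rderiv_sq _ _ _ (b ^+ 2)); first exact: sqr_ge0.
move=> t ta; rewrite -exprMn.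
have -> : bump_m t * bump_m t - bump_m x * bump_m x - - 2 * b * bump_m x * (t - x) =
  bump_m t * bump_m t - bump_m x * bump_m x - 2 * bump_m x * (- (b * (t - x))) by ring.
rewrite /bump_m (_ : 1 - b * (t - a) = (1 - b * (x - a)) + - (b * (t - x))); last by ring.
rewrite -(sqrrN (b * (t - x))).
(* The claim is |max(u + h, 0)^2 - max(u, 0)^2 - 2 max(u, 0) h| <= h^2, checked in the four sign
   cases; it also holds at the kink u = 0. *)
set u := 1 - _; set h := - _.
by have [|] := leP (u + h) 0; have [|] := leP u 0 => k1 k2; rewrite ler_norml; apply/andP; split; nra.
Qed.

Lemma is_rderiv_bw x : is_rderiv a bump_w x (bump_dw x).
Proof. by have := isrdM (is_rderiv_id x) (is_rderiv_bm2 x); rewrite mul1r. Qed.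

Lemma is_rderiv_near r s x l del : 0 < del -> (forall t, `|t - x| < del -> r t = s t) ->
  is_rderiv a r x l -> is_rderiv a s x l.
Proof.
move=> d0 rs H e /H[d1 d10 K]; exists (Num.min del d1); first by rewrite lt_min d0.
move=> t ta; rewrite lt_min => /andP[h1 h2]; rewrite -!rs ?subrr ?normr0//; exact: K.
Qed.

(** At the excluded point w'' jumps from 2 b to 0. *)
Lemma is_rderiv_bw1 x : b * (x - a) != 1 -> is_rderiv a bump_dw x (bump_ddw x).
Proof.
rewrite neq_lt => /orP[h|h].
  rewrite /bump_ddw h.
  have d0 : 0 < (1 - b * (x - a)) / b by rewrite divr_gt0// subr_gt0.
  apply: (@is_rderiv_near (fun t => (1 - b * (t - a)) ^+ 2 - 2 * (b * (t - a)) * (1 - b * (t - a))) _ _ _ _ d0).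
    move=> t; rewrite ltr_pdivlMr// => ht.
    have h1 : b * (t - a) < 1.
      have := ler_norm (t - x) => /(ler_wpM2r (ltW b0)); lra.
    by rewrite /bump_dw bump_m_in//; ring.
  apply: (@is_rderiv_sq _ _ _ (3 * b ^+ 2)); first by rewrite mulr_ge0// sqr_ge0.
  move=> t ta; rewrite [X in `|X|](_ : _ = 3 * b ^+ 2 * (t - x) ^+ 2); last by ring.
  by rewrite ger0_norm// mulr_ge0 ?sqr_ge0// mulr_ge0// sqr_ge0.
rewrite bump_ddw_out ?(ltW h)//.
have d0 : 0 < (b * (x - a) - 1) / b by rewrite divr_gt0// subr_gt0.
apply: (@is_rderiv_near (fun t => 0) _ _ _ _ d0).
  move=> t; rewrite ltr_pdivlMr// => ht.
  rewrite bump_dw_out//.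
  have := ler_norm (x - t) => /(ler_wpM2r (ltW b0)); rewrite distrC; lra.
apply: (@is_rderiv_sq _ _ _ 0) => // t ta.
by rewrite !mul0r !subrr normr0.
Qed.

Lemma is_rderiv_bw1_ae : {ae mu, forall x, a <= x -> is_rderiv a bump_dw x (bump_ddw x)}.
Proof.
exists [set a + b^-1]; split => //; first exact: lebesgue_measure_set1.
move=> x /= h; apply/eqP; apply: contra_notT h => xa _; apply: is_rderiv_bw1.
apply: contra xa => /eqP h; apply/eqP.
have e : x = a + (b * (x - a)) * b^-1 by field; rewrite gt_eqF.
by rewrite e h mul1r.
Qed.

Lemma bump_ddw_int : Rintegral mu Ia bump_ddw = -1.
Proof.
pose c := a + b^-1.
have ac : a < c by rewrite ltrDl invr_gt0.
(* [F] is w' on [a, c], so the integral of w'' is w'(c) - w'(a) = 0 - 1. *)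
pose F t : R := (1 - b * (t - a)) ^+ 2 - 2 * (b * (t - a)) * (1 - b * (t - a)).
pose f t : R := b * (6 * (b * (t - a)) - 4).
have cf : continuous f.
  move=> x; apply: cvgM; first exact: cvg_cst.
  apply: cvgB; last exact: cvg_cst.
  apply: cvgM; first exact: cvg_cst.
  apply: cvgM; first exact: cvg_cst.
  by apply: cvgB; [exact: cvg_id|exact: cvg_cst].
have dF (x : R) : is_derive x 1 F (f x).
  apply: is_derive_eq; rewrite /f /GRing.scale/=; ring.
have cF : continuous F by move=> x; apply: differentiable_continuous; apply/derivable1_diffP.
have ftc := @continuous_FTC2 R f F a c ac (continuous_subspaceT cf).
have {}ftc : (\int[mu]_(x in `[a, c]) (f x)%:E = (F c)%:E - (F a)%:E)%E.
  apply: ftc.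
    split; first by move=> x _; have [] := dF x.
      exact/cvg_at_right_filter/cF.
    exact/cvg_at_left_filter/cF.
  by move=> x _; rewrite derive1E; have [] := dF x.
have bc : b * (c - a) = 1 by rewrite /c addrAC subrr add0r divff// gt_eqF.
have {}ftc : (\int[mu]_(x in `[a, c]) (f x)%:E = (-1)%:E)%E.
  by rewrite ftc -EFinB; congr EFin; rewrite /F bc subrr; ring.
have mf : measurable_fun `[a, c[ (EFin \o f).
  apply/measurable_EFinP; apply: (measurable_funS measurableT) => //.
  exact: continuous_measurable_fun.
have e1 : (\int[mu]_(x in Ia) (bump_ddw x)%:E = \int[mu]_(x in Ia) ((EFin \o f) \_ `[a, c[) x)%E.
  apply: eq_integral => x; rewrite inE/= in_itv/= andbT => ax.
  rewrite patchE /bump_ddw; have [h|h] := ltP (b * (x - a)) 1.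
    rewrite mem_set//= in_itv/= ax/= /c.
    by rewrite -ltrBlDl -[ltRHS]mulr1 ltr_pdivlMl.
  rewrite memNset//= in_itv/= ax/= => xc.
  move: xc; rewrite /c -ltrBlDl -[ltRHS]mulr1 ltr_pdivlMl//.
  by rewrite ltNge h.
rewrite /Rintegral e1 -integral_mkcondr.
rewrite (_ : Ia `&` `[a, c[ = `[a, c[%classic); last first.
  by apply/setIidr => x /=; rewrite !in_itv/= andbT => /andP[].
by rewrite (integral_itv_bndo_bndc mf) ftc.
Qed.

Lemma bump_ddw_measurable : measurable_fun Ia bump_ddw.
Proof.
apply: (measurable_funS measurableT) => //; apply: measurable_fun_ifT => //.
  apply: measurable_fun_ltr => //; apply: measurable_funM => //.
  exact: measurable_funB.
apply: measurable_funM => //; apply: measurable_funB => //.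
apply: measurable_funM => //; apply: measurable_funM => //.
exact: measurable_funB.
Qed.

End bump.

(** * Bounded functions with compact support *)

Section compact_support.
Context {R : realType} (a c : R) (ac : a <= c).
Local Notation Ia := (`[a, +oo[%classic : set R).
Local Notation mu := (@lebesgue_measure R).
Let mI := @measurable_Ia R a.

Let ind : R -> R := \1_(`[a, c]%classic : set R).

Let ind_rint : rint mu Ia ind.
Proof.
apply: (@integrableS _ _ _ mu setT) => //; exact: integrable_indic_itv.
Qed.

Let ind_int : Rintegral mu Ia ind = c - a.
Proof.
rewrite /Rintegral integral_indic//.
rewrite (_ : _ `&` _ = `[a, c]%classic); last first.
  by apply/setIidl => x /=; rewrite !in_itv/= andbT => /andP[].
have h : fine (mu `[a, c]%classic) = c - a.
  rewrite lebesgue_measure_itv/= lte_fin; case: ltP => //= ca.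
  by apply/esym/eqP; rewrite subr_eq0 eq_le ca ac.
exact: h.
Qed.

Lemma supp_rint (r : R -> R) M : measurable_fun Ia r -> (forall x, a <= x <= c -> `|r x| <= M) ->
  (forall x, c < x -> r x = 0) -> rint mu Ia r /\ `|Rintegral mu Ia r| <= M * (c - a).
Proof.
move=> mr rM r0.
have Mi : rint mu Ia (fun x => M * ind x) by exact: rintZ.
have le x : Ia x -> `|r x| <= M * ind x.
  rewrite /= in_itv/= andbT /ind indicE => ax.
  have [xc|cx] := leP x c.
    by rewrite mem_set ?mulr1 ?rM ?ax//= in_itv/= ax.
  by rewrite r0// normr0 memNset ?mulr0//= in_itv/= ax/= leNgt cx.
have ri : rint mu Ia r by exact: le_rint Mi.
split => //; rewrite (le_trans (le_normr_Rintegral mI ri))//.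
rewrite -ind_int -RintegralZl//; apply: le_Rintegral => //.
exact: integrable_norm.
Qed.

Lemma supp_L2 (f : R -> R[i]) M : 0 <= M -> cmeas Ia f -> (forall x, a <= x <= c -> normc (f x) <= M) ->
  (forall x, c < x -> f x = 0) -> L2a a f /\ sqn mu Ia f <= M ^+ 2 * (c - a).
Proof.
move=> M0 mf fM f0.
have [|||h1 h2] := @supp_rint (fun x => normc (f x) ^+ 2) (M ^+ 2).
- by apply: measurable_funX; exact: cmeas_normc.
- by move=> x h; rewrite ger0_norm ?sqr_ge0// ler_sqr ?nnegrE ?normc_ge0 ?fM.
- by move=> x /f0 ->; rewrite normc0 expr0n.
have Lf : L2a a f by apply/inL2P.
split => //; rewrite sqnE//; exact: le_trans (ler_norm _) h2.
Qed.

End compact_support.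

(** * The Green form against bump multiples *)

Section green.
Context {R : realType} (a : R) (q : R -> R) (q_loc : locally_summable a q).
Implicit Types (u v y z f g : R -> R[i]) (x t b : R).
Local Notation Ia := (`[a, +oo[%classic : set R).
Local Notation mu := (@lebesgue_measure R).
Local Notation ell := (ell a q).
Local Notation cderiv := (cderiv a).
Local Notation Dstar := (Dstar a q).
Let mI := @measurable_Ia R a.
Local Notation dot := (dota a).

Lemma supp_cint f (c M : R) : a <= c -> cmeas Ia f -> (forall x, a <= x <= c -> normc (f x) <= M) ->
  (forall x, c < x -> f x = 0) -> cint mu Ia f /\ normc (cintegral mu Ia f) <= M * (c - a).
Proof.
move=> ac mf fM f0.
have [|||h1 h2] := @supp_rint _ _ _ ac (fun x => normc (f x)) M.
- exact: cmeas_normc.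
- by move=> x h; rewrite ger0_norm ?normc_ge0 ?fM.
- by move=> x /f0 ->; rewrite normc0.
have ci : cint mu Ia f by apply: (le_cint mI mf _ h1).
by split => //; rewrite (le_trans (normc_cintegral mI ci))// (le_trans (ler_norm _)).
Qed.

Lemma abs_cont_bounded y c : a <= c -> loc_abs_cont a y ->
  exists2 M, 0 <= M & forall x, a <= x <= c -> normc (y x) <= M.
Proof.
move=> ac /loc_abs_cont_ReIm[h1 h2].
have [M M0 HM] := racont_bounded ac (h1 c ac); have [N N0 HN] := racont_bounded ac (h2 c ac).
exists (M + N); first exact: addr_ge0.
by move=> x h; rewrite (le_trans (normc_le_ReIm _))// lerD ?HM ?HN.
Qed.

Definition bump b y x : R[i] := y x * (bump_w a b x)%:C.

Lemma bump_L2 b y : 0 < b -> Dstar y ->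
  L2a a (fun x => cderiv y x * (bump_dw a b x)%:C) /\ L2a a (fun x => y x * (bump_ddw a b x)%:C).
Proof.
move=> b0 Dy; have ac : a <= a + b^-1 by rewrite lerDl invr_ge0 ltW.
have out x : a + b^-1 < x -> 1 <= b * (x - a).
  by move=> h; rewrite -ler_pdivrMl// mulr1 lerBrDl ltW.
have [M M0 HM] := abs_cont_bounded ac (Dstar_ac Dy).
have [N N0 HN] := abs_cont_bounded ac (Dstar_dac Dy).
have b10 : 0 <= 10 * b by rewrite mulr_ge0// ltW.
split.
  apply: (@supp_L2 _ _ _ ac _ (N * 3) _ _ _ _).1.
  - exact: mulr_ge0.
  - apply: cmeasM; first exact: (loc_abs_cont_meas (Dstar_dac Dy)).
    apply: cmeasR; apply: econt_measurable; apply: racont_econt => c; exact: bump_dw_ac.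
  - move=> x h; rewrite normcM normcR ler_pM ?normc_ge0 ?HN// bump_dw_le//.
    by case/andP: h.
  - by move=> x /out h; rewrite bump_dw_out// mulr0.
apply: (@supp_L2 _ _ _ ac _ (M * (10 * b)) _ _ _ _).1.
- exact: mulr_ge0.
- apply: cmeasM; first exact: (loc_abs_cont_meas (Dstar_ac Dy)).
  by apply: cmeasR; exact: bump_ddw_measurable.
- move=> x h; rewrite normcM normcR ler_pM ?normc_ge0 ?HM// bump_ddw_le//.
  by case/andP: h.
- by move=> x /out h; rewrite bump_ddw_out// mulr0.
Qed.

Lemma bump_Dstar b y : 0 < b -> Dstar y ->
  [/\ Dstar (bump b y), bump b y a = 0, cderiv (bump b y) a = y a &
      aeqa a (ell (bump b y)) (fun x => (bump_w a b x)%:C * ell y x -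
        (2%:R * (cderiv y x * (bump_dw a b x)%:C) + y x * (bump_ddw a b x)%:C))].
Proof.
move=> b0 Dy; have [L1 L2] := bump_L2 b0 Dy.
have [D1 D2 D3] := Dstar_mul q_loc Dy (fun c => @bump_w_ac _ a b b0 c) (fun c => @bump_dw_ac _ a b b0 c)
  (fun x _ => @is_rderiv_bw _ a b x) (@is_rderiv_bw1_ae _ a b b0) (fun x => @bump_w_le _ a b b0 x) L1 L2.
split => //; first by rewrite /bump bump_w_a// mulr0.
by rewrite /bump D2// bump_w_a bump_dw_a mulr0 add0r mulr1.
Qed.

Definition green_form u v : R[i] := dot (ell u) v - dot u (ell v).

Local Notation G := green_form.

Lemma green_form_herm u v : Dstar u -> Dstar v -> G v u = - (G u v)^*.
Proof.
move=> Du Dv; rewrite /green_form conjcB.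
have L := @Dstar_L2 _ a q; have E := @Dstar_L2ell _ a q.
rewrite opprB /dota -(dotC mI (L _ Du) (E _ Dv)) -(dotC mI (E _ Du) (L _ Dv)).
by [].
Qed.

Lemma aeqa_refl f : aeqa a f f.
Proof. by apply: (@aeW _ (measurableTypeR R) R mu) => x. Qed.

Lemma dot_aeql f f' g : L2a a f -> L2a a f' -> L2a a g -> aeqa a f f' -> dot f g = dot f' g.
Proof. by move=> h1 h2 h3 h; apply: (dot_aeq mI) => //; exact: aeqa_refl. Qed.

Lemma dot_aeqr f f' g : L2a a f -> L2a a f' -> L2a a g -> aeqa a f f' -> dot g f = dot g f'.
Proof. by move=> h1 h2 h3 h; apply: (dot_aeq mI) => //; exact: aeqa_refl. Qed.

Lemma green_form_lin (k : R[i]) u v z : Dstar u -> Dstar v -> Dstar z ->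
  G (fun x => k * u x + v x) z = k * G u z + G v z.
Proof.
move=> Du Dv Dz; have [D1 _ D3] := Dstar_lin q_loc k Du Dv.
have L := @Dstar_L2 _ a q; have E := @Dstar_L2ell _ a q.
have LL := L2_lin mI k (E _ Du) (E _ Dv).
rewrite /green_form (dot_aeql (E _ D1) LL (L _ Dz) D3) /dota.
rewrite (dot_linl mI _ (E _ Du) (E _ Dv) (L _ Dz)) (dot_linl mI _ (L _ Du) (L _ Dv) (E _ Dz)).
by ring.
Qed.

(** In ell(y w) = w ell y - 2 y' w' - y w'' the terms with w and w' contribute O(1/b): w is of that
    size, and w' is bounded on a support of length 1/b. So does (y w, ell z). The term with w''
    gives the limit, because w'' has integral -1 and is concentrated near a. *)
Lemma bump_green y z : Dstar y -> Dstar z -> forall e, 0 < e -> exists2 b : R, 0 < b &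
  normc (G (bump b y) z - y a * (z a)^*) < e.
Proof.
move=> Dy Dz e e0.
have L := @Dstar_L2 _ a q; have E := @Dstar_L2ell _ a q.
have a1 : a <= a + 1 by rewrite lerDl.
have [M M0 HM] := abs_cont_bounded a1 (Dstar_ac Dz).
have [N N0 HN] := abs_cont_bounded a1 (Dstar_dac Dy).
pose C1 := Rintegral mu Ia (fun x => normc (ell y x * (z x)^*)).
pose C3 := Rintegral mu Ia (fun x => normc (y x * (ell z x)^*)).
have C10 : 0 <= C1 by apply: Rintegral_ge0 => x _; exact: normc_ge0.
have C30 : 0 <= C3 by apply: Rintegral_ge0 => x _; exact: normc_ge0.
pose p x := y x * (z x)^* - y a * (z a)^*.
have e40 : 0 < e / 40 by rewrite divr_gt0.
(* The margin e / 20 is chosen against |w''| <= 10 b on an interval of length 1/b, which leaves an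
   error of at most e / 2. *)
have [del d0 Hp] : exists2 del, 0 < del & forall x, a <= x -> x - a < del -> normc (p x) <= e / 20.
  have /loc_abs_cont_ReIm[yr yi] := Dstar_ac Dy; have /loc_abs_cont_ReIm[zr zi] := Dstar_ac Dz.
  have rc : econt a (fun x => Re (y x * (z x)^*)).
    apply: racont_econt => c ac; apply: (@racont_ext _ _ _ (fun x => Re (y x) * Re (z x) + Im (y x) * Im (z x))).
      by move=> x _; rewrite !ReImE; ring.
    by apply: racontD; apply: racontM; auto.
  have ic : econt a (fun x => Im (y x * (z x)^*)).
    apply: racont_econt => c ac; apply: (@racont_ext _ _ _ (fun x => Im (y x) * Re (z x) - Re (y x) * Im (z x))).
      by move=> x _; rewrite !ReImE; ring.
    by apply: racontB; apply: racontM; auto.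
  have [d1 d10 H1] := rc a (lexx a) _ e40; have [d2 d20 H2] := ic a (lexx a) _ e40.
  exists (Num.min d1 d2); first by rewrite lt_min d10.
  move=> x ax; rewrite lt_min => /andP[h1 h2].
  rewrite (le_trans (normc_le_ReIm _))// /p ReD ReN ImD ImN.
  have xa : `|x - a| = x - a by rewrite ger0_norm ?subr_ge0.
  rewrite -xa in h1 h2; have := H1 x ax h1; have := H2 x ax h2; lra.
(* The three summands ensure b >= 1, 1/b < del and (C1 + C3 + 6 N M) / b < e / 4. *)
pose b := 1 + del^-1 + (C1 + C3 + 6 * N * M + 1) / (e / 4).
have KK0 : 0 <= C1 + C3 + 6 * N * M by rewrite !addr_ge0// !mulr_ge0.
have b1 : 1 <= b.
  rewrite /b -addrA lerDl addr_ge0// ?invr_ge0 ?(ltW d0)// divr_ge0//; first lra.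
  by rewrite divr_ge0// ltW.
have b0 : 0 < b by rewrite (lt_le_trans _ b1).
have bK : (C1 + C3 + 6 * N * M) / b < e / 4.
  rewrite ltr_pdivrMr// [ltRHS]mulrC -ltr_pdivrMr ?divr_gt0//.
  apply: (@lt_le_trans _ _ ((C1 + C3 + 6 * N * M + 1) / (e / 4))).
    by rewrite ltr_pM2r ?invr_gt0 ?divr_gt0// ltrDl.
  by rewrite /b lerDr addr_ge0// invr_ge0 ltW.
have bd : b^-1 < del.
  rewrite -[ltRHS]invrK ltf_pV2 ?posrE ?invr_gt0// /b -addrA addrCA ltrDl.
  by rewrite ltr_wpDr// divr_ge0//; [lra|rewrite divr_ge0// ltW].
have bi1 : b^-1 <= 1 by rewrite invf_le1.
exists b => //.
have ac : a <= a + b^-1 by rewrite lerDl invr_ge0 ltW.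
have ac1 : a + b^-1 <= a + 1 by rewrite lerD2l.
have out x : a + b^-1 < x -> 1 <= b * (x - a).
  by move=> h; rewrite -ler_pdivrMl// mulr1 lerBrDl ltW.
have [D1 D2 D3 D4] := bump_Dstar b0 Dy; have [L1 L2] := bump_L2 b0 Dy.
have mw : cmeas Ia (fun x => (bump_w a b x)%:C).
  by apply: cmeasR; apply: econt_measurable; apply: racont_econt => c; exact: bump_w_ac.
have mw2 : cmeas Ia (fun x => (bump_ddw a b x)%:C) by apply: cmeasR; exact: bump_ddw_measurable.
have wle x : Ia x -> normc (bump_w a b x)%:C <= b^-1.
  by rewrite normcR /= in_itv/= andbT; exact: bump_w_le.
have Lw : L2a a (fun x => (bump_w a b x)%:C * ell y x) by exact: (L2M mI mw wle (E _ Dy)).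
have L12 : L2a a (fun x => 2%:R * (cderiv y x * (bump_dw a b x)%:C)) by exact: (L2Z mI).
have L3 := L2D mI L12 L2.
rewrite /green_form (dot_aeql (E _ D1) (L2B mI Lw L3) (L _ Dz) D4) /dota (dotBl mI)//; last exact: L.
rewrite (dotDl mI L12 L2 (L _ Dz)) (dotZl mI _ L1 (L _ Dz)).
have wint f : cint mu Ia f -> normc (cintegral mu Ia (fun x => (bump_w a b x)%:C * f x)) <=
    Rintegral mu Ia (fun x => normc (f x)) / b.
  move=> cf; have mwf : cmeas Ia (fun x => (bump_w a b x)%:C * f x).
    by apply: cmeasM => //; exact: cint_meas cf.
  have ni := cint_normc mI cf.
  have cwf : cint mu Ia (fun x => (bump_w a b x)%:C * f x).
    apply: (le_cint mI mwf _ (rintZ mI b^-1 ni)) => x Dx.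
    by rewrite normcM ler_wpM2r ?normc_ge0// wle.
  rewrite (le_trans (normc_cintegral mI cwf))// mulrC -RintegralZl//.
  apply: le_Rintegral => //; [exact: cint_normc|exact: rintZ|].
  by move=> x Dx; rewrite normcM ler_wpM2r ?normc_ge0// wle.
have T1 : normc (dotp mu Ia (fun x => (bump_w a b x)%:C * ell y x) z) <= C1 / b.
  have := wint _ (L2_cint mI (E _ Dy) (L _ Dz)).
  by under [X in cintegral _ _ X]eq_fun do rewrite mulrA.
have T3 : normc (dotp mu Ia (bump b y) (ell z)) <= C3 / b.
  have := wint _ (L2_cint mI (L _ Dy) (E _ Dz)).
  by under [X in cintegral _ _ X]eq_fun do rewrite mulrA [_%:C * _]mulrC.
have T2 : normc (dotp mu Ia (fun x => cderiv y x * (bump_dw a b x)%:C) z) <= 3 * N * M / b.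
  have [|||_] := @supp_cint (fun x => cderiv y x * (bump_dw a b x)%:C * (z x)^*) _ (3 * N * M) ac.
  - by apply: cmeasM; [exact: L2_meas L1|apply: cmeasJ; exact: L2_meas (L _ Dz)].
  - move=> x /andP[ax xc]; have xa1 : a <= x <= a + 1 by rewrite ax (le_trans xc).
    rewrite !normcM normcJ normcR ler_pM ?mulr_ge0 ?normc_ge0 ?HM//.
    by rewrite mulrC ler_pM ?normc_ge0 ?bump_dw_le ?HN.
  - by move=> x /out h; rewrite bump_dw_out// mulr0 mul0r.
  by rewrite addrAC subrr add0r.
have Y2 : cint mu Ia (fun x => (bump_ddw a b x)%:C) /\ cintegral mu Ia (fun x => (bump_ddw a b x)%:C) = -1.
  have [|||ci _] := @supp_cint (fun x => (bump_ddw a b x)%:C) _ (10 * b) ac.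
  - exact: mw2.
  - by move=> x /andP[ax xc]; rewrite normcR bump_ddw_le.
  - by move=> x /out h; rewrite bump_ddw_out.
  split => //; apply: complexP; rewrite /cintegral/=; first exact: bump_ddw_int.
  by rewrite Rintegral_cst// mul0r oppr0.
have T4 : normc (dotp mu Ia (fun x => y x * (bump_ddw a b x)%:C) z + y a * (z a)^*) <= e / 2.
  have [|||ci le] := @supp_cint (fun x => p x * (bump_ddw a b x)%:C) _ (e / 20 * (10 * b)) ac.
  - apply: cmeasM => //; apply: cmeasD; last exact: cmeas_cst.
    by apply: cmeasM; [exact: L2_meas (L _ Dy)|apply: cmeasJ; exact: L2_meas (L _ Dz)].
  - move=> x /andP[ax xc]; rewrite normcM normcR ler_pM ?normc_ge0 ?bump_ddw_le//.
    by apply: Hp => //; rewrite (le_lt_trans _ bd)// lerBlDl.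
  - by move=> x /out h; rewrite bump_ddw_out// mulr0.
  have -> : dotp mu Ia (fun x => y x * (bump_ddw a b x)%:C) z + y a * (z a)^* =
     cintegral mu Ia (fun x => p x * (bump_ddw a b x)%:C).
    have e1 : dotp mu Ia (fun x => y x * (bump_ddw a b x)%:C) z =
      cintegral mu Ia (fun x => p x * (bump_ddw a b x)%:C + y a * (z a)^* * (bump_ddw a b x)%:C).
      by apply: eq_cintegral => x _; rewrite /p; ring.
    rewrite e1 (cintegralD mI ci (cintZ mI _ Y2.1)) (cintegralZ mI _ Y2.1) Y2.2.
    by rewrite mulrN1 subrK.
  rewrite (le_trans le)// (_ : e / 20 * (10 * b) * (a + b^-1 - a) = e / 2)//.
  by field; rewrite gt_eqF.
set A1 := dotp _ _ _ _ in T1 *; set A2 := dotp _ _ _ _ in T2 *; set A4 := dotp _ _ _ _ in T4 *.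
set A3 := dotp _ _ _ _ in T3 *.
rewrite (_ : _ - _ - _ = A1 - 2%:R * A2 - A3 - (A4 + y a * (z a)^*)); last by ring.
rewrite (le_lt_trans (le_normcD _ _))// normcN.
rewrite (@le_lt_trans _ _ ((C1 + C3 + 6 * N * M) / b + e / 2))//; last by move: bK; lra.
rewrite lerD// (le_trans (le_normcD _ _))// normcN.
have h2 : normc (2%:R * A2) <= 6 * N * M / b.
  rewrite normcM (_ : 2%:R = (2%:R : R)%:C); last by rewrite rmorph_nat.
  rewrite normcR normr_nat; move: T2; rewrite -!mulrA; lra.
have h1 := le_normcD A1 (- (2%:R * A2)); rewrite normcN in h1.
apply: (le_trans (lerD (le_trans h1 (lerD T1 h2)) T3)).
by rewrite !mulrDl addrAC.
Qed.

End green.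

(** * Green's identity on the maximal domain *)

Section green_formula.
Context {R : realType} (a : R) (q : R -> R) (theta : R).
Implicit Types (u v y z f g : R -> R[i]) (x t b : R).
Local Notation Ia := (`[a, +oo[%classic : set R).
Local Notation mu := (@lebesgue_measure R).
Local Notation ell := (ell a q).
Local Notation cderiv := (cderiv a).
Local Notation Dstar := (Dstar a q).
Local Notation dot := (dota a).
Local Notation G := (green_form a q).
Let mI := @measurable_Ia R a.

Definition Dtheta y : Prop := Dstar y /\ cderiv y a = theta%:C * y a.

Definition D0 y : Prop := [/\ Dstar y, y a = 0 & cderiv y a = 0].

Lemma D0_Dth y : D0 y -> Dtheta y.
Proof. by case=> D y0 dy0; split => //; rewrite y0 dy0 mulr0. Qed.

Lemma Dtheta_D0 y : Dtheta y -> y a = 0 -> D0 y.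
Proof. by case=> D dy y0; split => //; rewrite dy y0 mulr0. Qed.

Lemma schr_op_mem (bc : R[i] -> R[i] -> Prop) y : Dstar y -> bc (y a) (cderiv y a) ->
  schr_op a q bc (y, ell y).
Proof.
move=> D h; split => /=; [exact: Dstar_L2 D|exact: Dstar_L2ell D|].
by exists y; split => //; exact: aeqa_refl.
Qed.

(** By continuity a discrepancy at x persists on some [x, x + d[, which has positive measure. Taking
    the interval to the right of x covers x = a. *)
Lemma Dstar_ae_eq y z : Dstar y -> Dstar z -> aeqa a y z -> forall x, a <= x -> y x = z x.
Proof.
move=> Dy Dz yz x ax; apply/eqP/negPn/negP => nyz.
have lac : loc_abs_cont a (fun t => -1 * z t + y t).
  by apply: loc_abs_cont_lin; [exact: Dstar_ac Dz|exact: Dstar_ac Dy].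
have /loc_abs_cont_ReIm[/racont_econt rr /racont_econt ri] := lac.
have dz : 0 < normc (y x - z x) by apply: normc_gt0; rewrite subr_eq0.
have d4 : 0 < normc (y x - z x) / 4 by rewrite divr_gt0.
have [d1 d10 H1] := rr x ax _ d4; have [d2 d20 H2] := ri x ax _ d4.
have [N [mN N0 NN]] := yz.
pose d := Num.min d1 d2.
have d0 : 0 < d by rewrite lt_min d10.
have sub : `[x, x + d[ `<=` N.
  move=> t /=; rewrite in_itv/= => /andP[xt td]; apply: NN => /= h.
  have at_ : a <= t := le_trans ax xt.
  have yzt : y t = z t by apply: h; rewrite /= in_itv/= at_.
  have tx : `|t - x| < d by rewrite ger0_norm ?subr_ge0// ltrBlDl.
  move: tx; rewrite lt_min => /andP[t1 t2].
  have := H1 t at_ t1; have := H2 t at_ t2.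
  rewrite !mulN1r yzt addNr /= !sub0r !normrN => k2 k1.
  have := normc_le_ReIm (- z x + y x); rewrite [- z x + _]addrC in k1 k2 *.
  move: k1 k2 d4; set r1 := `|_|; set r2 := `|_|; set r3 := normc _; lra.
have := le_measure mu _ _ sub; rewrite !inE => /(_ (measurable_itv _) mN).
apply/negP; rewrite -ltNge [X in (X < _)%E](_ : _ = 0%E)//.
have mpos : (0 < mu (`[x, (x + d)%R[%classic : set R))%E.
  by rewrite lebesgue_measure_itv/= lte_fin ltrDl d0 -EFinB lte_fin addrAC subrr add0r.
exact: mpos.
Qed.

Lemma Dstar_lin0 (k : R[i]) y z : locally_summable a q -> Dstar y -> Dstar z ->
  [/\ Dstar (fun x => k * y x + z x),
      cderiv (fun x => k * y x + z x) a = k * cderiv y a + cderiv z a &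
      aeqa a (ell (fun x => k * y x + z x)) (fun x => k * ell y x + ell z x)].
Proof. by move=> ql Dy Dz; have [h1 h2 h3] := Dstar_lin ql k Dy Dz; split => //; exact: h2. Qed.

Hypothesis q_loc : locally_summable a q.
Hypothesis B_def : deficiency_indices_11 mu Ia (B_op a q).
Hypothesis Bt_sa : selfadjoint_op mu Ia (T_op a q theta%:C).

Lemma Dtheta_lin (k : R[i]) y z : Dtheta y -> Dtheta z -> Dtheta (fun x => k * y x + z x).
Proof.
move=> [Dy dy] [Dz dz]; have [D1 D2 _] := Dstar_lin0 k q_loc Dy Dz; split => //.
by rewrite D2 dy dz; ring.
Qed.

Lemma Dtheta_sym y z : Dtheta y -> Dtheta z -> dot (ell y) z = dot y (ell z).
Proof.
move=> [Dy dy] [Dz dz].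
have : adjoint mu Ia (T_op a q theta%:C) (z, ell z).
  by rewrite -Bt_sa; exact: schr_op_mem.
by case=> _ _; apply; exact: schr_op_mem.
Qed.

(** If y(a) vanished throughout D(B_theta), then B_theta = B would be self-adjoint, and a deficiency
    vector u at i would satisfy i (u, u) = -i (u, u). *)
Lemma Dtheta_ex1 : exists2 y, Dtheta y & y a = 1.
Proof.
have [[y [[D dy] ya]]|H] := pselect (exists y, Dtheta y /\ y a <> 0).
  (* The multiple y / y(a) is written as k y + y, the shape of linear combination that [Dstar_lin0]
     handles; later scalings use the same device. *)
  have [D0' D1 _] := Dstar_lin0 ((y a)^-1 - 1) q_loc D D.
  exists (fun x => ((y a)^-1 - 1) * y x + y x).
    by split => //; rewrite D1 dy; ring.
  by field; apply/eqP.
exfalso.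
have TB : T_op a q theta%:C = B_op a q.
  apply/seteqP; split => -[f g] [/= h1 h2 [y [D bc e1 e2]]]; split => //; exists y; split => //.
    have ya : y a = 0 by apply: contra_notP H => ya; exists y.
    by rewrite bc ya mulr0.
  by case: bc => -> ->; rewrite mulr0.
have [[u [Nu nu] _] _] := B_def; apply: nu.
have : T_op a q theta%:C (u, fun x => 'i * u x) by rewrite Bt_sa TB.
case=> /= Lu Liu [y [D bc e1 e2]].
have L := @Dstar_L2 _ a q; have E := @Dstar_L2ell _ a q.
have s := Dtheta_sym (conj D bc) (conj D bc).
have e1' : aeqa a y u by apply: ae_lebesgueS e1 => x h Dx; rewrite h.
have e2' : aeqa a (ell y) (fun x => 'i * u x) by apply: ae_lebesgueS e2 => x h Dx; rewrite h.
move: s; rewrite /dota (dot_aeq mI (E _ D) Liu (L _ D) Lu e2' e1').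
rewrite (dot_aeq mI (L _ D) Lu (E _ D) Liu e1' e2') (dotZl mI _ Lu Lu) (dotZr mI _ Lu Lu).
move=> h; apply: (sqn_eq0 mI Lu); move: h; rewrite (dot_self mI Lu).
by set s := sqn _ _ _; rewrite /conjc => -[] _; lra.
Qed.

Let y0 := xget (fun=> 0) [set y | Dtheta y /\ y a = 1].

Lemma unit_DthetaP : Dtheta y0 /\ y0 a = 1.
Proof. by have [y h1 h2] := Dtheta_ex1; apply: (@xgetPex _ (fun=> 0) [set y | Dtheta y /\ y a = 1]); exists y. Qed.

Let y0D : Dstar y0. Proof. by have [[]] := unit_DthetaP. Qed.

Lemma bump_diff b : 0 < b -> D0 (fun x => -1 * bump a b y0 x + bump a 1 y0 x).
Proof.
move=> b0; have [D1 D2 D3 _] := bump_Dstar q_loc b0 y0D.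
have [E1 E2 E3 _] := bump_Dstar q_loc ltr01 y0D.
have [F1 F2 _] := Dstar_lin0 (-1) q_loc D1 E1; split => //.
  by rewrite D2 E2 mulr0 addr0.
by rewrite F2 D3 E3 mulN1r addNr.
Qed.

Let u := bump a 1 y0.
Let uD : Dstar u. Proof. by have [] := bump_Dstar q_loc ltr01 y0D. Qed.
Let ua : u a = 0. Proof. by have [] := bump_Dstar q_loc ltr01 y0D. Qed.
Let du : cderiv u a = 1. Proof. by have [_ _ -> _] := bump_Dstar q_loc ltr01 y0D; rewrite unit_DthetaP.2. Qed.

Let G_bump z : Dstar z -> (forall d, D0 d -> G d z = 0) -> G u z = (z a)^*.
Proof.
move=> Dz H; apply/eqP/negPn/negP => ne.
have e0 : 0 < normc (G u z - (z a)^*) by apply: normc_gt0; rewrite subr_eq0.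
have [b b0] := bump_green q_loc y0D Dz e0; rewrite unit_DthetaP.2 mul1r.
have [D1 _ _ _] := bump_Dstar q_loc b0 y0D.
have := H _ (bump_diff b0); rewrite (green_form_lin q_loc _ D1 uD Dz) mulN1r => h.
have -> : G u z = G (bump a b y0) z by apply/esym/eqP; rewrite -subr_eq0 -oppr_eq0 opprB addrC h.
by rewrite ltxx.
Qed.

Let G_uth z : Dtheta z -> G u z = (z a)^*.
Proof.
move=> Dz; apply: G_bump; first by case: Dz.
by move=> d /D0_Dth dth; rewrite /green_form (Dtheta_sym dth Dz) subrr.
Qed.

(** [G_bump] applies with z = u: for d in D(B) the hermitian symmetry reduces G d u to G u d, which
    is the conjugate of d(a) = 0. *)
Let G_uu : G u u = 0.
Proof.
rewrite G_bump//; first by rewrite ua conjc0.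
by move=> d dd; have [D da _] := dd; rewrite (green_form_herm uD D) (G_uth (D0_Dth dd)) da conjc0 conjc0 oppr0.
Qed.

(** Every y in the maximal domain is c u plus an element of D(B_theta), with c = y'(a) - theta y(a).
    The form vanishes at (u, u) and on D(B_theta), so only the mixed terms survive, and [G_uth]
    evaluates them. *)
Lemma green y z : Dstar y -> Dstar z ->
  dot (ell y) z - dot y (ell z) = cderiv y a * (z a)^* - y a * (cderiv z a)^*.
Proof.
move=> Dy Dz; rewrite -/(G y z).
have dec w : Dstar w -> let c := cderiv w a - theta%:C * w a in
    Dtheta (fun x => - c * u x + w x) /\ w = (fun x => c * u x + (- c * u x + w x)).
  move=> Dw c; split; last by apply/funext => x; rewrite mulNr addrA subrr add0r.
  have [D1 D2 _] := Dstar_lin0 (- c) q_loc uD Dw; split => //.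
  by rewrite D2 du ua mulr0 add0r /c; ring.
have [] := dec y Dy; have [] := dec z Dz.
set c := cderiv z a - _; set d := cderiv y a - _.
set v' := (fun x => - c * u x + z x); set v := (fun x => - d * u x + y x).
move=> Dv' ez Dv ey.
have va : v a = y a by rewrite /v ua mulr0 add0r.
have va' : v' a = z a by rewrite /v' ua mulr0 add0r.
have dvth := Dv; have dvth' := Dv'; case: Dv => Dv _; case: Dv' => Dv' _.
have [Dcu _ _] := Dstar_lin0 c q_loc uD Dv'; rewrite -ez in Dcu.
have GE w : Dstar w -> G w z = c^* * G w u + G w v'.
  move=> Dw; rewrite (green_form_herm Dcu Dw) {1}ez (green_form_lin q_loc _ uD Dv' Dw) conjcD conjcM opprD -mulrN.
  by rewrite -(green_form_herm uD Dw) -(green_form_herm Dv' Dw).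
rewrite {1}ey (green_form_lin q_loc _ uD Dv Dz) !GE// G_uu mulr0 add0r.
rewrite (G_uth dvth') (green_form_herm uD Dv) (G_uth dvth) conjcK.
have -> : G v v' = 0 by rewrite /green_form (Dtheta_sym dvth dvth') subrr.
rewrite va va' /c /d conjcB conjcM conjc_real; ring.
Qed.

Lemma Dstar_boundary_ex (c0 c1 : R[i]) : exists y, [/\ Dstar y, y a = c0 & cderiv y a = c1].
Proof.
have [D1 D2 _] := Dstar_lin0 (c0 - 1) q_loc y0D y0D.
have [E1 E2 _] := Dstar_lin0 (c1 - theta%:C * c0) q_loc uD D1.
have [[_ dy0] ya] := unit_DthetaP.
exists (fun x => (c1 - theta%:C * c0) * u x + ((c0 - 1) * y0 x + y0 x)); split => //.
  by rewrite ya ua; ring.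
by rewrite E2 D2 du dy0 ya; ring.
Qed.

End green_formula.

(** * Weyl solutions and the distribution function *)
Section cauchy_kernel_facts.
Context {R : realType}.
Implicit Types (z : R[i]) (t : R).
Local Notation J := (`[0, +oo[%classic : set R).

Lemma resolvent_bound z : ~~ (0 <= z) -> exists2 c : R, 0 < c &
  forall t, 0 <= t -> c * (1 + t) <= normc (t%:C - z).
Proof.
move=> nz; have n0 := normc_ge0 z.
have [iz|iz] := eqVneq (Im z) 0.
  have xz : Re z < 0.
    by rewrite ltNge; apply: contra nz => rz; rewrite lecE/= iz eqxx.
  exists (Num.min 1 (- Re z)); first by rewrite lt_min ltr01 oppr_gt0.
  move=> t t0; apply: le_trans (le_trans (ler_norm _) (le_Re_normc _)).
  rewrite !ReImE/=; have m1 : Num.min 1 (- Re z) <= 1 by rewrite ge_min lexx.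
  have m2 : Num.min 1 (- Re z) <= - Re z by rewrite ge_min lexx orbT.
  rewrite mulrDr mulr1 addrC lerD//; first by rewrite ler_piMl.
have ni : 0 < `|Im z| by rewrite normr_gt0.
have n1 : 0 < 1 + normc z + `|Im z| by rewrite ltr_wpDl// addr_ge0.
(* This constant comes from adding |w| >= |Im z| with weight 1 + |z| and |w| >= t - |z| with weight
   |Im z|. *)
exists (`|Im z| / (1 + normc z + `|Im z|)); first by rewrite divr_gt0.
move=> t t0; set w := t%:C - z.
have h1 : `|Im z| <= normc w.
  by rewrite (le_trans _ (le_Im_normc _))// /w !ReImE/= sub0r normrN.
have h2 : t - normc z <= normc w.
  rewrite lerBlDr (_ : t = normc (w + z)); first exact: le_normcD.
  by rewrite /w subrK normcR ger0_norm.
rewrite mulrAC ler_pdivrMr//.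
have h3 : (1 + normc z) * `|Im z| <= (1 + normc z) * normc w.
  by rewrite ler_wpM2l// addr_ge0.
have h4 : (t - normc z) * `|Im z| <= normc w * `|Im z| by rewrite ler_wpM2r.
have := mulr_ge0 n0 (normc_ge0 w); move: h3 h4; nra.
Qed.

Lemma resolvent_neq0 z t : ~~ (0 <= z) -> 0 <= t -> t%:C - z != 0.
Proof. by move=> nz t0; apply: contra nz; rewrite subr_eq0 => /eqP <-; rewrite ler0c. Qed.

Lemma conj_nonneg z : ~~ (0 <= z) -> ~~ (0 <= z^*).
Proof. by apply: contra; rewrite !lecE !ReImE/= oppr_eq0. Qed.

Definition cauchy_kernel z t : R[i] := (t%:C - z)^-1.

Lemma cauchy_kernelK z t : ~~ (0 <= z) -> 0 <= t -> (t%:C - z) * cauchy_kernel z t = 1.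
Proof. by move=> nz t0; rewrite /cauchy_kernel divff// resolvent_neq0. Qed.

Lemma cauchy_kernel_bound z : ~~ (0 <= z) -> exists2 c : R, 0 < c &
  forall t, 0 <= t -> normc (cauchy_kernel z t) <= c * (1 + t)^-1.
Proof.
move=> nz; have [c c0 H] := resolvent_bound nz; exists c^-1; first by rewrite invr_gt0.
move=> t t0; rewrite /cauchy_kernel normcV -invfM lef_pV2 ?posrE ?H//.
  by rewrite normc_gt0// resolvent_neq0.
by rewrite mulr_gt0// ltr_wpDr.
Qed.

Lemma cauchy_kernel_lip z : ~~ (0 <= z) -> exists2 c : R, 0 < c &
  forall s t, 0 <= s -> 0 <= t -> normc (cauchy_kernel z t - cauchy_kernel z s) <= c * `|t - s|.
Proof.
move=> nz; have [c c0 H] := cauchy_kernel_bound nz; exists (c ^+ 2); first by rewrite exprn_gt0.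
move=> s t s0 t0; have s1 := resolvent_neq0 nz s0; have t1 := resolvent_neq0 nz t0.
have -> : cauchy_kernel z t - cauchy_kernel z s = cauchy_kernel z t * cauchy_kernel z s * (s - t)%:C.
  rewrite /cauchy_kernel rmorphB/=; field.
  by rewrite s1 t1.
rewrite !normcM normcR distrC expr2 ler_wpM2r//.
have le1 r : 0 <= r -> normc (cauchy_kernel z r) <= c.
  move=> r0; rewrite (le_trans (H r r0))// ler_piMr ?(ltW c0)// invf_le1 ?lerDl//.
  by rewrite ltr_wpDr.
by rewrite ler_pM ?normc_ge0 ?le1.
Qed.

Lemma cauchy_kernel_meas z : ~~ (0 <= z) -> cmeas J (cauchy_kernel z).
Proof.
move=> nz; have [c c0 H] := cauchy_kernel_lip nz.
split; apply: econt_measurable; apply: racont_econt => b b0;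
  apply: (@racont_lip _ _ _ _ c) => [|x y /andP[x0 _] /andP[y0 _]]; try exact: ltW.
- rewrite (le_trans _ (H _ _ x0 y0))// (le_trans _ (le_Re_normc _))//.
  by rewrite !ReImE.
- rewrite (le_trans _ (H _ _ x0 y0))// (le_trans _ (le_Im_normc _))//.
  by rewrite !ReImE.
Qed.

End cauchy_kernel_facts.

Lemma dot0l {R : realType} (m : {measure set (measurableTypeR R) -> \bar R}) (D : set R)
  (mD : measurable (D : set (measurableTypeR R))) (g : R -> R[i]) : dotp m D (fun=> 0) g = 0.
Proof.
have z0 : Rintegral m D (fun=> 0) = 0 by rewrite Rintegral_cst// mul0r.
rewrite dotpE; apply: complexP; rewrite /cintegral/= -[RHS]z0; apply: eq_Rintegral => x _;
  by rewrite mul0r.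
Qed.

(** * Weyl solutions on the spectral side *)

Section spectral.
Context {R : realType} (a : R) (q : R -> R) (theta : R) (sigma : distr_fun R).
Implicit Types (u v y f g phi : R -> R[i]) (x t b : R) (z : R[i]).
Local Notation Ia := (`[a, +oo[%classic : set R).
Local Notation J := (`[0, +oo[%classic : set R).
Local Notation mu := (@lebesgue_measure R).
Local Notation ell := (ell a q).
Local Notation cderiv := (cderiv a).
Local Notation Dstar := (Dstar a q).
Local Notation Dtheta := (Dtheta a q theta).
Local Notation dot := (dota a).
Let mI := @measurable_Ia R a.
Let mJ := @measurable_Ia R 0.

Hypothesis q_loc : locally_summable a q.
Hypothesis B_def : deficiency_indices_11 mu Ia (B_op a q).
Hypothesis Bt_sa : selfadjoint_op mu Ia (T_op a q theta%:C).

Let m := distr_measure sigma.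
Local Notation L2s := (inL2 m J).
Hypothesis int1 : (\int[m]_(t in J) ((1 + t)^-1)%:E < +oo)%E.
Variable U : (R -> R[i]) -> (R -> R[i]).
Hypothesis U_L2 : forall f, L2a a f -> L2s (U f).
Hypothesis U_lin : forall (k : R[i]) f g, L2a a f -> L2a a g ->
  aeq m J (U (fun x => k * f x + g x)) (fun t => k * U f t + U g t).
Hypothesis U_iso : forall f g, L2a a f -> L2a a g -> dotp m J (U f) (U g) = dot f g.
Hypothesis U_surj : forall phi, L2s phi -> exists2 f, L2a a f & aeq m J (U f) phi.
Hypothesis U_op : forall f g, L2a a f -> L2a a g ->
  (T_op a q theta%:C (f, g) <-> mult_op sigma (U f, U g)) /\
  (B_op a q (f, g) <-> mult0_op sigma (U f, U g)).

Let L := @Dstar_L2 _ a q.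
Let E := @Dstar_L2ell _ a q.

Let aeq_sym f g : aeq m J f g -> aeq m J g f.
Proof. by apply: filterS => x h Dx; rewrite h. Qed.

Let aeq_trans f g h : aeq m J f g -> aeq m J g h -> aeq m J f h.
Proof. by apply: filterS2 => x h1 h2 Dx; rewrite h1// h2. Qed.

Let aeq_refl f : aeq m J f f.
Proof. by apply: (@aeW _ (measurableTypeR R) R m) => x. Qed.

Let int1_rint : rint m J (fun t => (1 + t)^-1).
Proof.
apply/integrableP; split.
  apply/measurable_EFinP.
  have n1 : ~~ ((0 : R[i]) <= -1) by rewrite lecE/= oppr_ge0 ler10 andbF.
  have [h _] := cauchy_kernel_meas n1; apply: eq_measurable_fun h => t.
  move=> _; have -> : cauchy_kernel (-1) t = ((1 + t)^-1)%:C; last by [].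
  by rewrite fmorphV/= rmorphD/= rmorph1 addrC /cauchy_kernel opprK.
apply: le_lt_trans int1; rewrite le_eqVlt; apply/orP; left; apply/eqP.
apply: eq_integral => t.
by rewrite /= inE/= in_itv/= andbT => t0; rewrite ger0_norm// invr_ge0 addr_ge0.
Qed.

Let sq1_le t : 0 <= t -> (1 + t)^-1 ^+ 2 <= (1 + t)^-1.
Proof.
move=> t0; rewrite expr2 ler_piMr ?invr_ge0 ?addr_ge0// invf_le1 ?lerDl//.
by rewrite ltr_wpDr.
Qed.

Lemma cauchy_kernel_L2 z : ~~ (0 <= z) -> L2s (cauchy_kernel z).
Proof.
move=> nz; have [c c0 H] := cauchy_kernel_bound nz.
apply: (L2_dom mJ (cauchy_kernel_meas nz) _ (rintZ mJ (c ^+ 2) int1_rint)) => t.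
rewrite /= in_itv/= andbT => t0; rewrite (@le_trans _ _ ((c * (1 + t)^-1) ^+ 2))//.
  by rewrite ler_sqr ?nnegrE ?normc_ge0 ?H// mulr_ge0 ?(ltW c0)// invr_ge0 addr_ge0.
by rewrite exprMn ler_wpM2l ?sqr_ge0 ?sq1_le.
Qed.

Lemma cauchy_kernel_cint z : ~~ (0 <= z) -> cint m J (cauchy_kernel z).
Proof.
move=> nz; have [c c0 H] := cauchy_kernel_bound nz.
apply: (le_cint mJ (cauchy_kernel_meas nz) _ (rintZ mJ c int1_rint)) => t.
by rewrite /= in_itv/= andbT => t0; exact: H.
Qed.

(** [U] acts on functions, not on classes; being isometric and linear up to null sets, it sends a
    null difference to a null difference. *)
Lemma U_ae f g : L2a a f -> L2a a g -> aeqa a f g -> aeq m J (U f) (U g).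
Proof.
move=> Lf Lg fg; have Lh := L2_lin mI (-1) Lg Lf.
have h0 : aeqa a (fun x => -1 * g x + f x) (fun=> 0).
  by apply: ae_lebesgueS fg => x h Dx; rewrite h// mulN1r addNr.
have := U_iso Lh Lh; rewrite /dota (dot_aeq mI Lh (L20 mu mI) Lh (L20 mu mI) h0 h0).
rewrite (dot0l mu mI).
move=> /(congr1 (@complex.Re R)) z0; have := sqn_eq0 mJ (U_L2 Lh) z0.
apply: filterS2 (U_lin (-1) Lg Lf) => x h1 h2 Dx.
by have := h1 Dx; rewrite h2// mulN1r => /eqP; rewrite eq_sym addrC subr_eq0 => /eqP.
Qed.

Lemma U_ell y : Dtheta y -> aeq m J (U (ell y)) (fun t => t%:C * U y t).
Proof.
move=> [D bc]; have T := schr_op_mem (bc := fun c0 c1 => c1 = theta%:C * c0) D bc.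
by have [/(_ T)[]] := (U_op (L D) (E D)).1.
Qed.

(** If U f' = U f / (t - z), then t U f' = U (z f' + f), so the unitary equivalence puts (f', z f' +
    f) in the graph of B_theta. That graph is saturated for equality almost everywhere; w is the
    representative of f' in the domain. *)
Lemma resolvent z f : ~~ (0 <= z) -> L2a a f ->
  exists w, [/\ Dtheta w, aeqa a (ell w) (fun x => z * w x + f x) &
    aeq m J (U w) (fun t => cauchy_kernel z t * U f t)].
Proof.
move=> nz Lf; have [c c0 H] := cauchy_kernel_bound nz.
have Lc : L2s (fun t => cauchy_kernel z t * U f t).
  apply: (@L2M _ _ _ mJ _ c _ (cauchy_kernel_meas nz) _ (U_L2 Lf)) => t.
  rewrite /= in_itv/= andbT => t0; apply: (le_trans (H t t0)).
  rewrite ler_piMr ?(ltW c0)// invf_le1 ?lerDl//.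
  by rewrite ltr_wpDr.
have [f' Lf' Uf'] := U_surj Lc.
have Lg := L2_lin mI z Lf' Lf.
have Ug : aeq m J (U (fun x => z * f' x + f x)) (fun t => t%:C * U f' t).
  apply: filterS2 (U_lin z Lf' Lf) Uf' => t h1 h2 Dt.
  rewrite h1// h2//; have t0 : 0 <= t by move: Dt; rewrite /= in_itv/= andbT.
  have := cauchy_kernelK nz t0; rewrite mulrBl => /eqP; rewrite subr_eq => /eqP.
  by rewrite !mulrA => ->; rewrite mulrDl mul1r addrC.
have Um : mult_op sigma (U f', U (fun x => z * f' x + f x)).
  by split; [exact: (U_L2 Lf')|exact: (U_L2 Lg)|exact: Ug].
have [_ _ [w [Dw bc e1 e2]]] := (U_op Lf' Lg).1.2 Um.
exists w; split => //.
  by apply: ae_lebesgueS2 e1 e2 => x h1 h2 Dx; rewrite -(h2 Dx) /= -(h1 Dx).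
by apply: (aeq_trans _ Uf'); apply: aeq_sym; exact: (U_ae Lf' (L Dw) e1).
Qed.

(** On the spectral side the equation reads (t - z) U y = 0, and t - z has no zero on [0, +oo[. *)
Lemma Dtheta_ker0 z y : ~~ (0 <= z) -> Dtheta y -> aeqa a (ell y) (fun x => z * y x) ->
  forall x, a <= x -> y x = 0.
Proof.
move=> nz Dy ely; have D := Dy.1.
have h1 := U_ae (E D) (L2Z mI z (L D)) ely.
have Uy0 : aeq m J (U y) (fun=> 0).
  have h3 : aeq m J (U (fun x => z * y x)) (fun t => z * U y t).
    have h := U_lin (z - 1) (L D) (L D).
    have <- : (fun x => (z - 1) * y x + y x) = (fun x => z * y x) by apply/funext => x; ring.
    by apply: filterS h => t h Dt; rewrite h//; ring.
  have h2 := U_ell Dy; have h4 := aeq_trans (aeq_sym h2) (aeq_trans h1 h3).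
  apply: filterS h4 => t h Dt; have t0 : 0 <= t by move: Dt; rewrite /= in_itv/= andbT.
  have /eqP := h Dt; rewrite -subr_eq0 -mulrBl mulf_eq0 (negbTE (resolvent_neq0 nz t0))/=.
  by move/eqP.
have y0 : aeqa a y (fun=> 0).
  apply: (sqn_eq0 mI (L D)); rewrite /sqn -[dotp _ _ _ _]/(dot y y) -U_iso; try exact: L.
  rewrite (dot_aeq mJ (U_L2 (L D)) (L20 m mJ) (U_L2 (L D)) (L20 m mJ) Uy0 Uy0).
  by rewrite (dot0l m mJ).
have [D00 _ _] := Dstar_lin0 (-1) q_loc D D.
have h : aeqa a y (fun x => -1 * y x + y x).
  by apply: ae_lebesgueS y0 => t h Dt; rewrite mulN1r addNr h.
by move=> x ax; rewrite (Dstar_ae_eq D D00 h ax) mulN1r addNr.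
Qed.

Let ckJ z t : (cauchy_kernel z t)^* = cauchy_kernel (z^*) t.
Proof. by rewrite /cauchy_kernel conjcV conjcB conjc_real. Qed.

(** U y = (U y + U (ell y)) / (1 + t) is a product of two L_2 functions, since (1 + t)^-2 <= (1 +
    t)^-1. *)
Lemma Dtheta_cint y : Dtheta y -> cint m J (U y).
Proof.
move=> Dy; have D := Dy.1; have Lg := L2D mJ (U_L2 (L D)) (U_L2 (E D)).
have n1 : ~~ ((0 : R[i]) <= -1) by rewrite lecE/= oppr_ge0 ler10 andbF.
have ci := L2_cint mJ Lg (cauchy_kernel_L2 n1).
apply: (cint_aeq mJ ci (L2_meas (U_L2 (L D))) _).1.
apply: filterS (U_ell Dy) => t h Dt; rewrite (h Dt) ckJ conjcN conj1c.
have t0 : 0 <= t by move: Dt; rewrite /= in_itv/= andbT.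
transitivity (U y t * ((t%:C - -1) * cauchy_kernel (-1) t)); first by rewrite (cauchy_kernelK n1 t0) mulr1.
by ring.
Qed.

Definition U_integral y : R[i] := cintegral m J (U y).

Lemma U_integral_lin (k : R[i]) y v : Dtheta y -> Dtheta v -> U_integral (fun x => k * y x + v x) = k * U_integral y + U_integral v.
Proof.
move=> Dy Dv; have cy := Dtheta_cint Dy; have cv := Dtheta_cint Dv.
have D := Dtheta_lin q_loc k Dy Dv.
rewrite /U_integral -(cintegralZ mJ _ cy) -(cintegralD mJ (cintZ mJ k cy) cv).
apply: (cint_aeq mJ _ (L2_meas (U_L2 (L D.1))) (U_lin k (L Dy.1) (L Dv.1))).2.
exact: (cintD mJ (cintZ mJ k cy) cv).
Qed.

Lemma U_integral_eq0 y : Dtheta y -> (U_integral y = 0 <-> y a = 0).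
Proof.
move=> Dy; have D := Dy.1.
have T := schr_op_mem (bc := fun c0 c1 => c1 = theta%:C * c0) D Dy.2.
have M := (U_op (L D) (E D)).1.1 T; have B := (U_op (L D) (E D)).2; split=> h.
  have [_ _ [y' [D' [bc0 _] e1 _]]] := B.2 (conj M h).
  by rewrite (Dstar_ae_eq D D' e1 (lexx a)).
have [D1 h0 h1] := Dtheta_D0 Dy h.
have T0 := schr_op_mem (bc := fun c0 c1 => c0 = 0 /\ c1 = 0) D (conj h0 h1).
by have [] := B.1 T0.
Qed.

Lemma U_integral_ex : exists2 I0 : R[i], I0 != 0 & forall y, Dtheta y -> U_integral y = y a * I0.
Proof.
have [y0 Dy0 y0a] := Dtheta_ex1 q_loc B_def Bt_sa; exists (U_integral y0).
  apply/eqP => h; have := (U_integral_eq0 Dy0).1 h; rewrite y0a => /eqP.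
  by rewrite oner_eq0.
move=> y Dy; have D := Dtheta_lin q_loc (- y a) Dy0 Dy.
have ya : (fun x => - y a * y0 x + y x) a = 0 by rewrite /= y0a mulr1 addNr.
have := (U_integral_eq0 D).2 ya; rewrite (U_integral_lin _ Dy0 Dy) => /eqP.
by rewrite mulNr addrC subr_eq0 => /eqP.
Qed.

Definition is_weyl z phi : Prop :=
  [/\ Dstar phi, aeqa a (ell phi) (fun x => z * phi x) & cderiv phi a = 1 + theta%:C * phi a].

(** Let u have boundary values (0, 1), and subtract from it the resolvent of B_theta applied to (ell
    - z) u. An element of D(B_theta) does not affect the normalization y'(a) - theta y(a) = 1. *)
Lemma weyl_ex z : ~~ (0 <= z) -> exists phi, is_weyl z phi.
Proof.
move=> nz; have [u [Du u0 u1]] := Dstar_boundary_ex q_loc B_def Bt_sa 0 1.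
have Lf := L2B mI (E Du) (L2Z mI z (L Du)).
have [w [Dw elw _]] := resolvent nz Lf.
have [D1 D2 D3] := Dstar_lin0 (-1) q_loc Dw.1 Du.
exists (fun x => -1 * w x + u x); split => //.
  by apply: ae_lebesgueS2 D3 elw => x h1 h2 Dx; rewrite (h1 Dx) (h2 Dx); ring.
by rewrite D2 Dw.2 u0 u1; ring.
Qed.

(** Subtracting c phi with c = y'(a) - theta y(a) leaves a solution in D(B_theta), which is zero. *)
Lemma weyl_uniq z y phi : ~~ (0 <= z) -> is_weyl z phi -> Dstar y -> aeqa a (ell y) (fun x => z * y x) ->
  forall x, a <= x -> y x = (cderiv y a - theta%:C * y a) * phi x.
Proof.
move=> nz [Dp ep dp] Dy ey x ax; set c := _ - _.
have [D1 D2 D3] := Dstar_lin0 (- c) q_loc Dp Dy.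
have D : Dtheta (fun x => - c * phi x + y x) by split => //; rewrite D2 dp /c; ring.
have := Dtheta_ker0 nz D _ ax; rewrite mulNr => h; apply/eqP; rewrite -subr_eq0 addrC h//.
have e1 : aeqa a (ell (fun x => - c * phi x + y x)) (fun x => - c * (z * phi x) + ell y x).
  by apply: ae_lebesgueS2 D3 ep => t h1 h2 Dt; rewrite (h1 Dt) (h2 Dt).
by apply: ae_lebesgueS2 e1 ey => t h1 h2 Dt; rewrite (h1 Dt) (h2 Dt); ring.
Qed.

(** The difference of the two sides is orthogonal to every psi = U f. With w the resolvent of
    B_theta at conj z applied to f, Green's identity gives (f, phi) = -w(a), while psi against the
    kernel of z gives the integral of U w, which is w(a) I0; the factor in front of the kernel
    balances the two. *)
Lemma U_weyl (I0 : R[i]) z phi : I0 != 0 -> (forall y, Dtheta y -> U_integral y = y a * I0) ->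
  ~~ (0 <= z) -> is_weyl z phi ->
  aeq m J (U phi) (fun t => - (I0^-1)^* * cauchy_kernel z t).
Proof.
move=> I00 II nz [Dp ep dp]; have nzc := conj_nonneg nz.
set C := - (I0^-1)^*.
have LC := L2Z mJ C (cauchy_kernel_L2 nz).
have Ld := L2B mJ (U_L2 (L Dp)) LC.
have main psi : L2s psi -> dotp m J psi (fun t => U phi t - C * cauchy_kernel z t) = 0.
  move=> Lpsi; have [f Lf Uf] := U_surj Lpsi.
  have [w [Dw elw Uw]] := resolvent nzc Lf.
  have Dw1 := Dw.1.
  rewrite (dotBr mJ (U_L2 (L Dp)) LC Lpsi) (dotZr mJ _ (cauchy_kernel_L2 nz) Lpsi).
  rewrite -(dot_aeq mJ (U_L2 Lf) Lpsi (U_L2 (L Dp)) (U_L2 (L Dp)) Uf (aeq_refl _)).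
  rewrite (U_iso Lf (L Dp)).
  have e1 : dot f phi = - w a.
    have := green q_loc B_def Bt_sa Dw1 Dp.
    have -> : (cderiv phi a)^* = 1 + theta%:C * (phi a)^*.
      by rewrite dp; apply: complexP; rewrite !ReImE/=; ring.
    rewrite Dw.2.
    have LZ := L2_lin mI (z^*) (L Dw1) Lf.
    rewrite (dot_aeql (E Dw1) LZ (L Dp) elw).
    rewrite (dot_aeqr (E Dp) (L2Z mI z (L Dp)) (L Dw1) ep) /dota.
    rewrite (dot_linl mI _ (L Dw1) Lf (L Dp)) (dotZr mI _ (L Dp) (L Dw1)).
    by rewrite addrAC subrr add0r => ->; ring.
  have e2 : dotp m J psi (cauchy_kernel z) = w a * I0.
    rewrite -II// /U_integral dotpE; apply: (cint_aeq mJ (Dtheta_cint Dw) _ _).2.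
      by apply: cmeasM; [exact: L2_meas Lpsi|apply: cmeasJ; exact: cauchy_kernel_meas].
    apply: filterS2 Uw Uf => t h1 h2 Dt.
    by rewrite (h1 Dt) (h2 Dt) ckJ mulrC.
  rewrite e1 e2 /C conjcN conjcK; field.
  by [].
have := main _ Ld => h.
have : sqn m J (fun t => U phi t - C * cauchy_kernel z t) = 0 by rewrite /sqn h.
move=> /(sqn_eq0 mJ Ld); apply: filterS => t h1 Dt.
by apply/eqP; rewrite -subr_eq0 (h1 Dt).
Qed.

Let ckm2 b : 1 <= b -> ~~ ((0 : R[i]) <= (- b ^+ 2)%:C).
Proof. by move=> b1; rewrite ler0c oppr_ge0 -ltNge exprn_gt0// (lt_le_trans ltr01). Qed.

Let ckm2E b t : cauchy_kernel (- b ^+ 2)%:C t = ((t + b ^+ 2)^-1)%:C.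
Proof. by rewrite fmorphV/= rmorphD/= /cauchy_kernel rmorphN/= opprK. Qed.

(** Only the difference of two Weyl solutions lies in D(B_theta), where the integral of [U]
    determines the value at a. Hence phi(a) is obtained up to a constant independent of z. *)
Lemma weyl_diff (I0 : R[i]) z z' phi phi' : I0 != 0 -> (forall y, Dtheta y -> U_integral y = y a * I0) ->
  ~~ (0 <= z) -> ~~ (0 <= z') -> is_weyl z phi -> is_weyl z' phi' ->
  phi a - phi' a = - (normc (I0^-1) ^+ 2)%:C *
    (cintegral m J (cauchy_kernel z) - cintegral m J (cauchy_kernel z')).
Proof.
move=> I00 II nz nz' hp hp'; have U1 := U_weyl I00 II nz hp; have U2 := U_weyl I00 II nz' hp'.
case: hp => Dp ep dp; case: hp' => Dp' ep' dp'.
have [D1 D2 D3] := Dstar_lin0 (-1) q_loc Dp' Dp.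
have D : Dtheta (fun x => -1 * phi' x + phi x) by split => //; rewrite D2 dp dp'; ring.
set C := - (I0^-1)^* in U1 U2.
have c1 := cintZ mJ C (cauchy_kernel_cint nz); have c2 := cintZ mJ (- C) (cauchy_kernel_cint nz').
have : U_integral (fun x => -1 * phi' x + phi x) = C * cintegral m J (cauchy_kernel z) - C * cintegral m J (cauchy_kernel z').
  rewrite -mulNr -(cintegralZ mJ _ (cauchy_kernel_cint nz)) -(cintegralZ mJ _ (cauchy_kernel_cint nz')).
  rewrite -(cintegralD mJ c1 c2); apply: (cint_aeq mJ (cintD mJ c1 c2) (L2_meas (U_L2 (L D1))) _).2.
  apply: aeq_trans (U_lin (-1) (L Dp') (L Dp)) _.
  by apply: filterS2 U1 U2 => t h1 h2 Dt; rewrite (h1 Dt) (h2 Dt); ring.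
rewrite (II _ D) mulN1r addrC => h.
have -> : phi a - phi' a = (phi a - phi' a) * I0 * I0^-1 by rewrite mulfK.
by rewrite h -mul_conjc /C; ring.
Qed.

Lemma sqn_weyl (I0 : R[i]) z phi : I0 != 0 -> (forall y, Dtheta y -> U_integral y = y a * I0) ->
  ~~ (0 <= z) -> is_weyl z phi ->
  sqn mu Ia phi = normc (I0^-1) ^+ 2 * sqn m J (cauchy_kernel z).
Proof.
move=> I00 II nz hp; have U1 := U_weyl I00 II nz hp; case: hp => Dp _ _.
have LC := L2Z mJ (- (I0^-1)^*) (cauchy_kernel_L2 nz).
rewrite /sqn -[dotp mu _ _ _]/(dot phi phi) -(U_iso (L Dp) (L Dp)).
rewrite (dot_aeq mJ (U_L2 (L Dp)) LC (U_L2 (L Dp)) LC U1 U1).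
rewrite (dotZl mJ _ (cauchy_kernel_L2 nz) LC) (dotZr mJ _ (cauchy_kernel_L2 nz) (cauchy_kernel_L2 nz)).
rewrite conjcN conjcK mulrA (dot_self mJ (cauchy_kernel_L2 nz)) mulrNN [_^* * _]mulrC mul_conjc.
by rewrite -rmorphM.
Qed.

Lemma sqnD_le f g : L2a a f -> L2a a g ->
  sqn mu Ia (fun x => f x + g x) <= 2 * sqn mu Ia f + 2 * sqn mu Ia g.
Proof.
move=> Lf Lg; have LD := L2D mI Lf Lg.
have [_ if_] := (inL2P _ _ _).1 Lf; have [_ ig] := (inL2P _ _ _).1 Lg.
have [_ ifg] := (inL2P _ _ _).1 LD.
rewrite !sqnE// -!RintegralZl// -RintegralD//; [|exact: rintZ..].
apply: le_Rintegral => //; first by apply: rintD; [|exact: rintZ..].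
move=> x _; have := le_normcD (f x) (g x).
have h1 := normc_ge0 (f x + g x); have h2 := normc_ge0 (f x); have h3 := normc_ge0 (g x).
have := sqr_ge0 (normc (f x) - normc (g x)).
move: h1 h2 h3; set p := normc _; set r := normc _; set s := normc _ => *; nra.
Qed.

(* phi(a) is a scalar product of phi with (ell + b^2)(y0 w), whose squared norm is
   O(b) because w has support of length 1/b; and |phi|^2 = O(b^-2). *)
Lemma weyl_asymptotic (I0 : R[i]) : I0 != 0 -> (forall y, Dtheta y -> U_integral y = y a * I0) ->
  exists2 K, 0 <= K & forall b, 1 <= b -> forall phi, is_weyl (- b ^+ 2)%:C phi ->
    normc (phi a) ^+ 2 <= K / b.
Proof.
move=> I00 II; have [y0 Dy0 y0a] := Dtheta_ex1 q_loc B_def Bt_sa; have D0y := Dy0.1.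
have a1 : a <= a + 1 by rewrite lerDl.
have [M M0 HM] := abs_cont_bounded a1 (Dstar_ac D0y).
have [N N0 HN] := abs_cont_bounded a1 (Dstar_dac D0y).
pose I1 := Rintegral m J (fun t => (1 + t)^-1).
(* 6 N + 11 M gathers the bounds 6 N of 2 y0' w', b M of b^2 y0 w and 10 b M of y0 w'', all compared
   with b >= 1. *)
pose K' := 2 * sqn mu Ia (ell y0) + 2 * (6 * N + 11 * M) ^+ 2.
have K'0 : 0 <= K'.
  apply: addr_ge0; apply: mulr_ge0 => //; [exact: sqn_ge0 (E D0y)|exact: sqr_ge0].
have I10 : 0 <= I1.
  apply: Rintegral_ge0 => t; rewrite /= in_itv/= andbT => t0.
  by rewrite invr_ge0 addr_ge0.
exists (K' * (normc (I0^-1) ^+ 2 * I1)).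
  by rewrite mulr_ge0// mulr_ge0 ?sqr_ge0.
move=> b b1 phi hp; have b0 : 0 < b by rewrite (lt_le_trans ltr01).
have nz := ckm2 b1; have S := sqn_weyl I00 II nz hp; case: hp => Dp ep dp.
(* One factor t + b^2 is bounded below by b^2, the other by 1 + t. *)
have ckn : sqn m J (cauchy_kernel (- b ^+ 2)%:C) <= b ^- 2 * I1.
  rewrite (sqnE mJ (cauchy_kernel_L2 nz)) -(RintegralZl _ mJ int1_rint).
  have [_ i1] := (inL2P _ _ _).1 (cauchy_kernel_L2 nz).
  apply: (le_Rintegral mJ i1 (rintZ mJ _ int1_rint)) => t Dt.
  have t0 : 0 <= t by move: Dt; rewrite /= in_itv/= andbT.
  rewrite ckm2E normcR.
  have tb : 0 < t + b ^+ 2 by rewrite ltr_wpDl// exprn_gt0.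
  rewrite gtr0_norm ?invr_gt0// exprVn -invfM lef_pV2 ?posrE ?exprn_gt0//; last first.
    by rewrite mulr_gt0 ?exprn_gt0// ltr_wpDr.
  have bb1 : 1 <= b ^+ 2 by rewrite expr_ge1// ltW.
  by rewrite [leRHS]expr2 ler_pM ?exprn_ge0 ?addr_ge0 ?(ltW b0)// ?lerDr// addrC lerD2l.
have ac : a <= a + b^-1 by rewrite lerDl invr_ge0 ltW.
have bi1 : b^-1 <= 1 by rewrite invf_le1.
have out x : a + b^-1 < x -> 1 <= b * (x - a).
  by move=> h; rewrite -ler_pdivrMl// mulr1 lerBrDl ltW.
have [D1 D2 D3 D4] := bump_Dstar q_loc b0 D0y; have [L1 L2] := bump_L2 b0 D0y.
have mw : cmeas Ia (fun x => (bump_w a b x)%:C).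
  by apply: cmeasR; apply: econt_measurable; apply: racont_econt => c; exact: bump_w_ac.
have wle x : Ia x -> normc (bump_w a b x)%:C <= b^-1.
  by rewrite normcR /= in_itv/= andbT; exact: bump_w_le.
pose g1 x := (bump_w a b x)%:C * ell y0 x.
pose g2 x := (b ^+ 2)%:C * bump a b y0 x - (2%:R * (cderiv y0 x * (bump_dw a b x)%:C) + y0 x * (bump_ddw a b x)%:C).
have Lg1 : L2a a g1 by exact: (L2M mI mw wle (E D0y)).
have Lg2 : L2a a g2 by exact: (L2B mI (L2Z mI _ (L D1)) (L2D mI (L2Z mI _ L1) L2)).
have Lg := L2D mI Lg1 Lg2.
have Lz := L2B mI (E D1) (L2Z mI (- b ^+ 2)%:C (L D1)).
have key : (phi a)^* = dot (fun x => g1 x + g2 x) phi.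
  have := green q_loc B_def Bt_sa D1 Dp; rewrite D2 D3 y0a mul0r subr0 mul1r => <-.
  rewrite (dot_aeqr (E Dp) (L2Z mI _ (L Dp)) (L D1) ep) /dota (dotZr mI _ (L Dp) (L D1)) conjc_real.
  rewrite -(dotZl mI _ (L D1) (L Dp)) -(dotBl mI (E D1) (L2Z mI _ (L D1)) (L Dp)).
  apply: (dot_aeql Lz Lg (L Dp)); apply: ae_lebesgueS D4 => x h Dx; rewrite (h Dx) /g1 /g2 rmorphN/=; ring.
have n1 : sqn mu Ia g1 <= sqn mu Ia (ell y0) * b.
  have [_ i1] := (inL2P _ _ _).1 Lg1; have [_ i2] := (inL2P _ _ _).1 (E D0y).
  rewrite (sqnE mI Lg1) (sqnE mI (E D0y)) -(RintegralZr _ mI i2).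
  apply: le_Rintegral => //.
    by have := rintZ mI b i2; apply: eq_integrable => // x _ /=; rewrite mulrC.
  move=> x Dx; rewrite /g1 normcM exprMn mulrC ler_wpM2l ?sqr_ge0//.
  have := wle x Dx => h; rewrite (@le_trans _ _ 1)// expr_le1// ?normc_ge0//.
  exact: le_trans h bi1.
have n2 : sqn mu Ia g2 <= (6 * N + 11 * M) ^+ 2 * b.
  have c0 : 0 <= (6 * N + 11 * M) * b by rewrite mulr_ge0 ?(ltW b0)// addr_ge0// mulr_ge0.
  have [||_] := @supp_L2 _ _ _ ac g2 _ c0 (L2_meas Lg2).
  - move=> x /andP[ax xc]; have xa1 : a <= x <= a + 1 by rewrite ax (le_trans xc)// lerD2l.
    have k0 : normc (bump a b y0 x) <= M * b^-1.
      by rewrite normcM normcR ler_pM ?normc_ge0 ?HM ?bump_w_le.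
    have k1 : normc (cderiv y0 x * (bump_dw a b x)%:C) <= N * 3.
      by rewrite normcM normcR ler_pM ?normc_ge0 ?HN ?bump_dw_le.
    have k2 : normc (y0 x * (bump_ddw a b x)%:C) <= M * (10 * b).
      by rewrite normcM normcR ler_pM ?normc_ge0 ?HM ?bump_ddw_le.
    rewrite (le_trans (le_normcD _ _))// normcN normcM normcR.
    have e2 : normc (2%:R * (cderiv y0 x * (bump_dw a b x)%:C)) <= 6 * N.
      rewrite normcM (_ : 2%:R = (2%:R : R)%:C); last by rewrite rmorph_nat.
      rewrite normcR normr_nat (_ : 6 * N = 2 * (N * 3)); last by ring.
      by rewrite ler_wpM2l.
    have e3 : `|b ^+ 2| * normc (bump a b y0 x) <= b * M.
      rewrite ger0_norm ?sqr_ge0// (_ : b * M = b ^+ 2 * (M * b^-1)); last by field; rewrite gt_eqF.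
      by rewrite ler_wpM2l ?sqr_ge0.
    have e4 := le_normcD (2%:R * (cderiv y0 x * (bump_dw a b x)%:C)) (y0 x * (bump_ddw a b x)%:C).
    have e5 : 6 * N <= 6 * N * b by rewrite ler_peMr// mulr_ge0.
    apply: (le_trans (lerD e3 (le_trans e4 (lerD e2 k2)))).
    rewrite (_ : (6 * N + 11 * M) * b = b * M + (6 * N * b + M * (10 * b))); last by ring.
    by rewrite lerD2l lerD2r.
  - move=> x /out h; rewrite /g2 /bump bump_w_out// bump_dw_out// bump_ddw_out//.
    by rewrite !mulr0 addr0 subr0.
  move=> h; apply: (le_trans h); rewrite le_eqVlt; apply/orP; left; apply/eqP.
  by field; rewrite gt_eqF.
have n3 : sqn mu Ia (fun x => g1 x + g2 x) <= K' * b.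
  apply: (le_trans (sqnD_le Lg1 Lg2)).
  have -> : K' * b = 2 * (sqn mu Ia (ell y0) * b) + 2 * ((6 * N + 11 * M) ^+ 2 * b).
    by rewrite /K' mulrDl !mulrA.
  by apply: lerD; apply: ler_wpM2l.
have n4 : sqn mu Ia phi <= normc (I0^-1) ^+ 2 * (b ^- 2 * I1).
  by rewrite S; apply: ler_wpM2l; [exact: sqr_ge0|exact: ckn].
rewrite -normcJ key; apply: (le_trans (L2_Cauchy_Schwarz mI Lg (L Dp))).
have p1 : 0 <= sqn mu Ia (fun x => g1 x + g2 x) by exact: sqn_ge0 Lg.
have p2 : 0 <= sqn mu Ia phi by exact: sqn_ge0 (L Dp).
have n5 := ler_pM p1 p2 n3 n4; apply: (le_trans n5).
move: (normc _ ^+ 2) (K') (I1) b0 => c k i b0; rewrite le_eqVlt; apply/orP; left; apply/eqP.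
by field; rewrite gt_eqF.
Qed.

End spectral.

(** * The Stieltjes transform of sigma on the negative axis *)

Section stieltjes_transform.
Context {R : realType} (sigma : distr_fun R).
Implicit Types (b t : R) (z : R[i]).
Local Notation J := (`[0, +oo[%classic : set R).
Let m := distr_measure sigma.
Let mJ := @measurable_Ia R 0.

Hypothesis inf1 : (\int[m]_(t in J) 1 = +oo)%E.
Hypothesis int1 : (\int[m]_(t in J) ((1 + t)^-1)%:E < +oo)%E.

Definition stieltjes b : R := Rintegral m J (fun t => (t + b)^-1).

Lemma neg_not_ge0 b : 0 < b -> ~~ ((0 : R[i]) <= (- b)%:C).
Proof. by move=> b0; rewrite ler0c oppr_ge0 -ltNge. Qed.

Lemma cauchy_kernelR b t : cauchy_kernel (- b)%:C t = ((t + b)^-1)%:C.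
Proof. by rewrite fmorphV/= rmorphD/= /cauchy_kernel rmorphN/= opprK. Qed.

Let int_rint b : 0 < b -> rint m J (fun t => (t + b)^-1).
Proof.
move=> b0; have [+ _] := cauchy_kernel_cint int1 (neg_not_ge0 b0).
by apply: eq_integrable => // t _; rewrite /comp cauchy_kernelR.
Qed.

Lemma cintegral_cauchy_kernel b : 0 < b -> cintegral m J (cauchy_kernel (- b)%:C) = (stieltjes b)%:C.
Proof.
move=> b0; have -> : cauchy_kernel (- b)%:C = fun t => ((t + b)^-1)%:C by apply/funext => t; exact: cauchy_kernelR.
rewrite /cintegral /stieltjes; apply: complexP; first by [].
by rewrite [LHS]/= /Rintegral integral0.
Qed.

(** Squares appear because [weyl_asymptotic] concerns z = -b^2; the majorant is 1 / (t + 1). *)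
Lemma stieltjes_cvg0 : (stieltjes (n.+1%:R ^+ 2) @[n --> \oo] --> 0)%classic.
Proof.
have b0 n : 0 < (n.+1%:R : R) ^+ 2 by rewrite exprn_gt0.
have b1 n : 1 <= (n.+1%:R : R) ^+ 2 by rewrite expr_ge1// ler1n.
have h : (\int[m]_(t in J) ((t + n.+1%:R ^+ 2)^-1)%:E)%E @[n --> \oo] --> (\int[m]_(t in J) 0)%E.
  apply: (@dominated_cvg _ _ _ m J mJ (fun n t => ((t + n.+1%:R ^+ 2)^-1)%:E) _ (fun t => ((t + 1)^-1)%:E)).
  - by move=> n; exact: measurable_int (int_rint (b0 n)).
  - move=> t; rewrite /= in_itv/= andbT => t0.
    apply: cvg_EFin; first by apply: nearW.
    apply/cvgrPdist_lt => e e0; near=> n; rewrite sub0r normrN.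
    have tb : 0 < t + n.+1%:R ^+ 2 by rewrite ltr_wpDl.
    rewrite gtr0_norm ?invr_gt0// invf_plt ?posrE//.
    rewrite (@lt_le_trans _ _ n.+1%:R)//; last first.
      by rewrite (@le_trans _ _ (n.+1%:R ^+ 2)) ?lerDr// expr2 ler_peMr// ler1n.
    rewrite (@lt_trans _ _ n%:R) ?ltr_nat//; near: n; exact: nbhs_infty_gtr.
  - by [].
  - exact: int_rint.
  - move=> n t; rewrite /= in_itv/= andbT => t0; rewrite lee_fin.
    have tb : 0 < t + n.+1%:R ^+ 2 by rewrite ltr_wpDl.
    by rewrite gtr0_norm ?invr_gt0// lef_pV2 ?posrE ?lerD2l// ltr_wpDl.
by rewrite integral0 in h; exact: fine_cvg h.
Unshelve. all: by end_near. Qed.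

(** The difference of the integrands is positive, so equality would make the measure zero, against
    its infinite mass. *)
Lemma stieltjes_dec b b' : 0 < b -> b < b' -> stieltjes b' < stieltjes b.
Proof.
move=> b0 bb'; have b'0 := lt_trans b0 bb'.
have i1 := int_rint b0; have i2 := int_rint b'0; have i3 := rintB mJ i1 i2.
have fpos t : J t -> 0 < (t + b)^-1 - (t + b')^-1.
  rewrite /= in_itv/= andbT => t0; have p1 := ltr_wpDl t0 b0; have p2 := ltr_wpDl t0 b'0.
  by rewrite subr_gt0 ltf_pV2 ?posrE// ltrD2l.
rewrite -subr_gt0 -RintegralB// lt_neqAle; apply/andP; split; last first.
  by apply: Rintegral_ge0 => t /fpos/ltW.
apply/eqP => h.
have h' : (\int[m]_(t in J) `|((t + b)^-1 - (t + b')^-1)%:E| = 0)%E.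
  have -> : (\int[m]_(t in J) `|((t + b)^-1 - (t + b')^-1)%:E|
     = \int[m]_(t in J) ((t + b)^-1 - (t + b')^-1)%:E)%E.
    by apply: eq_integral => t; rewrite inE => /fpos/ltW h1; rewrite gee0_abs// lee_fin.
  by rewrite -[LHS]fineK; [move: h; rewrite /Rintegral => <-|exact: integrable_fin_num i3].
have [/(_ h') f0 _] := ae_eq_integral_abs m mJ (measurable_int _ i3).
have e0 : ae_eq m J (cst (1%E : \bar R)) (cst (0%E : \bar R)).
  apply: filterS f0 => t h1 Dt; have := fpos t Dt; have := h1 Dt.
  by rewrite /= => -[->]; rewrite ltxx.
have := ae_eq_integral _ _ mJ (measurable_cst _) (measurable_cst _) e0.
by rewrite integral0 inf1.
Qed.

End stieltjes_transform.

(** * The value of the Weyl solution at a *)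

Section weyl.
Context {R : realType} (a : R) (q : R -> R) (theta : R) (sigma : distr_fun R).
Implicit Types (u v y f g phi : R -> R[i]) (x t b : R) (z : R[i]).
Local Notation Ia := (`[a, +oo[%classic : set R).
Local Notation J := (`[0, +oo[%classic : set R).
Local Notation mu := (@lebesgue_measure R).
Local Notation ell := (ell a q).
Local Notation cderiv := (cderiv a).
Local Notation Dstar := (Dstar a q).
Local Notation Dtheta := (Dtheta a q theta).
Let m := distr_measure sigma.

Hypothesis q_loc : locally_summable a q.
Hypothesis B_def : deficiency_indices_11 mu Ia (B_op a q).
Hypothesis Bt_sa : selfadjoint_op mu Ia (T_op a q theta%:C).
Hypothesis int1 : (\int[m]_(t in J) ((1 + t)^-1)%:E < +oo)%E.
Hypothesis pair : pair_distribution a sigma (T_op a q theta%:C) (B_op a q).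

Lemma pair_resolvent z f : ~~ (0 <= z) -> L2a a f ->
  exists2 w, Dtheta w & aeqa a (ell w) (fun x => z * w x + f x).
Proof.
move=> nz Lf; have [U [U1 U2 U3 U4 U5]] := pair.
by have [w [Dw e _]] := resolvent U1 U2 U3 U4 U5 nz Lf; exists w.
Qed.

Lemma pair_weyl_ex z : ~~ (0 <= z) -> exists phi, is_weyl a q theta z phi.
Proof.
move=> nz; have [U [U1 U2 U3 U4 U5]] := pair.
exact: (weyl_ex q_loc B_def Bt_sa U1 U2 U3 U4 U5 nz).
Qed.

Lemma pair_weyl_uniq z y phi : ~~ (0 <= z) -> is_weyl a q theta z phi -> Dstar y ->
  aeqa a (ell y) (fun x => z * y x) ->
  forall x, a <= x -> y x = (cderiv y a - theta%:C * y a) * phi x.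
Proof.
have [U [U1 U2 U3 U4 U5]] := pair; exact: (weyl_uniq q_loc U1 U2 U3 U5).
Qed.

(** The constant s is |I0|^2, where I0 is the ratio of the integral of U y to y(a) on D(B_theta). *)
Lemma weyl_formula : exists2 s : R, 0 < s & forall z phi, ~~ (0 <= z) -> is_weyl a q theta z phi ->
  phi a = - (s^-1)%:C * cintegral m J (cauchy_kernel z).
Proof.
have [U [U1 U2 U3 U4 U5]] := pair.
have [I0 I00 II] := U_integral_ex q_loc B_def Bt_sa int1 U1 U2 U5.
have [K K0 HK] := weyl_asymptotic q_loc B_def Bt_sa int1 U1 U2 U3 U4 U5 I00 II.
have HD := weyl_diff q_loc B_def Bt_sa int1 U1 U2 U3 U4 U5 I00 II.
have c0 : 0 < normc (I0^-1) ^+ 2 by rewrite exprn_gt0//; apply: normc_gt0; rewrite invr_eq0.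
move: (normc (I0^-1) ^+ 2) c0 HD => c c0 HD.
exists c^-1; rewrite ?invr_gt0// => z phi nz hp; rewrite invrK.
(* By [weyl_diff] the value k is the same at every z; along z = -(n + 1)^2 both of its terms tend to
   0. *)
pose k := phi a + c%:C * cintegral m J (cauchy_kernel z).
suff : normc k = 0 by move/eq0_normc/eqP; rewrite addr_eq0 mulNr => /eqP.
apply/eqP; apply/negPn/negP => k0.
have kp : 0 < normc k by rewrite lt_neqAle normc_ge0 eq_sym k0.
have n0 n : 0 < (n.+1%:R : R) ^+ 2 by rewrite exprn_gt0.
have kE n : exists2 psi, normc (psi a) ^+ 2 <= K / n.+1%:R & k = psi a + (c * stieltjes sigma (n.+1%:R ^+ 2))%:C.
  have nzn := neg_not_ge0 (n0 n); have [psi hpsi] := pair_weyl_ex nzn; exists psi.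
    by apply: HK hpsi; rewrite ler1n.
  have := HD _ _ _ _ nz nzn hp hpsi; rewrite cintegral_cauchy_kernel// => h.
  by rewrite /k -[phi a](subrK (psi a)) h rmorphM/=; ring.
have e0 : 0 < normc k / 2 by rewrite divr_gt0.
have h1 : \forall n \near \oo, `|0 - stieltjes sigma (n.+1%:R ^+ 2)| < normc k / 2 / c.
  by apply: cvgr_dist_lt; [exact: stieltjes_cvg0|rewrite divr_gt0].
have h2 : \forall n \near \oo, (K / (normc k / 2) ^+ 2 : R) < n%:R by exact: nbhs_infty_gtr.
have [n [/= h3 h4]] := filter_ex (filterI h1 h2).
have [psi p1 p2] := kE n.
have q1 : normc (psi a) < normc k / 2.
  rewrite -ltr_sqr ?nnegrE ?normc_ge0 ?(ltW e0)//; apply: (le_lt_trans p1).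
  rewrite ltr_pdivrMr// mulrC -ltr_pdivrMr ?exprn_gt0//; apply: (lt_trans h4).
  by rewrite ltr_nat.
have q2 : normc (c * stieltjes sigma (n.+1%:R ^+ 2))%:C < normc k / 2.
  by rewrite normcR normrM (gtr0_norm c0) mulrC -ltr_pdivlMr//; move: h3; rewrite sub0r normrN.
have := le_normcD (psi a) (c * stieltjes sigma (n.+1%:R ^+ 2))%:C; rewrite -p2 => q3.
by have := le_lt_trans q3 (ltrD q1 q2); rewrite -splitr ltxx.
Qed.

End weyl.

(** * The adjoint of B and star-extensions *)
Section adjoint_B.
Context {R : realType} (a : R) (q : R -> R) (theta : R) (sigma : distr_fun R).
Implicit Types (u v w y f g phi : R -> R[i]) (x t b : R) (z : R[i]).
Local Notation Ia := (`[a, +oo[%classic : set R).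
Local Notation mu := (@lebesgue_measure R).
Local Notation ell := (ell a q).
Local Notation cderiv := (cderiv a).
Local Notation Dstar := (Dstar a q).
Local Notation Dtheta := (Dtheta a q theta).
Local Notation D0 := (D0 a q).
Local Notation dot := (dota a).
Let mI := @measurable_Ia R a.

Hypothesis q_loc : locally_summable a q.
Hypothesis B_def : deficiency_indices_11 mu Ia (B_op a q).
Hypothesis Bt_sa : selfadjoint_op mu Ia (T_op a q theta%:C).
Hypothesis pair : pair_distribution a sigma (T_op a q theta%:C) (B_op a q).

Let L := @Dstar_L2 _ a q.
Let E := @Dstar_L2ell _ a q.
Let G := @green _ a q theta q_loc B_def Bt_sa.

Lemma ell_ext y w : (forall x, a <= x -> y x = w x) -> forall x, a <= x -> ell y x = ell w x.
Proof.
move=> yw x ax; have e : cderiv (cderiv y) x = cderiv (cderiv w) x.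
  by apply: cderiv_ext => // t at_; exact: cderiv_ext.
by rewrite /Defs.ell e (yw x ax).
Qed.

Lemma Dstar_ae_ext y w : Dstar y -> Dstar w -> aeqa a y w ->
  [/\ y a = w a, cderiv y a = cderiv w a & forall x, a <= x -> ell y x = ell w x].
Proof.
move=> Dy Dw yw; have h := Dstar_ae_eq Dy Dw yw.
by split; [exact: h|exact: cderiv_ext|exact: ell_ext].
Qed.

Lemma i_not_ge0 : ~~ ((0 : R[i]) <= 'i).
Proof. by rewrite lecE/= oner_eq0. Qed.

Lemma schr_opP (bc : R[i] -> R[i] -> Prop) f g : schr_op a q bc (f, g) ->
  exists y, [/\ Dstar y, bc (y a) (cderiv y a), aeqa a f y, aeqa a g (ell y) & L2a a f /\ L2a a g].
Proof. by case=> /= Lf Lg [y [Dy h1 h2 h3]]; exists y. Qed.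

Lemma schr_op_intro (bc : R[i] -> R[i] -> Prop) y f g : Dstar y -> bc (y a) (cderiv y a) ->
  L2a a f -> L2a a g -> aeqa a f y -> aeqa a g (ell y) -> schr_op a q bc (f, g).
Proof. by move=> Dy h Lf Lg h1 h2; split => //; exists y. Qed.

Lemma aeqa_sym f g : aeqa a f g -> aeqa a g f.
Proof. by apply: ae_lebesgueS => x h Dx; rewrite h. Qed.

Lemma aeqa_trans f g w : aeqa a f g -> aeqa a g w -> aeqa a f w.
Proof. by apply: ae_lebesgueS2 => x h1 h2 Dx; rewrite h1// h2. Qed.

Lemma D0_green y w : D0 y -> Dstar w -> dot (ell y) w = dot y (ell w).
Proof.
case=> Dy y0 y1 Dw; have := G Dy Dw; rewrite y0 y1 !mul0r subrr.
by move/eqP; rewrite subr_eq0 => /eqP.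
Qed.

Lemma adjoint_B_intro w : Dstar w -> adjoint mu Ia (B_op a q) (w, ell w).
Proof.
move=> Dw; split; [exact: L|exact: E|] => f g /schr_opP[y [Dy [y0 y1] fy gy [Lf Lg]]] /=.
have e1 := dot_aeql Lg (E Dy) (L Dw) gy; have e2 := dot_aeql Lf (L Dy) (E Dw) fy.
by move: e1 e2; rewrite /dota => -> ->; exact: D0_green.
Qed.

Lemma adjoint_aeq (T : graph R) u v u' v' : (forall f g, T (f, g) -> L2a a f /\ L2a a g) ->
  adjoint mu Ia T (u, v) -> L2a a u' -> L2a a v' -> aeqa a u u' -> aeqa a v v' ->
  adjoint mu Ia T (u', v').
Proof.
move=> TL [/= Lu Lv H] Lu' Lv' uu vv; split => //= f g Tfg; have [Lf Lg] := TL _ _ Tfg.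
have e1 := dot_aeqr Lu Lu' Lg uu; have e2 := dot_aeqr Lv Lv' Lf vv.
by move: e1 e2 (H _ _ Tfg); rewrite /dota => -> ->.
Qed.

(** The resolvent gives w in D(B_theta) with (ell - i) w = v - i u, and u - w is then a deficiency
    vector of B at i. That space is one-dimensional and contains the Weyl solution, so u - w is a
    multiple of it. *)
Lemma adjoint_B u v : adjoint mu Ia (B_op a q) (u, v) ->
  exists y, [/\ Dstar y, aeqa a u y & aeqa a v (ell y)].
Proof.
move=> [/= Lu Lv H]; have Lf := L2B mI Lv (L2Z mI 'i Lu).
have [w [Dw _] elw] := pair_resolvent pair i_not_ge0 Lf.
have Luw := L2B mI Lu (L Dw).
have def : deficiency_space mu Ia (B_op a q) 'i (fun x => u x - w x).
  split; [exact: Luw|exact: (L2Z mI)|] => f g Bfg /=.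
  have [_ _ Hw] := adjoint_B_intro Dw; have {}Hw := Hw _ _ Bfg; have {}H := H _ _ Bfg.
  have [_ [_ _ _ _ [Lf' Lg]]] := schr_opP Bfg.
  have LR := L2_lin mI 'i (L Dw) Lf.
  rewrite (dotBr mI Lu (L Dw) Lg) H Hw /=.
  have := dot_aeqr (E Dw) LR Lf' elw; rewrite /dota => ->.
  rewrite (dot_linr mI _ (L Dw) Lf Lf') (dotBr mI Lv (L2Z mI 'i Lu) Lf').
  rewrite (dotZr mI _ Luw Lf') (dotBr mI Lu (L Dw) Lf') (dotZr mI _ Lu Lf').
  by ring.
have [phi [Dp ep dp]] := pair_weyl_ex q_loc B_def Bt_sa pair i_not_ge0.
have LZp := L2Z mI 'i (L Dp).
have defp : deficiency_space mu Ia (B_op a q) 'i phi.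
  apply: (adjoint_aeq _ (adjoint_B_intro Dp) (L Dp) LZp (aeqa_refl _ _) ep).
  by move=> f g /schr_opP[y []].
have [[u0 _ Hu0] _] := B_def.
have [c uw] := Hu0 _ def; have [c' pu] := Hu0 _ defp.
(* The Weyl solution is not null, as phi'(a) - theta phi(a) = 1. *)
have c'0 : c' != 0.
  apply/eqP => c0; have p0 : aeqa a phi (fun=> 0).
    by apply: ae_lebesgueS pu => x h Dx; rewrite (h Dx) c0 mul0r.
  have [D1 h1 _] := Dstar_lin0 (-1) q_loc Dp Dp.
  have p1 : aeqa a phi (fun x => -1 * phi x + phi x).
    by apply: ae_lebesgueS p0 => x h Dx; rewrite h// mulr0 addr0.
  have [e1 e2 _] := Dstar_ae_ext Dp D1 p1.
  move: dp; rewrite e2 h1 mulN1r addNr e1 mulN1r addNr mulr0 addr0 => /esym/eqP.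
  by rewrite oner_eq0.
have [D1 h1 h2] := Dstar_lin0 (c / c') q_loc Dp Dw.
have uy : aeqa a u (fun x => c / c' * phi x + w x).
  apply: ae_lebesgueS2 uw pu => x k1 k2 Dx; rewrite -[u x](subrK (w x)) (k1 Dx) (k2 Dx) mulrA divfK//.
exists (fun x => c / c' * phi x + w x); split => //.
have e1 : aeqa a (ell (fun x => c / c' * phi x + w x)) (fun x => c / c' * ('i * phi x) + ell w x).
  by apply: ae_lebesgueS2 h2 ep => x k1 k2 Dx; rewrite (k1 Dx) (k2 Dx).
apply: aeqa_trans (aeqa_sym e1).
have elw' : aeqa a (ell w) (fun x => 'i * w x + (v x - 'i * u x)) by exact: elw.
by apply: ae_lebesgueS2 elw' uy => x k1 k2 Dx; rewrite (k1 Dx) (k2 Dx); ring.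
Qed.

(** Orthogonality to D(B) alone does not involve [ell]: paired with 0, g becomes a value of the
    adjoint of B, which acts as [ell], so g = ell 0. *)
Lemma D0_dense g : L2a a g -> (forall y, D0 y -> dot y g = 0) -> aeqa a g (fun=> 0).
Proof.
move=> Lg H; have L0 := L20 mu mI.
have [y [Dy y0 gy]] : exists y, [/\ Dstar y, aeqa a (fun=> 0) y & aeqa a g (ell y)].
  apply: adjoint_B; split => //= f k /schr_opP[y [Dy [y0 y1] fy ky [Lf Lk]]].
  have e1 := dot_aeql Lf (L Dy) Lg fy; move: e1; rewrite /dota => ->.
  have := H y (And3 Dy y0 y1); rewrite /dota => ->.
  by rewrite (dotC mI L0 Lk) (dot0l mu mI)//; exact: conjc0.
have [D1 _ h2] := Dstar_lin0 (-1) q_loc Dy Dy.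
have p1 : aeqa a y (fun x => -1 * y x + y x).
  by apply: ae_lebesgueS y0 => x h Dx; rewrite -h// mulr0 addr0.
have [_ _ e3] := Dstar_ae_ext Dy D1 p1.
apply: ae_lebesgueS2 gy h2 => x k1 k2 Dx; rewrite (k1 Dx) e3 ?(k2 Dx); first by ring.
by move: Dx; rewrite /= in_itv/= andbT.
Qed.

End adjoint_B.

(** * Boundary functionals and rank-one boundary perturbations *)

Section boundary_forms.
Context {R : realType} (a : R) (q : R -> R) (theta : R) (sigma : distr_fun R).
Implicit Types (u v w y f g phi : R -> R[i]) (x t b : R) (z h k : R[i]).
Local Notation Ia := (`[a, +oo[%classic : set R).
Local Notation mu := (@lebesgue_measure R).
Local Notation ell := (ell a q).
Local Notation cderiv := (cderiv a).
Local Notation Dstar := (Dstar a q).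
Local Notation Dtheta := (Dtheta a q theta).
Local Notation D0 := (D0 a q).
Local Notation dot := (dota a).
Local Notation normplus := (normplus a q).
Let mI := @measurable_Ia R a.

Hypothesis q_loc : locally_summable a q.
Hypothesis B_def : deficiency_indices_11 mu Ia (B_op a q).
Hypothesis Bt_sa : selfadjoint_op mu Ia (T_op a q theta%:C).
Hypothesis pair : pair_distribution a sigma (T_op a q theta%:C) (B_op a q).

Let L := @Dstar_L2 _ a q.
Let E := @Dstar_L2ell _ a q.
Let G := @green _ a q theta q_loc B_def Bt_sa.
Let lin k y w (Dy : Dstar y) (Dw : Dstar w) := Dstar_lin0 k q_loc Dy Dw.
Let dense := @D0_dense _ a q theta sigma q_loc B_def Bt_sa pair.

Lemma normplusE y : Dstar y -> normplus y = Num.sqrt (sqn mu Ia y + sqn mu Ia (ell y)).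
Proof. by []. Qed.

Lemma normplus_ge0 y : 0 <= normplus y. Proof. exact: sqrtr_ge0. Qed.

Lemma sqn_le_normplus y : Dstar y -> Num.sqrt (sqn mu Ia y) <= normplus y.
Proof.
move=> Dy; rewrite (normplusE Dy); apply: ler_wsqrtr.
by rewrite lerDl; exact: sqn_ge0 (E Dy).
Qed.

Lemma sqn_ell_le_normplus y : Dstar y -> Num.sqrt (sqn mu Ia (ell y)) <= normplus y.
Proof.
move=> Dy; rewrite (normplusE Dy); apply: ler_wsqrtr.
by rewrite lerDr; exact: sqn_ge0 (L Dy).
Qed.

Lemma normc_dot f g : L2a a f -> L2a a g ->
  normc (dot f g) <= Num.sqrt (sqn mu Ia f) * Num.sqrt (sqn mu Ia g).
Proof.
move=> Lf Lg; have h := L2_Cauchy_Schwarz mI Lf Lg.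
have s0 : 0 <= sqn mu Ia f by exact: sqn_ge0 Lf.
rewrite -(sqrtrM _ s0) -[leLHS]ger0_norm ?normc_ge0// -sqrtr_sqr.
exact: ler_wsqrtr.
Qed.

(** Green's identity against fixed functions with boundary values (0, 1) and (1, 0) expresses y(a)
    and y'(a) by scalar products controlled by the norm of H_+. *)
Lemma trace_bound : exists2 C : R, 0 <= C & forall y, Dstar y ->
  normc (y a) <= C * normplus y /\ normc (cderiv y a) <= C * normplus y.
Proof.
have [w1 [D1 w10 w11]] := Dstar_boundary_ex q_loc B_def Bt_sa 0 1.
have [w2 [D2 w20 w21]] := Dstar_boundary_ex q_loc B_def Bt_sa 1 0.
have key y w : Dstar y -> Dstar w -> normc (cderiv y a * (w a)^* - y a * (cderiv w a)^*)
    <= 2 * normplus w * normplus y.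
  move=> Dy Dw; rewrite -(G Dy Dw); apply: (le_trans (le_normcD _ _)); rewrite normcN.
  have h1 := le_trans (normc_dot (E Dy) (L Dw))
    (ler_pM (sqrtr_ge0 _) (sqrtr_ge0 _) (sqn_ell_le_normplus Dy) (sqn_le_normplus Dw)).
  have h2 := le_trans (normc_dot (L Dy) (E Dw))
    (ler_pM (sqrtr_ge0 _) (sqrtr_ge0 _) (sqn_le_normplus Dy) (sqn_ell_le_normplus Dw)).
  apply: (le_trans (lerD h1 h2)); rewrite le_eqVlt; apply/orP; left; apply/eqP; ring.
exists (2 * normplus w1 + 2 * normplus w2).
  by rewrite addr_ge0// mulr_ge0// normplus_ge0.
move=> y Dy; have n1 := normplus_ge0 y.
have p1 := normplus_ge0 w1; have p2 := normplus_ge0 w2.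
split.
  have := key y w1 Dy D1; rewrite w10 w11 conjc0 conj1c mulr0 mulr1 sub0r normcN => h.
  by apply: (le_trans h); rewrite ler_wpM2r// lerDl mulr_ge0.
have := key y w2 Dy D2; rewrite w20 w21 conjc0 conj1c mulr0 mulr1 subr0 => h.
by apply: (le_trans h); rewrite ler_wpM2r// lerDr mulr_ge0.
Qed.

Definition bform (c0 c1 : R[i]) y : R[i] := c0 * y a + c1 * cderiv y a.

Lemma bform_lin c0 c1 k y w : Dstar y -> Dstar w ->
  bform c0 c1 (fun x => k * y x + w x) = k * bform c0 c1 y + bform c0 c1 w.
Proof. by move=> Dy Dw; have [_ h _] := lin k Dy Dw; rewrite /bform h; ring. Qed.

Lemma bform_bound c0 c1 : exists2 C : R, 0 <= C & forall y, Dstar y -> normc (bform c0 c1 y) <= C * normplus y.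
Proof.
have [C C0 H] := trace_bound; exists ((normc c0 + normc c1) * C).
  by rewrite mulr_ge0// addr_ge0 ?normc_ge0.
move=> y Dy; have [h1 h2] := H y Dy; apply: (le_trans (le_normcD _ _)).
by rewrite !normcM -mulrA mulrDl lerD// ler_wpM2l ?normc_ge0.
Qed.

Lemma bform_ex c0 c1 : (c0, c1) != (0, 0) -> exists2 y, Dstar y & bform c0 c1 y != 0.
Proof.
rewrite xpair_eqE negb_and => /orP[h|h].
  have [y [Dy y0 y1]] := Dstar_boundary_ex q_loc B_def Bt_sa 1 0.
  by exists y => //; rewrite /bform y0 y1 mulr1 mulr0 addr0.
have [y [Dy y0 y1]] := Dstar_boundary_ex q_loc B_def Bt_sa 0 1.
by exists y => //; rewrite /bform y0 y1 mulr1 mulr0 add0r.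
Qed.

Lemma D0_bform c0 c1 y : D0 y -> bform c0 c1 y = 0.
Proof. by case=> _ h1 h2; rewrite /bform h1 h2 !mulr0 addr0. Qed.

Lemma in_Hminus_form f k c0 c1 (F : functional) : L2a a f ->
  (forall y, Dstar y -> F y = dot f y + k * (bform c0 c1 y)^*) -> in_Hminus a q F.
Proof.
move=> Lf HF; split.
  move=> c y w Dy Dw; have [D _ _] := lin c Dy Dw.
  rewrite !HF// bform_lin// /dota (dot_linr mI c (L Dy) (L Dw) Lf) conjcD conjcM.
  by ring.
have [C C0 HC] := bform_bound c0 c1; exists (Num.sqrt (sqn mu Ia f) + normc k * C) => y Dy.
rewrite HF//; apply: (le_trans (le_normcD _ _)); rewrite mulrDl; apply: lerD.
  apply: (le_trans (normc_dot Lf (L Dy))); apply: ler_wpM2l; first exact: sqrtr_ge0.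
  exact: sqn_le_normplus.
by rewrite normcM normcJ -mulrA; apply: ler_wpM2l; [exact: normc_ge0|exact: HC].
Qed.

(** [A_form] and the real part of A share this shape: the maximal operator plus a boundary term of
    rank one. *)
Definition form_op (p0 p1 r0 r1 : R[i]) y w : R[i] := dot (ell y) w + bform p0 p1 y * (bform r0 r1 w)^*.

Lemma form_op_bounded p0 p1 r0 r1 (A : pmop) :
  (forall y w, Dstar y -> Dstar w -> A y w = form_op p0 p1 r0 r1 y w) -> bounded_pm a q A.
Proof.
move=> HA; split.
- by move=> y Dy; apply: (in_Hminus_form (E Dy)) => w Dw; exact: HA.
- move=> k y w Dy Dw v Dv; have [D _ e] := lin k Dy Dw; rewrite !HA// /form_op bform_lin//.
  have LZ := L2_lin mI k (E Dy) (E Dw).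
  rewrite (dot_aeql (E D) LZ (L Dv) e) /dota (dot_linl mI k (E Dy) (E Dw) (L Dv)).
  by ring.
have [C C0 HC] := bform_bound p0 p1; have [C' C0' HC'] := bform_bound r0 r1.
exists (1 + C * C') => y w Dy Dw; rewrite HA//.
apply: (le_trans (le_normcD _ _)); rewrite normcM normcJ -mulrA mulrDl mul1r; apply: lerD.
  apply: (le_trans (normc_dot (E Dy) (L Dw))).
  by apply: ler_pM; rewrite ?sqrtr_ge0//; [exact: sqn_ell_le_normplus|exact: sqn_le_normplus].
rewrite mulrACA; apply: ler_pM; rewrite ?normc_ge0//; [exact: HC|exact: HC'].
Qed.

(** Tests in D(B), where boundary functionals vanish, isolate the equation in L_2 by density; one w
    outside the kernel of the second functional then gives the boundary equation. *)
Lemma form_kernel (A : pmop) p0 p1 r0 r1 z y f k : (forall w, Dstar w -> A y w = form_op p0 p1 r0 r1 y w) ->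
  (r0, r1) != (0, 0) -> Dstar y -> L2a a f ->
  (forall w, Dstar w -> A y w - z * dot y w = dot f w + k * (bform r0 r1 w)^*) ->
  aeqa a (ell y) (fun x => z * y x + f x) /\ bform p0 p1 y = k.
Proof.
move=> HA rn Dy Lf H; have LZ := L2_lin mI z (L Dy) Lf.
have e1 : aeqa a (ell y) (fun x => z * y x + f x).
  have LB := L2B mI (E Dy) LZ.
  have : aeqa a (fun x => ell y x - (z * y x + f x)) (fun=> 0).
    apply: dense => // w D0w; have [Dw _ _] := D0w; rewrite /dota (dotC mI LB (L Dw)).
    rewrite (dotBl mI (E Dy) LZ (L Dw)) (dot_linl mI z (L Dy) Lf (L Dw)).
    have := H w Dw; rewrite (HA w Dw) /form_op (D0_bform _ _ D0w) conjc0 !mulr0 !addr0.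
    rewrite /dota => /eqP; rewrite subr_eq addrC => /eqP ->; rewrite subrr; exact: conjc0.
  by apply: ae_lebesgueS => x h Dx; apply/eqP; rewrite -subr_eq0 (h Dx).
split => //; have [w Dw wn] := bform_ex rn.
have := H w Dw; rewrite (HA w Dw) /form_op (dot_aeql (E Dy) LZ (L Dw) e1) /dota.
rewrite (dot_linl mI z (L Dy) Lf (L Dw)) => h.
have wc : (bform r0 r1 w)^* != 0 by rewrite conjc_eq0.
apply: (mulIf wc); apply: (addrI (z * dotp mu Ia y w + dotp mu Ia f w)).
by rewrite -[RHS]addrA -h; ring.
Qed.

End boundary_forms.

(** [hb] stands for conj h, the y's and z's for boundary values of y and conjugate ones of z, and
    [e], [f] for (ell y, z) and (y, ell z). Green's identity removes [f], and the average of A and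
    its adjoint keeps the second factor m0 z0 - m1 z1. *)
Lemma re_form_identity (F : fieldType) (h hb m0 m1 y0 y1 z0 z1 e f : F) :
  2%:R != 0 :> F -> m0 - m1 * h != 0 -> m0 - m1 * hb != 0 -> e - f = y1 * z0 - y0 * z1 ->
  ((e - (m0 - m1 * h)^-1 * (y1 - h * y0) * (m0 * z0 - m1 * z1)) +
   (f - (m0 - m1 * hb)^-1 * (z1 - hb * z0) * (m0 * y0 - m1 * y1))) / 2%:R =
  e - ((m0 - m1 * h) * (m0 - m1 * hb))^-1 *
    ((m0 - m1 * ((h + hb) / 2%:R)) * y1 - (m0 * ((h + hb) / 2%:R) - m1 * (h * hb)) * y0) *
    (m0 * z0 - m1 * z1).
Proof.
move=> n2 nd ndb ef; have -> : f = e - (y1 * z0 - y0 * z1) by rewrite -ef; ring.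
by field; rewrite n2 nd ndb.
Qed.

Lemma im_form_identity (F : fieldType) (h hb m0 m1 y0 y1 z0 z1 e f : F) :
  m0 - m1 * h != 0 -> m0 - m1 * hb != 0 -> e - f = y1 * z0 - y0 * z1 ->
  (e - (m0 - m1 * h)^-1 * (y1 - h * y0) * (m0 * z0 - m1 * z1)) -
   (f - (m0 - m1 * hb)^-1 * (z1 - hb * z0) * (m0 * y0 - m1 * y1)) =
  (h - hb) * ((m0 - m1 * h) * (m0 - m1 * hb))^-1 * (m0 * y0 - m1 * y1) * (m0 * z0 - m1 * z1).
Proof.
move=> nd ndb ef; have -> : f = e - (y1 * z0 - y0 * z1) by rewrite -ef; ring.
by field; rewrite nd ndb.
Qed.

(** * Homogeneous coordinates for mu *)

Section projective_parameter.
Context {R : realType}.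
Implicit Types (mu : \bar R) (h : R[i]) (m : R).

(* mu is represented by the point [mu_num mu : mu_den mu] of the projective line. *)
Definition mu_num mu : R := if mu is EFin r then r else 1.
Definition mu_den mu : R := if mu is EFin r then 1 else 0.

Lemma mu_neq0 mu : (mu_num mu, mu_den mu) != (0, 0).
Proof. by case: mu => [r| |]; rewrite xpair_eqE /= oner_eq0 ?andbF. Qed.

Definition pden h m0 m1 : R[i] := m0%:C - m1%:C * h.
(** y in H_+ is mapped into H by Re A when re_den y'(a) = re_num y(a). For finite mu the ratio is
    (mu Re h - |h|^2) / (mu - Re h), whose denominator may vanish. *)
Definition re_num h m0 m1 : R := m0 * Re h - m1 * (Re h ^+ 2 + Im h ^+ 2).
Definition re_den h m0 m1 : R := m0 - m1 * Re h.
(** This is |pden|^2. In the present form its positivity shows that re_num = theta re_den forces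
    re_den to be nonzero. *)
Definition pnorm h m0 m1 : R := m0 * re_den h m0 m1 - m1 * re_num h m0 m1.

Lemma pdenJ h m0 m1 : (pden h m0 m1)^* = m0%:C - m1%:C * h^*.
Proof. by rewrite conjcB conjcM !conjc_real. Qed.

Lemma pden_neq0 h m0 m1 : Im h != 0 -> (m0, m1) != (0, 0) -> pden h m0 m1 != 0.
Proof.
move=> h0; rewrite xpair_eqE; apply: contra; rewrite eq_complex !ReImE/=.
rewrite !mul0r subr0 addr0 sub0r oppr_eq0 mulf_eq0 (negbTE h0) orbF.
by move=> /andP[+ /eqP m10]; rewrite m10 mul0r subr0 => ->; rewrite eqxx.
Qed.

Lemma pnormE h m0 m1 : pden h m0 m1 * (m0%:C - m1%:C * h^*) = (pnorm h m0 m1)%:C.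
Proof.
by apply: complexP; rewrite /pden /pnorm /re_den /re_num !ReImE/=; ring.
Qed.

Lemma pnorm_normc h m0 m1 : pnorm h m0 m1 = normc (pden h m0 m1) ^+ 2.
Proof.
by apply: complexI; rewrite -pnormE -pdenJ mul_conjc.
Qed.

Lemma pnorm_gt0 h m0 m1 : Im h != 0 -> (m0, m1) != (0, 0) -> 0 < pnorm h m0 m1.
Proof. by move=> h0 mn; rewrite pnorm_normc exprn_gt0// normc_gt0// pden_neq0. Qed.

Lemma real_complex_div (r s : R) : (r / s)%:C = r%:C * (s%:C)^-1 :> R[i].
Proof. by rewrite -fmorphV -rmorphM. Qed.

Lemma complexi_neq0 : ('i : R[i]) != 0.
Proof. by rewrite eq_complex/= oner_eq0 andbF. Qed.

Lemma half_add_conjc h : (h + h^*) / 2%:R = (Re h)%:C.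
Proof.
have n2 : (2%:R : R[i]) != 0 by rewrite pnatr_eq0.
apply: (mulIf n2); rewrite divfK//; apply: complexP; rewrite -(rmorph_nat (@real_complex R)) !ReImE/=; ring.
Qed.

Lemma mul_conjc_ReIm h : h * h^* = (Re h ^+ 2 + Im h ^+ 2)%:C.
Proof. by apply: complexP; rewrite !ReImE/=; ring. Qed.

Lemma sub_conjc h : h - h^* = (Im h)%:C * (2%:R * 'i).
Proof. by apply: complexP; rewrite -(rmorph_nat (@real_complex R)) !ReImE/=; ring. Qed.

End projective_parameter.

(** * The Livsic system attached to h and mu, and its transfer function *)

Section livsic_forms.
Context {R : realType} (a : R) (q : R -> R) (theta : R) (sigma : distr_fun R).
Implicit Types (u v w y f g phi : R -> R[i]) (x t b : R) (z k : R[i]).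
Local Notation Ia := (`[a, +oo[%classic : set R).
Local Notation mu := (@lebesgue_measure R).
Local Notation ell := (ell a q).
Local Notation cderiv := (cderiv a).
Local Notation Dstar := (Dstar a q).
Local Notation Dtheta := (Dtheta a q theta).
Local Notation D0 := (D0 a q).
Local Notation dot := (dota a).
Local Notation fop := (form_op a q).
Local Notation bdl := (bform a).
Let mI := @measurable_Ia R a.

Hypothesis q_loc : locally_summable a q.
Hypothesis B_def : deficiency_indices_11 mu Ia (B_op a q).
Hypothesis Bt_sa : selfadjoint_op mu Ia (T_op a q theta%:C).
Hypothesis pair : pair_distribution a sigma (T_op a q theta%:C) (B_op a q).

Let L := @Dstar_L2 _ a q.
Let E := @Dstar_L2ell _ a q.
Let G := @green _ a q theta q_loc B_def Bt_sa.
Let kernel := @form_kernel _ a q theta sigma q_loc B_def Bt_sa pair.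
Let bounded := @form_op_bounded _ a q theta q_loc B_def Bt_sa.

Variables (h : R[i]) (nu : \bar R).
Hypothesis h_gt0 : 0 < Im h.
Local Notation m0 := (mu_num nu).
Local Notation m1 := (mu_den nu).
Local Notation d := (pden h m0 m1).
Local Notation N := (pnorm h m0 m1).
Local Notation x0 := (re_num h m0 m1).
Local Notation x1 := (re_den h m0 m1).
Local Notation rho := (bdl m0%:C (- m1%:C)).

Let h_neq0 : Im h != 0. Proof. by rewrite gt_eqF. Qed.
Let d0 : d != 0. Proof. exact: pden_neq0 (mu_neq0 _). Qed.
Let d0J : m0%:C - m1%:C * h^* != 0. Proof. by rewrite -pdenJ conjc_eq0. Qed.
Let N0 : 0 < N. Proof. exact: pnorm_gt0 (mu_neq0 _). Qed.

Let mC : (m0%:C, - m1%:C) != (0 : R[i], 0 : R[i]).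
Proof.
apply: contra (mu_neq0 nu); rewrite !xpair_eqE oppr_eq0 => /andP[/eqP[->] /eqP[->]].
by rewrite eqxx.
Qed.

Lemma rhoJ w : (rho w)^* = m0%:C * (w a)^* - m1%:C * (cderiv w a)^*.
Proof. by rewrite /rho conjcD !conjcM conjcN !conjc_real mulNr. Qed.

Lemma A_formE y w : A_form a q h nu y w = fop (d^-1 * h) (- d^-1) m0%:C (- m1%:C) y w.
Proof.
have e0 : delta a w = (w a)^* by []; have e1 : delta' a w = - (cderiv w a)^* by [].
rewrite /form_op rhoJ /bform /pden /A_form e0 e1; case: nu => [r| |]; rewrite /mu_num /mu_den.
- by rewrite !mul1r; ring.
- by rewrite !mul0r !subr0 invr1; ring.
- by rewrite !mul0r !subr0 invr1; ring.
Qed.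

Definition livsic_gain : R := Num.sqrt (Im h) / normc d.

Lemma g_formE w : g_form a h nu w = livsic_gain%:C * (rho w)^*.
Proof.
have e0 : delta a w = (w a)^* by []; have e1 : delta' a w = - (cderiv w a)^* by [].
rewrite /livsic_gain rhoJ /pden /g_form e0 e1; case: nu => [r| |]; rewrite /mu_num /mu_den.
- by rewrite !mul1r.
- by rewrite !mul0r !subr0 normc1 divr1 mul1r.
- by rewrite !mul0r !subr0 normc1 divr1 mul1r.
Qed.

Lemma livsic_gain2 : livsic_gain ^+ 2 = Im h / N.
Proof. by rewrite /livsic_gain expr_div_n sqr_sqrtr ?(ltW h_gt0)// -pnorm_normc. Qed.

Variables (A : @pmop R) (K : @channel R).
Hypothesis HA : forall y, Dstar y -> eq_Hminus a q (A y) (A_form a q h nu y).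
Hypothesis HK : forall c, eq_Hminus a q (K c) (fun w => c * g_form a h nu w).

Let Aform y w : Dstar y -> Dstar w ->
  A y w = dot (ell y) w - (m0%:C - m1%:C * h)^-1 * (cderiv y a - h * y a) *
            (m0%:C * (w a)^* - m1%:C * (cderiv w a)^*).
Proof. by move=> Dy Dw; rewrite HA// A_formE /form_op rhoJ /bform /pden; ring. Qed.

Let AformJ y w : Dstar y -> Dstar w ->
  (A w y)^* = dot y (ell w) - (m0%:C - m1%:C * h^*)^-1 * ((cderiv w a)^* - h^* * (w a)^*) *
            (m0%:C * y a - m1%:C * cderiv y a).
Proof.
move=> Dy Dw; rewrite Aform// [dot y _](dotC mI (E Dw) (L Dy)) conjcB !conjcM -pdenJ -conjcV.
by rewrite !conjcB !conjcM !conjcK !conjc_real.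
Qed.

Let Re_form y w : Dstar y -> Dstar w ->
  Re_pm A y w = fop (x0 / N)%:C (- (x1 / N)%:C) m0%:C (- m1%:C) y w.
Proof.
move=> Dy Dw; rewrite /Re_pm /adj_pm AformJ// Aform// re_form_identity ?pnatr_eq0//; last exact: G.
have e0 : x0%:C = m0%:C * (Re h)%:C - m1%:C * (Re h ^+ 2 + Im h ^+ 2)%:C :> R[i].
  by rewrite /re_num; apply: complexP; rewrite !ReImE/=; ring.
have e1 : x1%:C = m0%:C - m1%:C * (Re h)%:C :> R[i].
  by rewrite /re_den; apply: complexP; rewrite !ReImE/=; ring.
by rewrite half_add_conjc mul_conjc_ReIm pnormE /form_op rhoJ /bform !real_complex_div e0 e1; ring.
Qed.

Let Im_form y w : Dstar y -> Dstar w ->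
  Im_pm A y w = (Im h / N)%:C * rho y * (rho w)^*.
Proof.
move=> Dy Dw; rewrite /Im_pm /adj_pm AformJ// Aform// im_form_identity//; last exact: G.
have n2 : (2%:R * 'i : R[i]) != 0 by rewrite mulf_neq0 ?pnatr_eq0 ?complexi_neq0.
rewrite sub_conjc pnormE rhoJ /bform real_complex_div.
by apply: (mulIf n2); rewrite divfK//; ring.
Qed.

(** The hypothesis identifies the boundary condition contained in Re A with that of B_theta, whose
    self-adjointness is given. *)
Lemma livsic_star_extension : re_num h m0 m1 = theta * re_den h m0 m1 -> star_extension a q A (T_op a q h).
Proof.
move=> x01; have x1n0 : x1 != 0.
  by move: N0; rewrite /pnorm x01; apply: contraTneq => ->; rewrite !mulr0 subrr ltxx.
have Bsub k : B_op a q `<=` T_op a q k.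
  move=> [f g] /schr_opP[y [Dy [y0 y1] fy gy [Lf Lg]]].
  by apply: (schr_op_intro Dy) => //; rewrite y0 y1 mulr0.
have bA : bounded_pm a q A.
  by apply: bounded => y w Dy Dw; rewrite HA// A_formE.
(* T_h extends B, so its adjoint acts as [ell]; testing with a w of boundary values (1, h) yields
   the condition with conj h. *)
have adjT u v : adjoint mu Ia (T_op a q h) (u, v) ->
    exists y, [/\ Dstar y, aeqa a u y, aeqa a v (ell y) & cderiv y a = h^* * y a].
  move=> H; have [y [Dy uy vy]] : exists y, [/\ Dstar y, aeqa a u y & aeqa a v (ell y)].
    apply: (adjoint_B q_loc B_def Bt_sa pair); case: H => Lu Lv H; split => // f g Bfg; exact: (H f g (Bsub h _ Bfg)).
  exists y; split => //; have [w [Dw w0 w1]] := Dstar_boundary_ex q_loc B_def Bt_sa 1 h.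
  have Tw : T_op a q h (w, ell w) by apply: schr_op_mem; rewrite // w0 w1 mulr1.
  have [_ _ H'] := adjoint_aeq (fun f g => fun T => let: ex_intro _ (And5 _ _ _ _ x) := schr_opP T in x) H (L Dy) (E Dy) uy vy.
  have := H' _ _ Tw => /= e; have := G Dw Dy; rewrite /dota e subrr w0 w1 mul1r => /esym/eqP.
  rewrite subr_eq0 => /eqP e2.
  by rewrite -[LHS]conjcK -e2 conjcM conjcK.
have Bre y w : Dstar y -> Dstar w -> y a = 0 -> cderiv y a = 0 -> Re_pm A y w = dot (ell y) w.
  by move=> Dy Dw y0 y1; rewrite Re_form// /form_op {1}/bform y0 y1 !mulr0 addr0 mul0r addr0.
split=> //.
- split; last exact: Bsub.
  move=> [f g] /schr_opP[y [Dy yh fy gy [Lf Lg]]]; split => //; exists y; split => // w Dw.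
  by rewrite Aform// yh subrr mulr0 mul0r subr0; apply: dot_aeql (E Dy) Lg (L Dw) (aeqa_sym gy).
- split.
    move=> [u v] H; have [y [Dy uy vy yh]] := adjT _ _ H; have [/= Lu Lv _] := H.
    split => //; exists y; split => // w Dw.
    rewrite /embed -/(dot v w) (dot_aeql Lv (E Dy) (L Dw) vy) /adj_pm AformJ//.
    have := G Dy Dw; rewrite yh => /eqP; rewrite subr_eq => /eqP ->.
    by field; exact: d0J.
  move=> [f g] /schr_opP[y [Dy [y0 y1] fy gy [Lf Lg]]]; split => //= u v /schr_opP[w [Dw _ uw vw [Lu Lv]]].
  have := G Dw Dy; rewrite y0 y1 conjc0 !mulr0 subrr => /eqP; rewrite subr_eq0 => /eqP e.
  have h1 := dot_aeq mI Lv (E Dw) Lf (L Dy) vw fy; have h2 := dot_aeq mI Lu (L Dw) Lg (E Dy) uw gy.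
  by rewrite h1 h2; exact: e.
- split; first exact: bounded Re_form.
    move=> [f g] /schr_opP[y [Dy [y0 y1] fy gy [Lf Lg]]]; split => //; exists y; split => // w Dw.
    by rewrite Bre//; apply: dot_aeql (E Dy) Lg (L Dw) (aeqa_sym gy).
  suff -> : restr_H a q (Re_pm A) = T_op a q theta%:C by exact: Bt_sa.
  have blth y : bdl (x0 / N)%:C (- (x1 / N)%:C) y = (- (x1 / N)%:C) * (cderiv y a - theta%:C * y a).
    by rewrite /bform x01 -mulrA rmorphM/=; ring.
  have k0 : - (x1 / N)%:C != 0 :> R[i].
    by rewrite oppr_eq0 (fmorph_eq0 (@real_complex R)) mulf_neq0// invr_eq0 gt_eqF.
  apply/seteqP; split=> -[f g].
    case=> /= Lf Lg [y [Dy fy Hy]].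
    have [e1 e2] : aeqa a (ell y) (fun x => 0 * y x + g x) /\ bdl (x0 / N)%:C (- (x1 / N)%:C) y = 0.
      apply: (kernel (fun w Dw => Re_form Dy Dw) mC Dy Lg) => w Dw.
      by rewrite !mul0r subr0 addr0; exact: Hy.
    apply: (schr_op_intro Dy) => //.
      by move: e2; rewrite blth => /eqP; rewrite mulf_eq0 (negbTE k0) subr_eq0 => /eqP.
    by apply: ae_lebesgueS e1 => x e Dx; rewrite (e Dx) mul0r add0r.
  move=> /schr_opP[y [Dy yh fy gy [Lf Lg]]]; split => //; exists y; split => // w Dw.
  rewrite Re_form// /form_op blth yh subrr mulr0 mul0r addr0.
  exact: dot_aeql (E Dy) Lg (L Dw) (aeqa_sym gy).
Qed.

Let KE c w : Dstar w -> K c w = c * livsic_gain%:C * (rho w)^*.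
Proof. by move=> Dw; rewrite HK// g_formE mulrA. Qed.

Let adjKE y : Dstar y -> adj_channel K y = livsic_gain%:C * rho y.
Proof. by move=> Dy; rewrite /adj_channel /pairing KE// mul1r conjcM conjcK conjc_real. Qed.

Lemma livsic_system_intro : re_num h m0 m1 = theta * re_den h m0 m1 -> livsic_system a q (T_op a q h) A K.
Proof.
move=> x01; split; first exact: livsic_star_extension.
  split=> [c|k c c' w Dw]; last by rewrite !KE//; ring.
  apply: (in_Hminus_form q_loc B_def Bt_sa (L20 mu mI)) => w Dw.
  by rewrite /dota (dot0l mu mI) add0r; exact: KE.
move=> y Dy w Dw; rewrite Im_form// KE// adjKE// -livsic_gain2 expr2 rmorphM/=.
by ring.
Qed.

Lemma g_form_Hminus : in_Hminus a q (g_form a h nu).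
Proof.
apply: (in_Hminus_form q_loc B_def Bt_sa (L20 mu mI)) => w Dw.
by rewrite /dota (dot0l mu mI) add0r; exact: g_formE.
Qed.

Let transfer_kernel z y : Dstar y -> forall c, eq_Hminus a q (shifted a (Re_pm A) z y) (K c) ->
  aeqa a (ell y) (fun x => z * y x) /\ bdl (x0 / N)%:C (- (x1 / N)%:C) y = c * livsic_gain%:C.
Proof.
move=> Dy c H; have [e1 e2] : aeqa a (ell y) (fun x => z * y x + 0) /\
    bdl (x0 / N)%:C (- (x1 / N)%:C) y = c * livsic_gain%:C.
  apply: (kernel (fun w Dw => Re_form Dy Dw) mC Dy (L20 mu mI)) => w Dw.
  by rewrite {2}/dota (dot0l mu mI) add0r -KE//; exact: H.
by split => //; apply: ae_lebesgueS e1 => x e Dx; rewrite (e Dx) addr0.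
Qed.

Let gainN : livsic_gain%:C * livsic_gain%:C * N%:C = (Im h)%:C :> R[i].
Proof. by rewrite -!rmorphM/= -expr2 livsic_gain2 divfK// gt_eqF. Qed.

(** The preimage of K 1 is c phi by [pair_weyl_uniq], and c is eliminated through the boundary
    equation. No relation between h, mu and theta is presupposed: the uniqueness argument must
    extract re_num = theta re_den from this identity. *)
Lemma transfer_eq z V0 phi : ~~ (0 <= z) -> is_weyl a q theta z phi -> transfer_value a q A K z V0 ->
  V0 * (x1%:C + (theta * x1 - x0)%:C * phi a) = (Im h)%:C * (m1%:C - (m0 - theta * m1)%:C * phi a).
Proof.
move=> nz hp [_ [y [Dy Hy ->]]]; have [ey by_] := transfer_kernel Dy Hy.
have yphi := pair_weyl_uniq q_loc pair nz hp Dy ey (lexx a).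
rewrite adjKE//; move: yphi by_; set c := cderiv y a - _ => yphi by_.
have y1 : cderiv y a = c * (1 + theta%:C * phi a).
  by rewrite -[cderiv y a](subrK (theta%:C * y a)) -/c yphi; ring.
have Nc : (N%:C : R[i]) != 0 by rewrite (fmorph_eq0 (@real_complex R)) gt_eqF.
have by' : c * (x0%:C * phi a - x1%:C * (1 + theta%:C * phi a)) = livsic_gain%:C * N%:C.
  rewrite -[livsic_gain%:C]mul1r -by_ /bform !real_complex_div yphi y1; field; exact: Nc.
have e1 : (theta * x1 - x0)%:C = theta%:C * x1%:C - x0%:C :> R[i] by rewrite rmorphB rmorphM.
have e2 : (m0 - theta * m1)%:C = m0%:C - theta%:C * m1%:C :> R[i] by rewrite rmorphB rmorphM.
rewrite -gainN /bform yphi y1 e1 e2.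
transitivity (livsic_gain%:C * (m0%:C * phi a - m1%:C * (1 + theta%:C * phi a)) *
  - (c * (x0%:C * phi a - x1%:C * (1 + theta%:C * phi a)))); first by ring.
by rewrite by'; ring.
Qed.

Lemma transfer_ex z phi : re_num h m0 m1 = theta * re_den h m0 m1 ->
  ~~ (0 <= z) -> is_weyl a q theta z phi ->
  transfer_value a q A K z ((Im h / x1)%:C * (m1%:C - (m0 - theta * m1)%:C * phi a)).
Proof.
move=> x01 nz hp; have [Dp ep dp] := hp; have x1n0 : x1 != 0.
  by move: N0; rewrite /pnorm x01; apply: contraTneq => ->; rewrite !mulr0 subrr ltxx.
have blth y : bdl (x0 / N)%:C (- (x1 / N)%:C) y = (- (x1 / N)%:C) * (cderiv y a - theta%:C * y a).
  by rewrite /bform x01 -mulrA rmorphM/=; ring.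
have k0 : - (x1 / N)%:C != 0 :> R[i].
  by rewrite oppr_eq0 (fmorph_eq0 (@real_complex R)) mulf_neq0// invr_eq0 gt_eqF.
split.
  move=> y Dy Hy x ax; have [e1 e2] : aeqa a (ell y) (fun x => z * y x) /\
      bdl (x0 / N)%:C (- (x1 / N)%:C) y = 0 * livsic_gain%:C.
    by apply: transfer_kernel => // w Dw; rewrite Hy// KE// !mul0r.
  rewrite (pair_weyl_uniq q_loc pair nz hp Dy e1 ax); move: e2; rewrite blth mul0r => /eqP.
  by rewrite mulf_eq0 (negbTE k0)/= => /eqP ->; rewrite mul0r.
(* c phi solves the L_2 equation for every c; this c satisfies the boundary part -(x1 / N) c = gain
   of (Re A - z) y = K 1. *)
pose c := livsic_gain%:C * (- (x1 / N)%:C)^-1.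
have [D1 h1 h2] := Dstar_lin0 (c - 1) q_loc Dp Dp.
pose y x := (c - 1) * phi x + phi x; have Dy : Dstar y by exact: D1.
have yE x : y x = c * phi x by rewrite /y; ring.
have y1 : cderiv y a - theta%:C * y a = c.
  by rewrite yE [cderiv y a]h1 dp; ring.
have ey : aeqa a (ell y) (fun x => z * y x).
  by apply: ae_lebesgueS2 h2 ep => x k1 k2 Dx; rewrite [ell y x](k1 Dx) (k2 Dx) yE; ring.
exists y; split => //.
  move=> w Dw; rewrite /shifted Re_form// /form_op blth y1 KE// mul1r.
  rewrite (dot_aeql (E Dy) (L2Z mI z (L Dy)) (L Dw) ey) /dota (dotZl mI z (L Dy) (L Dw)).
  by rewrite addrAC subrr add0r /c mulrCA divff// mulr1.
rewrite adjKE// /bform; have -> : cderiv y a = c * (1 + theta%:C * phi a).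
  by rewrite -[cderiv y a](subrK (theta%:C * y a)) y1 yE; ring.
have e2 : (m0 - theta * m1)%:C = m0%:C - theta%:C * m1%:C :> R[i] by rewrite rmorphB rmorphM.
rewrite yE /c (real_complex_div (Im h)) (real_complex_div x1 N) -gainN e2.
have n1 : (x1%:C : R[i]) != 0 by rewrite (fmorph_eq0 (@real_complex R)).
have n2 : (N%:C : R[i]) != 0 by rewrite (fmorph_eq0 (@real_complex R)) gt_eqF.
by field; rewrite n1 n2.
Qed.

End livsic_forms.

(** * The parameters h and mu *)
Section parameters.
Context {R : realType}.
Implicit Types (theta gamma s : R) (h : R[i]) (nu : \bar R).

Lemma quadratic_eq0 (c0 c1 c2 p1 p2 p3 : R) : p1 < p2 -> p2 < p3 ->
  c0 + c1 * p1 + c2 * p1 ^+ 2 = 0 -> c0 + c1 * p2 + c2 * p2 ^+ 2 = 0 ->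
  c0 + c1 * p3 + c2 * p3 ^+ 2 = 0 -> [/\ c0 = 0, c1 = 0 & c2 = 0].
Proof.
move=> p12 p23 e1 e2 e3.
have n12 : p2 - p1 != 0 by rewrite subr_eq0 gt_eqF.
have n23 : p3 - p2 != 0 by rewrite subr_eq0 gt_eqF.
have n13 : p3 - p1 != 0 by rewrite subr_eq0 gt_eqF// (lt_trans p12).
have h1 : c1 + c2 * (p1 + p2) = 0.
  by apply: (mulfI n12); rewrite mulr0 -[RHS](subrr 0) -{1}e2 -{1}e1; ring.
have h2 : c1 + c2 * (p2 + p3) = 0.
  by apply: (mulfI n23); rewrite mulr0 -[RHS](subrr 0) -{1}e3 -{1}e2; ring.
have c20 : c2 = 0.
  by apply: (mulfI n13); rewrite mulr0 -[RHS](subrr 0) -{1}h2 -{1}h1; ring.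
have c10 : c1 = 0 by rewrite -h1 c20 mul0r addr0.
by split => //; rewrite -e1 c10 c20 !mul0r !addr0.
Qed.

Definition model_h theta gamma s : R[i] :=
  (theta + gamma * (s / (gamma ^+ 2 + 1))) +i* (s / (gamma ^+ 2 + 1)).

Definition model_mu theta gamma s : \bar R :=
  if gamma == 0 then +oo%E else (theta + s / gamma)%:E.

Lemma sqrD1_gt0 gamma : 0 < gamma ^+ 2 + 1.
Proof. by rewrite ltr_wpDl ?sqr_ge0. Qed.

Lemma model_h_gt0 theta gamma s : 0 < s -> 0 < Im (model_h theta gamma s).
Proof. by move=> s0; rewrite divr_gt0 ?sqrD1_gt0. Qed.

(** Under the first equation the transfer function is affine in phi_z(a); the other two match its
    coefficients with those of V = gamma - s phi_z(a). *)
Lemma model_params theta gamma s (h := model_h theta gamma s) (nu := model_mu theta gamma s) :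
  0 < s ->
  [/\ re_num h (mu_num nu) (mu_den nu) = theta * re_den h (mu_num nu) (mu_den nu),
      Im h / re_den h (mu_num nu) (mu_den nu) * mu_den nu = gamma &
      Im h / re_den h (mu_num nu) (mu_den nu) * (mu_num nu - theta * mu_den nu) = s].
Proof.
move=> s0; have g0 : gamma ^+ 2 + 1 != 0 by rewrite gt_eqF// sqrD1_gt0.
have sn : s != 0 by rewrite gt_eqF.
rewrite /nu /model_mu /re_num /re_den /h /model_h; have [gz|gn] := eqVneq gamma 0.
  rewrite /mu_num /mu_den gz expr0n /= add0r divr1 !(mul0r, mulr0, subr0, addr0, divr1).
  by rewrite !mul1r !mulr1.
have xE : theta + s / gamma - (theta + gamma * (s / (gamma ^+ 2 + 1))) =
  s / (gamma * (gamma ^+ 2 + 1)) by field; rewrite g0 gn.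
have xn : s / (gamma * (gamma ^+ 2 + 1)) != 0 by rewrite mulf_neq0// invr_eq0 mulf_neq0.
by rewrite /= !mul1r !mulr1 xE; split; field; rewrite ?gn ?g0 ?sn.
Qed.

(** The coordinates of mu are identified rather than mu itself, since +oo and -oo give the same
    operator. *)
Lemma params_unique theta gamma s h nu (m0 := mu_num nu) (m1 := mu_den nu) : 0 < s -> 0 < Im h ->
  re_num h m0 m1 = theta * re_den h m0 m1 ->
  gamma * re_den h m0 m1 = Im h * m1 ->
  s * re_den h m0 m1 = Im h * (m0 - theta * m1) ->
  [/\ h = model_h theta gamma s, m0 = mu_num (model_mu theta gamma s) &
      m1 = mu_den (model_mu theta gamma s)].
Proof.
move=> s0 h0 e0 e1 e2; have sn : s != 0 by rewrite gt_eqF.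
have g0 : gamma ^+ 2 + 1 != 0 by rewrite gt_eqF// sqrD1_gt0.
have hn : Im h != 0 by rewrite gt_eqF.
have x1n0 : re_den h m0 m1 != 0.
  have := pnorm_gt0 hn (mu_neq0 nu); rewrite /pnorm -/m0 -/m1 e0; apply: contraTneq => ->.
  by rewrite !mulr0 subrr ltxx.
(* By [e1] and [e2] both m0 and m1 are multiples of x = re_den, so x cancels from re_den and re_num
   and two equations in h alone remain. *)
have [x hx] : exists x, re_den h m0 m1 = x by exists (re_den h m0 m1).
rewrite hx in e0 e1 e2 x1n0.
have m1E : m1 = gamma * x / Im h by rewrite e1 mulrAC divff// mul1r.
have m0E : m0 = x * (s + theta * gamma) / Im h.
  have -> : m0 = (Im h * (m0 - theta * m1)) / Im h + theta * m1 by field.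
  by rewrite -e2 m1E; field.
have k1 : Im h = s + theta * gamma - gamma * Re h.
  apply: (mulfI x1n0); rewrite -{1}hx /re_den m0E m1E.
  by field.
have k2 : (s + theta * gamma) * Re h - gamma * (Re h ^+ 2 + Im h ^+ 2) = theta * Im h.
  apply: (mulfI x1n0); have := e0; rewrite /re_num {1}m0E {1}m1E => e.
  transitivity (Im h * (theta * x)); last by ring.
  by rewrite -e; field.
have k3 : Re h = theta + gamma * Im h.
  apply: (mulfI hn); rewrite {1}k1 mulrDr [Im h * theta]mulrC -k2; ring.
have k4 : Im h = s / (gamma ^+ 2 + 1).
  apply: (mulIf g0); rewrite divfK//.
  have -> : Im h * (gamma ^+ 2 + 1) = Im h + gamma * (gamma * Im h) by ring.
  by rewrite {1}k1 k3; ring.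
split.
- by apply: complexP; rewrite ?k3 k4.
(* The coordinate m1 is 0 or 1, and it vanishes exactly when gamma does; this normalization recovers
   m0 from the ratio m0 / m1. *)
- rewrite /model_mu; case: eqVneq => [gz|gn].
    have m10 : m1 = 0 by rewrite m1E gz !mul0r.
    by move: m10; rewrite /m0 /m1; case: nu {m0 m1 e0 e1 e2 x1n0 m1E m0E hx} => //= r /eqP; rewrite oner_eq0.
  have m1n : m1 != 0 by rewrite m1E !mulf_neq0 ?invr_eq0.
  have : m0 = (theta + s / gamma) * m1 by rewrite {1}m0E {1}m1E; field; rewrite hn gn.
  by move: m1n; rewrite /m0 /m1; case: nu {m0 m1 e0 e1 e2 x1n0 m1E m0E k1 k2 hx} => /= [r _ ->| |]; rewrite ?mulr1 ?eqxx.
- rewrite /model_mu; case: eqVneq => [gz|gn]; first by rewrite m1E gz !mul0r.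
  have : m1 != 0 by rewrite m1E !mulf_neq0 ?invr_eq0.
  by rewrite /m1; case: nu {m0 m1 e0 e1 e2 x1n0 m1E m0E k1 k2 hx} => //=; rewrite eqxx.
Qed.

End parameters.

Theorem theorem5p5 (R : realType) (a : R) (q : R -> R) (theta gamma : R)
    (sigma : distr_fun R) (V : R[i] -> R[i])
    (q_loc : locally_summable a q)
    (B_sym : symmetric_op lebesgue_measure `[a, +oo[ (B_op a q))
    (B_def : deficiency_indices_11 lebesgue_measure `[a, +oo[ (B_op a q))
    (Bt_sa : selfadjoint_op lebesgue_measure `[a, +oo[ (T_op a q theta%:C))
    (Bt_pos : nonneg_op lebesgue_measure `[a, +oo[ (T_op a q theta%:C))
    (V_SL0 : SL0 V gamma sigma)
    (sigma_pair : pair_distribution a sigma (T_op a q theta%:C) (B_op a q)) :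
  exists (h : R[i]) (A : pmop) (K : channel),
    schr_realization a q V h A K /\
    forall (h' : R[i]) (A' : pmop) (K' : channel),
      schr_realization a q V h' A' K' ->
      [/\ h' = h,
          forall y, Dstar a q y -> eq_Hminus a q (A' y) (A y) &
          forall c, eq_Hminus a q (K' c) (K c)].
Proof.
case: V_SL0 => inf1 int1 VE.
have [s s0 W] := weyl_formula q_loc B_def Bt_sa int1 sigma_pair.
have sn : s != 0 by rewrite gt_eqF.
have VW z phi : ~~ (0 <= z) -> is_weyl a q theta z phi -> V z = gamma%:C - s%:C * phi a.
  move=> nz hp; rewrite VE// (W _ _ nz hp) mulNr mulrN opprK mulrA -rmorphM divff//.
  by rewrite rmorph1 mul1r.
pose h := model_h theta gamma s; pose nu := model_mu theta gamma s.
have h0 : 0 < Im h by exact: model_h_gt0.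
have [P1 P2 P3] := model_params theta gamma s0.
pose K : @channel R := fun c w => c * g_form a h nu w.
have HA y : Dstar a q y -> eq_Hminus a q (A_form a q h nu y) (A_form a q h nu y) by [].
have HK c : eq_Hminus a q (K c) (fun w => c * g_form a h nu w) by [].
exists h, (A_form a q h nu), K; split.
  split; first exact: h0.
  - exists nu; split; first exact: HA.
    split; last exact: HK.
    exact: (g_form_Hminus q_loc B_def Bt_sa).
  - exact: (livsic_system_intro q_loc B_def Bt_sa sigma_pair h0 HA HK).
  move=> z nz; have [phi hp] := pair_weyl_ex q_loc B_def Bt_sa sigma_pair nz.
  have := transfer_ex q_loc B_def Bt_sa sigma_pair h0 HA HK P1 nz hp.
  rewrite (VW _ _ nz hp) mulrBr mulrA -!rmorphM /=.
  by rewrite P2 P3.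
move=> h' A' K' [h'0 [nu' [HA' [_ HK']]] _ real].
(* At z = -b the left side of [transfer_eq] is the product of V = gamma - s p with an affine
   function of p = phi_z(a), whence a quadratic equation in the real number p. *)
have eqn b : 0 < b -> (gamma * re_den h' (mu_num nu') (mu_den nu') - Im h' * mu_den nu') +
    (gamma * (theta * re_den h' (mu_num nu') (mu_den nu') - re_num h' (mu_num nu') (mu_den nu'))
     - s * re_den h' (mu_num nu') (mu_den nu') + Im h' * (mu_num nu' - theta * mu_den nu')) *
      - (s^-1 * stieltjes sigma b) +
    - s * (theta * re_den h' (mu_num nu') (mu_den nu') - re_num h' (mu_num nu') (mu_den nu')) *
      (- (s^-1 * stieltjes sigma b)) ^+ 2 = 0.
  move=> b0; have nz := neg_not_ge0 b0.
  have [phi hp] := pair_weyl_ex q_loc B_def Bt_sa sigma_pair nz.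
  have := transfer_eq q_loc B_def Bt_sa sigma_pair h'0 HA' HK' nz hp (real _ nz).
  rewrite (VW _ _ nz hp).
  have -> : phi a = (- (s^-1 * stieltjes sigma b))%:C.
    by rewrite (W _ _ nz hp) cintegral_cauchy_kernel// -!rmorphN -rmorphM mulNr.
  move: (re_num _ _ _) (re_den _ _ _) => x0 x1.
  move: (mu_num _) (mu_den _) (- (s^-1 * _)) => m0 m1 p.
  rewrite -!(rmorphM, rmorphB, rmorphD) => /complexI e.
  rewrite -[RHS](subrr (Im h' * (m1 - (m0 - theta * m1) * p))) -{1}e; ring.
have st b b' : 0 < b -> b < b' -> - (s^-1 * stieltjes sigma b) < - (s^-1 * stieltjes sigma b').
  by move=> b0 bb; rewrite ltrN2 ltr_pM2l ?invr_gt0//; exact: stieltjes_dec.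
have l01 : 0 < 1 :> R by []; have l12 : 1 < 2 :> R by rewrite ltr1n.
have l23 : 2 < 3 :> R by rewrite ltr_nat.
have [c0 c1 c2] := quadratic_eq0 (st _ _ l01 l12) (st _ _ (lt_trans l01 l12) l23)
  (eqn _ l01) (eqn _ (lt_trans l01 l12)) (eqn _ (lt_trans (lt_trans l01 l12) l23)).
(* The leading coefficient comes first: it reduces the linear one to the equation [e2]. *)
have e0 : re_num h' (mu_num nu') (mu_den nu') = theta * re_den h' (mu_num nu') (mu_den nu').
  by move/eqP: c2; rewrite mulf_eq0 oppr_eq0 (negbTE sn) subr_eq0 => /eqP ->.
have e1 : gamma * re_den h' (mu_num nu') (mu_den nu') = Im h' * mu_den nu'.
  by apply/eqP; rewrite -subr_eq0 c0.
have e2 : s * re_den h' (mu_num nu') (mu_den nu') = Im h' * (mu_num nu' - theta * mu_den nu').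
  by move/eqP: c1; rewrite e0 subrr mulr0 sub0r addrC subr_eq0 => /eqP.
have [hh mm0 mm1] := params_unique s0 h'0 e0 e1 e2.
split; first exact: hh.
- move=> y Dy w Dw; rewrite HA'//.
  by rewrite !A_formE hh mm0 mm1.
- by move=> c w Dw; rewrite HK'// /K !g_formE /livsic_gain hh mm0 mm1.
Qed.
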